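(* Let $\Omega=B\times(0,\infty)\subset\mathbb{R}^3$ with $B=B(0,1)\subset\mathbb{R}^2$, and let $h\in(0,\infty)$, $M>0$. There exists a positive constant $C=C(h,M)$ such that $$\|\Lambda_\alpha-\Lambda_\beta\|_{H^{1/2}_{rad}(B)\to H^{-1/2}_{rad}(B)}\ \ge\ C\big(|\alpha_2-\beta_2|+|\alpha_1-\beta_1|\big)\qquad\text{for all }\gamma_\alpha,\gamma_\beta\in\mu(h,M).$$
   Context: For $\alpha=(\alpha_1,\alpha_2)$ define on $B\times(0,\infty)$ the conductivity $$\gamma_\alpha(z)=\begin{cases}1+\alpha_1 & \text{if } h\le z<\infty,\\ 1+\alpha_2 & \text{if } 0\le z<h,\end{cases}$$ where $z$ is the coordinate in $(0,\infty)$. $\mu(h,M)$ is the set of all such $\gamma_\alpha$ with $\alpha_1,\alpha_2\in[0,M]$. Function spaces. Let $J_0,J_1$ be the Bessel functions of order $0$ and $1$, and $0<\lambda_1<\lambda_2<\cdots$ the positive zeros of $J_0$. $L^2_{rad}(B)$ is the space of radial functions in $L^2(B)$ (functions of $r=\sqrt{x^2+y^2}$), and $L^2_{rad}(B\times(0,\infty))$ is the space of $L^2$ functions of $(r,z)$ only. For $f\in L^2_{rad}(B)$ put $$\hat f(n)=\frac{2\int_0^1 f(r)J_0(\lambda_n r)\,r\,dr}{J_1(\lambda_n)^2},\qquad n\ge1.$$ $H^{1/2}_{rad}(B)$ is the set of $f\in L^2_{rad}(B)$ with $\|f\|_{H^{1/2}_{rad}(B)}^2=\sum_{n\ge1}(1+\lambda_n^2)^{1/2}|\hat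 f(n)|^2J_1(\lambda_n)^2<\infty$. $H^{-1/2}_{rad}(B)$ is its dual, whose elements are represented by series $\sum_n\hat f(n)J_0(\lambda_n r)$ (acting by $g\mapsto\sum_n\hat f(n)\hat g(n)J_1(\lambda_n)^2$), with norm $\|f\|_{H^{-1/2}_{rad}(B)}^2=\sum_{n\ge1}(1+\lambda_n^2)^{-1/2}|\hat f(n)|^2J_1(\lambda_n)^2$. $H^1_{rad}(B\times(0,\infty))$ is the set of $u\in L^2_{rad}(B\times(0,\infty))$ with $|\nabla u|\in L^2_{rad}(B\times(0,\infty))$. Dirichlet-to-Neumann map. For $f\in H^{1/2}_{rad}(B)$ let $u\in H^1_{rad}(B\times(0,\infty))$ be the unique weak solution of $\nabla\cdot(\gamma_\alpha\nabla u)=0$ in $B\times(0,\infty)$, $u=0$ on $\partial B\times(0,\infty)$, $u=f$ on $B\times\{0\}$. Then $\Lambda_\alpha:H^{1/2}_{rad}(B)\to H^{-1/2}_{rad}(B)$ is $\Lambda_\alpha f=\gamma_\alpha\partial_\nu u|_{z=0}=-(1+\alpha_2)\,\partial_z u|_{z=0}$, where $\nu$ is the exterior unit normal; that is, if $u=\sum_{n\ge1}u_n(z)J_0(\lambda_n r)$, then $\Lambda_\alpha f=-(1+\alpha_2)\sum_{n\ge1}u_n'(0)J_0(\lambda_n r)$. The norm in the claim is the operator norm $\sup_{f\neq0}\|(\Lambda_\alpha-\Lambda_\beta)f\|_{H^{-1/2}_{rad}(B)}/\|f\|_{H^{1/2}_{rad}(B)}$. *)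

(* Defs.v *)
From HB Require Import structures.
From mathcomp Require Import all_boot all_order all_algebra.
From mathcomp Require Import all_classical all_reals all_analysis.
Set Implicit Arguments.
Unset Strict Implicit.
Unset Printing Implicit Defensive.
Import Order.TTheory GRing.Theory Num.Theory.
Import numFieldNormedType.Exports.
Local Open Scope classical_set_scope.
Local Open Scope ring_scope.

Section Bessel.
Context {R : realType}.

Definition besselJ (p : nat) (x : R) : R :=
  limn (series (fun k => (-1) ^+ k / (k`! * (k + p)`!)%:R
                         * (x / 2) ^+ (k.*2 + p))).

(* [bessel_zero n] is lambda_(n+1), the least zero of J_0 beyond the previous
   one; these zeros are infinite in number and isolated, so that the infimum is
   a minimum.  All the sequences below are indexed from 0 accordingly. *)
Fixpoint bessel_zero (n : nat) : R :=
  inf [set x : R | (if n is m.+1 then bessel_zero m else 0) < x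
                   /\ besselJ 0 x = 0].

(* f is the profile of a radial function, i.e. a function of r. *)
Definition bessel_coef (f : R -> R) (n : nat) : R :=
  2 * (\int[lebesgue_measure]_(r in `[0, 1]%classic)
         (f r * besselJ 0 (bessel_zero n * r) * r))
  / besselJ 1 (bessel_zero n) ^+ 2.

(* The H^s_rad(B) norm of sum_n c_n J_0(lambda_n r), for s = 1/2 and -1/2. *)
Definition bessel_norm (s : R) (c : nat -> R) : \bar R :=
  sqrte (\sum_(0 <= n <oo)
    (((1 + bessel_zero n ^+ 2) `^ s * c n ^+ 2
       * besselJ 1 (bessel_zero n) ^+ 2)%:E))%E.

End Bessel.

Section Spaces.
Context {R : realType}.
Local Notation R2 := (R * R)%type.
Local Notation R3 := (R * R * R)%type.

Local Notation leb1 := (@lebesgue_measure R).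
Local Notation leb2 := (leb1 \x leb1)%E.
Local Notation leb3 := (leb2 \x leb1)%E.

Definition disk : set R2 := [set q | q.1 ^+ 2 + q.2 ^+ 2 < 1].
Definition cylinder : set R3 := [set p | disk p.1 /\ 0 < p.2].

Definition L2 d (T : measurableType d) (mu : set T -> \bar R) (D : set T)
    (f : T -> R) : Prop :=
  measurable_fun D f /\ (\int[mu]_(x in D) (f x ^+ 2)%:E < +oo)%E.

Definition cvgL2 d (T : measurableType d) (mu : set T -> \bar R) (D : set T)
    (v : nat -> T -> R) (f : T -> R) : Prop :=
  ((\int[mu]_(x in D) ((v k x - f x) ^+ 2)%:E)%E @[k --> \oo] --> 0%E).

Definition unit3 (i : 'I_3) : R3 :=
  ((i == 0%N :> nat)%:R, (i == 1%N :> nat)%:R, (i == 2%N :> nat)%:R).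

Definition partial (i : 'I_3) (v : R3 -> R) (p : R3) : R := 'D_(unit3 i) v p.

Definition C1 (v : R3 -> R) : Prop :=
  continuous v /\
  forall i, (forall p, derivable v p (unit3 i)) /\ continuous (partial i v).

Definition C1c (O : set R3) (v : R3 -> R) : Prop :=
  C1 v /\ exists2 K : set R3, compact K /\ K `<=` O &
    forall p, ~ K p -> v p = 0.

Definition weak_partial (i : 'I_3) (u g : R3 -> R) : Prop :=
  forall v, C1c cylinder v ->
    \int[leb3]_(p in cylinder) (u p * partial i v p) =
    - \int[leb3]_(p in cylinder) (g p * v p).

Definition H1 (u : R3 -> R) (Du : 'I_3 -> R3 -> R) : Prop :=
  L2 leb3 cylinder u /\
  forall i, L2 leb3 cylinder (Du i) /\ weak_partial i u (Du i).

(* u, with weak gradient Du, has trace g on the bottom {z = 0} and l on the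
   lateral boundary, the latter being parametrized by the angle and z.  The trace
   operator is the extension by density of the restriction of C^1_c(R^3)
   functions to the boundary. *)
Definition has_trace (u : R3 -> R) (Du : 'I_3 -> R3 -> R)
    (g : R2 -> R) (l : R2 -> R) : Prop :=
  exists v : nat -> R3 -> R,
    [/\ forall k, C1c setT (v k),
        cvgL2 leb3 cylinder v u,
        forall i, cvgL2 leb3 cylinder (fun k => partial i (v k)) (Du i),
        cvgL2 leb2 disk (fun k q => v k (q, 0)) g &
        cvgL2 leb2 (`[0, 2 * pi]%classic `*` `]0, +oo[%classic)
          (fun k tz => v k (cos tz.1, sin tz.1, tz.2)) l].

Definition radial2 (f : R -> R) (q : R2) : R :=
  f (Num.sqrt (q.1 ^+ 2 + q.2 ^+ 2)).

Definition radial3 (U : R -> R -> R) (p : R3) : R :=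
  radial2 (U ^~ p.2) p.1.

Definition Hhalf_rad (f : R -> R) : Prop :=
  L2 leb2 disk (radial2 f) /\ (bessel_norm (1 / 2) (bessel_coef f) < +oo)%E.

Definition conductivity (h : R) (a : R2) (z : R) : R :=
  if h <= z then 1 + a.1 else 1 + a.2.

(* The test functions range over H^1_0 of the cylinder, and need not be
   radial. *)
Definition weak_solution (h : R) (a : R2) (f : R -> R) (U : R -> R -> R) : Prop :=
  exists2 Du : 'I_3 -> R3 -> R,
    H1 (radial3 U) Du /\ has_trace (radial3 U) Du (radial2 f) (fun=> 0) &
    forall v Dv, H1 v Dv -> has_trace v Dv (fun=> 0) (fun=> 0) ->
      \int[leb3]_(p in cylinder)
        (conductivity h a p.2 * \sum_(i < 3) Du i p * Dv i p) = 0.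

(* u_n(z) is defined for almost every z only; its derivative at 0 is the right
   derivative of its continuous representative w n. *)
Definition is_DN (h : R) (a : R2) (f : R -> R) (c : nat -> R) : Prop :=
  exists2 U, weak_solution h a f U &
    forall n, exists w : R -> R, exists d : R,
      [/\ {ae leb1, forall z, 0 < z -> w z = bessel_coef (U ^~ z) n},
          {within `[0, +oo[%classic, continuous w},
          t^-1 * (w t - w 0) @[t --> 0^'+] --> d &
          c n = - (1 + a.2) * d].

(* The coefficients of Lambda_a f in sum_n c_n J_0(lambda_n r).  For f in
   H^(1/2)_rad(B) there is exactly one sequence satisfying [is_DN]. *)
Definition DN (h : R) (a : R2) (f : R -> R) : nat -> R :=
  xget (fun=> 0) (is_DN h a f).

(* The norm of a linear operator from H^(1/2)_rad(B) to H^(-1/2)_rad(B), whose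
   values are given by their coefficients. *)
Definition op_norm (L : (R -> R) -> nat -> R) : \bar R :=
  ereal_sup [set (bessel_norm (- (1 / 2)) (L f)
                  * ((fine (bessel_norm (1 / 2) (bessel_coef f)))^-1)%:E)%E
            | f in [set f | Hhalf_rad f
                            /\ bessel_norm (1 / 2) (bessel_coef f) != 0%E]].

End Spaces.

(* Main.v *)
(* For the boundary value [J_0 (lambda r)], with [lambda] a zero of [J_0], the
   equation separates: its solution is [J_0 (lambda r)] times a piecewise
   exponential function of [z], and the Dirichlet-to-Neumann map multiplies this
   boundary value by [lambda] times the admittance
     [k_2 (k_1 + k_2 T) / (k_2 + k_1 T)],  [T = tanh (lambda h)],  [k_i = 1 + a_i].
   Testing the operator norm on the first two zeros bounds from below the
   differences of the admittances for two values of [T]; the values at two distinct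
   [T] determine [k_1] and [k_2] in a Lipschitz way for [1 <= k_i <= 1 + M].

   That the weak solution, taken in the sense of traces, is the explicit one is an
   energy argument.  A weak solution with zero data is its own test function, so
   that its vertical derivative vanishes, and so does the solution, by a
   Poincare inequality with weight [exp (- z)].  That the explicit function is a weak
   solution rests on a conjugation: up to constants, the flux of the profile with
   contrast [k_1 / k_2] is the profile with contrast [k_2 / k_1], and conversely, so
   that no integration by parts across the interface is needed. *)

(* Traces and weak gradients are defined through C^1_c approximations, whereas the solution has a
   kink at [z = h] and unbounded support, and is tested against functions that need not be radial.
   Hence every integral identity is proved for C^1_c functions, by an explicit divergence theorem in
   the cylinder, and then passed to the L^2 limit; the kink is smoothed by [softpos] and the support
   cut by [cutoff].

   The weight in the Poincare inequality answers the infinite height: on a half-line the vertical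
   derivative alone does not control the function in L^2, but differentiating the weight produces
   the missing term.

   One admittance is a single equation in [k_1] and [k_2], whence two modes; they give distinct [T]
   because the zeros are distinct.

   [DN] is a choice among the sequences satisfying [is_DN], so its value is known only once there is
   exactly one such sequence. Uniqueness of the weak solution holds almost everywhere in space and
   has to be carried to the Bessel coefficients at almost every height; this is the role of the
   polar null sets. Continuity in [z] then determines the derivative at 0. *)
From HB Require Import structures.
Require Import Defs.
From mathcomp Require Import all_boot all_order all_algebra.
From mathcomp Require Import all_classical all_reals all_analysis.
From mathcomp Require Import measurable_realfun.
From mathcomp Require Import ring lra.
Set Implicit Arguments.
Unset Strict Implicit.
Unset Printing Implicit Defensive.
Import Order.TTheory GRing.Theory Num.Theory.
Import numFieldNormedType.Exports.
Local Open Scope classical_set_scope.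
Local Open Scope ring_scope.

(** * Calculus on the real line *)

Section Derivation.
Context {R : realType}.
Implicit Types (f g : R -> R) (x a b : R).

(** The rules are restated for functions written pointwise, so that a derivative is assembled from
    proof terms and only a final identity is left to [ring] or [field]. *)
Lemma is_derive_fcst x a : is_derive x 1 (fun=> a) 0.
Proof. exact: is_derive_cst. Qed.

Lemma is_derive_fid x : is_derive x 1 (fun t => t) 1.
Proof. exact: is_derive_id. Qed.

Lemma is_derive_fD f g x a b : is_derive x 1 f a -> is_derive x 1 g b ->
  is_derive x 1 (fun t => f t + g t) (a + b).
Proof. by move=> fa gb; exact: is_deriveD. Qed.

Lemma is_derive_fN f x a : is_derive x 1 f a -> is_derive x 1 (fun t => - f t) (- a).
Proof. by move=> fa; exact: is_deriveN. Qed.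

Lemma is_derive_fM f g x a b : is_derive x 1 f a -> is_derive x 1 g b ->
  is_derive x 1 (fun t => f t * g t) (a * g x + f x * b).
Proof.
move=> fa gb.
have /is_derive_eq : is_derive x 1 (f * g) (f x *: b + g x *: a) by exact: is_deriveM.
by apply; rewrite -![_ *: _]/(_ * _); ring.
Qed.

Lemma is_derive_fX f n x a : is_derive x 1 f a ->
  is_derive x 1 (fun t => f t ^+ n.+1) (n.+1%:R * f x ^+ n * a).
Proof.
move=> fa; elim: n => [|n ih].
  by apply: is_derive_eq fa _; rewrite expr0 !mul1r.
under eq_fun do rewrite exprS.
apply: (is_derive_eq (is_derive_fM fa ih)).
by rewrite -[n.+2]add1n natrD exprS; ring.
Qed.

Lemma is_derive_fcomp g f x a b : is_derive (f x) 1 g b -> is_derive x 1 f a ->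
  is_derive x 1 (fun t => g (f t)) (b * a).
Proof. by move=> gb fa; exact: (is_derive1_comp (f := g) (g := f)). Qed.

Lemma is_derive_fV f x a : f x != 0 -> is_derive x 1 f a ->
  is_derive x 1 (fun t => (f t)^-1) (- a / f x ^+ 2).
Proof.
move=> f0 fa; have := @is_deriveV R f x a 1 f0 fa.
by move/is_derive_eq; apply; rewrite -![_ *: _]/(_ * _) mulNr mulNr [in LHS]mulrC.
Qed.

Lemma is_derive_continuous f x a : is_derive x 1 f a -> {for x, continuous f}.
Proof.
by move=> [fx _]; apply/differentiable_continuous; exact/derivable1_diffP.
Qed.

Lemma is_derive_derive1 f x a : is_derive x 1 f a -> derive1 f x = a.
Proof. by move=> [_ fa]; rewrite derive1E. Qed.

End Derivation.

Section FTC.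
Context {R : realType}.
Notation mu := (@lebesgue_measure R).
Implicit Types (F f : R -> R) (x a b : R).

Lemma within_continuous (f : R -> R) (A : set R) :
  (forall x, A x -> {for x, continuous f}) -> {within A, continuous f}.
Proof.
by move=> cf; apply/subspace_continuousP => x Ax; apply: cvg_within_filter; exact: cf.
Qed.

Lemma integral_derive F f a b : a <= b ->
  (forall x, a <= x <= b -> is_derive x 1 F (f x)) ->
  (forall x, a <= x <= b -> {for x, continuous f}) ->
  (\int[mu]_(x in `[a, b]) (f x)%:E = (F b - F a)%:E)%E.
Proof.
rewrite le_eqVlt => /predU1P[->|ab] dF cf.
  by rewrite set_itv1 integral_set1 subrr.
have cF x : a <= x <= b -> {for x, continuous F}.
  by move=> xab; apply: is_derive_continuous; exact: dF.
rewrite EFinB; apply: continuous_FTC2 => //.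
- by apply: within_continuous => x /=; rewrite in_itv; exact: cf.
- split.
  + by move=> x; rewrite in_itv/= => /andP[ax xb]; apply: ex_derive; apply: dF; rewrite !ltW.
  + by apply: cvg_at_right_filter; apply: cF; rewrite lexx ltW.
  + by apply: cvg_at_left_filter; apply: cF; rewrite lexx ltW.
- move=> x; rewrite in_itv/= => /andP[ax xb]; apply: is_derive_derive1.
  by apply: dF; rewrite !ltW.
Qed.

Lemma Rintegral_derive F f a b : a <= b ->
  (forall x, a <= x <= b -> is_derive x 1 F (f x)) ->
  (forall x, a <= x <= b -> {for x, continuous f}) ->
  \int[mu]_(x in `[a, b]) f x = F b - F a.
Proof. by move=> *; rewrite /Rintegral (@integral_derive F). Qed.

Lemma is_derive_ndecr F f a b : a <= b ->
  (forall x, a <= x <= b -> is_derive x 1 F (f x)) ->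
  (forall x, a <= x <= b -> 0 <= f x) -> F a <= F b.
Proof.
move=> ab dF f0; rewrite -subr_ge0.
have [||c] := @MVT_segment R F f a b ab.
- by move=> x; rewrite in_itv/= => /andP[ax xb]; apply: dF; rewrite !ltW.
- apply: within_continuous => x /=; rewrite in_itv/= => xab.
  by apply: is_derive_continuous; exact: dF.
- by rewrite in_itv/= => cab ->; rewrite mulr_ge0 ?subr_ge0// f0.
Qed.

(** The integral from [- L] serves, whence the bounded interval; the applications need a
    neighbourhood of [-1, 1] or of [0, 2 pi] only. *)
Lemma exists_primitive (f : R -> R) (L : R) : continuous f ->
  exists F : R -> R, forall x, -L < x < L -> is_derive x 1 F (f x).
Proof.
move=> cf.
exists (fun x => \int[mu]_(t in `[- L, x]) f t) => x /andP[Lx xL].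
have fL : mu.-integrable `[- L, L] (EFin \o f).
  apply: continuous_compact_integrable; first exact: segment_compact.
  exact: continuous_subspaceT.
have [dF F'] := @continuous_FTC1_closed R f (- L) x L xL fL Lx (cf x).
by apply: DeriveDef; [exact: dF|rewrite -derive1E; exact: F'].
Qed.

End FTC.

(** * Bessel functions *)

Section Bessel.
Context {R : realType}.
Implicit Types (p k n : nat) (t x : R).

Definition bcoef p k : R := (-1) ^+ k / (k`! * (k + p)`!)%:R.

(* The Bessel functions in the variable [t = x ^ 2 / 4]:
   [J_p x = (x / 2) ^ p * bfun p (x ^ 2 / 4)]. *)
Definition bfun p t : R := limn (pseries (bcoef p) t).

(** As [k! (k + p)! >= k!], the exponential series at [|t|] dominates. *)
Lemma is_cvg_bfun p t : cvgn (pseries (bcoef p) t).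
Proof.
apply: normed_cvg; apply: series_le_cvg (is_cvg_series_exp_coeff `|t|).
- by move=> n; exact: normr_ge0.
- by move=> n; rewrite exp_coeffE /= mulr_ge0// ?exprn_ge0// invr_ge0.
move=> n; rewrite exp_coeffE /= normrM normrX ler_wpM2r ?exprn_ge0//.
rewrite /bcoef normrM normrX normrN1 expr1n mul1r normfV normr_nat.
by rewrite lef_pV2 ?posrE ?ltr0n ?muln_gt0 ?fact_gt0// ler_nat leq_pmulr ?fact_gt0.
Qed.

Lemma cvg_bfun p t : pseries (bcoef p) t @ \oo --> bfun p t.
Proof. exact: is_cvg_bfun. Qed.

(** Cancelling [k + 1] against [(k + 1)!] turns the order [p] into [p + 1], with a change of sign.
    In the variable [t], differentiation is thus a shift of the order with no division by [x]. *)
Lemma pseries_diffs_bcoef p : pseries_diffs (bcoef p) = - bcoef p.+1.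
Proof.
apply/funext => k; rewrite /pseries_diffs /bcoef /= opprfctE addnS addSn.
rewrite (factS k) exprS mulN1r mulNr mulrN -mulnA natrM invfM; congr (- _).
by rewrite mulrCA [X in _ * X]mulrA mulfV ?mul1r.
Qed.

Lemma pseriesN (f : nat -> R) t : pseries (- f) t = - pseries f t.
Proof.
apply/funext => n.
rewrite -[RHS]/(- \sum_(0 <= i < n) f i * t ^+ i) -sumrN.
by apply: eq_bigr => i _; rewrite -mulNr.
Qed.

Lemma is_derive_bfun p t : is_derive t 1 (bfun p) (- bfun p.+1 t).
Proof.
have cvN q K : cvgn (- pseries (bcoef q) K).
  by apply: is_cvgN; exact: is_cvg_bfun.
have dd : pseries_diffs (pseries_diffs (bcoef p)) = bcoef p.+2.
  by rewrite pseries_diffs_bcoef pseries_diffsN pseries_diffs_bcoef opprK.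
have cK : `|t| < `| `|t| + 1| by rewrite [ltRHS]ger0_norm// ltrDl.
have := @pseries_snd_diffs R (bcoef p) (`|t| + 1) t.
rewrite dd pseries_diffs_bcoef !pseriesN.
move=> /(_ (@is_cvg_bfun _ _)) /(_ (cvN _ _)) /(_ (@is_cvg_bfun _ _)) /(_ cK).
by rewrite limN; last exact: is_cvg_bfun.
Qed.

Lemma continuous_bfun p : continuous (bfun p).
Proof. by move=> t; apply: is_derive_continuous; exact: is_derive_bfun. Qed.

(** In the variable [x] this is J_0 + J_2 = (2 / x) J_1. As the first two derivatives of [bfun 0]
    are [- bfun 1] and [bfun 2], it is also Bessel's equation of order 0. *)
Lemma bfun_rec t : bfun 0 t = bfun 1 t - t * bfun 2 t.
Proof.
(* An exact identity between partial sums: the factor [t] shifts the degree by one, so that the last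
   sum has one term fewer. *)
have E n : pseries (bcoef 0) t n.+1 =
           pseries (bcoef 1) t n.+1 - t * pseries (bcoef 2) t n.
  rewrite /pseries /series /=; elim: n => [|n ih].
    by rewrite !big_nat1 big_geq// mulr0 subr0 /bcoef !addn0 !addn1.
  rewrite big_nat_recr//= ih [in RHS]big_nat_recr//= [X in _ = _ - t * X]big_nat_recr//=.
  rewrite mulrDr opprD addrACA; congr (_ + _).
  rewrite /bcoef !addn0 addn1 addn2 !(factS n.+1) !(factS n) !natrM !exprS.
  have /lt0r_neq0 n0 : (0 : R) < n`!%:R by rewrite ltr0n fact_gt0.
  by field; rewrite n0 !lt0r_neq0 ?ltr_pwDl.
apply: cvg_lim; first exact: norm_hausdorff.
rewrite -cvg_shiftS.
rewrite (_ : (fun n => _) = fun n => pseries (bcoef 1) t n.+1 - t * pseries (bcoef 2) t n); last first.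
  by apply/funext => n; rewrite /= E.
apply: cvgB; first by rewrite (cvg_shiftS (pseries (bcoef 1) t)); exact: cvg_bfun.
by apply: cvgMr; exact: cvg_bfun.
Qed.

Lemma bfun0_0 : bfun 0 0 = 1.
Proof.
apply: cvg_lim; first exact: norm_hausdorff.
rewrite -cvg_shiftS.
rewrite (_ : (fun n => _) = cst 1); first exact: cvg_cst.
apply/funext => n; rewrite /pseries /series /= big_nat_recl//= big1 ?addr0.
  by rewrite /bcoef expr0 addn0 fact0 muln1 divr1 mulr1.
by move=> i _; rewrite expr0n mulr0.
Qed.

Lemma besselJE p x : besselJ p x = (x / 2) ^+ p * bfun p (x ^+ 2 / 4).
Proof.
rewrite /besselJ -[RHS](@lim_seriesZ R (fun k => bcoef p k * (x ^+ 2 / 4) ^+ k)); last first.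
  exact: is_cvg_bfun.
congr (limn (series _)); apply/funext => k.
transitivity ((x / 2) ^+ p * (bcoef p k * (x ^+ 2 / 4) ^+ k)); last by [].
rewrite /bcoef exprD -mul2n exprM.
by rewrite (_ : (x / 2) ^+ 2 = x ^+ 2 / 4); [ring|field].
Qed.

Lemma besselJ0E x : besselJ 0 x = bfun 0 (x ^+ 2 / 4).
Proof. by rewrite besselJE mul1r. Qed.

Lemma besselJ1E x : besselJ 1 x = x / 2 * bfun 1 (x ^+ 2 / 4).
Proof. by rewrite besselJE expr1. Qed.

Lemma besselJ00 : besselJ 0 (0 : R) = 1.
Proof. by rewrite besselJ0E expr0n mul0r bfun0_0. Qed.

Lemma is_derive_sqr4 x : is_derive x 1 (fun t => t ^+ 2 / 4 : R) (x / 2).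
Proof.
apply: (is_derive_eq (is_derive_fM (is_derive_fX 1 (is_derive_fid x)) (is_derive_fcst x _))).
by field.
Qed.

Lemma is_derive_besselJ0 x : is_derive x 1 (besselJ 0) (- besselJ 1 x).
Proof.
rewrite (_ : besselJ 0 = fun t => bfun 0 (t ^+ 2 / 4)); last first.
  by apply/funext => t; exact: besselJ0E.
apply: (is_derive_eq (is_derive_fcomp (is_derive_bfun _ _) (is_derive_sqr4 x))).
by rewrite besselJ1E; ring.
Qed.

(** The factor [t] absorbs the division by [x] in the rule for the derivative of J_1, so that the
    point 0 is included. *)
Lemma is_derive_besselJ1 x :
  is_derive x 1 (fun t => t * besselJ 1 t) (x * besselJ 0 x).
Proof.
rewrite (_ : (fun t => _) = fun t => t ^+ 2 / 2 * bfun 1 (t ^+ 2 / 4)); last first.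
  by apply/funext => t; rewrite besselJ1E; field.
have d2 : is_derive x 1 (fun t => t ^+ 2 / 2 : R) x.
  apply: (is_derive_eq (is_derive_fM (is_derive_fX 1 (is_derive_fid x)) (is_derive_fcst x _))).
  by field.
apply: (is_derive_eq (is_derive_fM d2 (is_derive_fcomp (is_derive_bfun _ _) (is_derive_sqr4 x)))).
by rewrite besselJ0E bfun_rec; field.
Qed.

Lemma is_derive_besselJ1_neq0 x : x != 0 ->
  is_derive x 1 (besselJ 1) (besselJ 0 x - besselJ 1 x / x).
Proof.
move=> x0.
have d1 : is_derive x 1 (fun t => (t / 2 : R)) (1 / 2).
  by apply: (is_derive_eq (is_derive_fM (is_derive_fid x) (is_derive_fcst x _))); ring.
rewrite (_ : besselJ 1 = fun t => t / 2 * bfun 1 (t ^+ 2 / 4)); last first.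
  by apply/funext => t; exact: besselJ1E.
apply: (is_derive_eq (is_derive_fM d1 (is_derive_fcomp (is_derive_bfun _ _) (is_derive_sqr4 x)))).
by rewrite besselJ0E bfun_rec; field.
Qed.

Lemma continuous_besselJ0 : continuous (@besselJ R 0).
Proof. by move=> x; apply: is_derive_continuous; exact: is_derive_besselJ0. Qed.

Lemma continuous_besselJ1 : continuous (@besselJ R 1).
Proof.
rewrite (_ : besselJ 1 = fun t => t / 2 * bfun 1 (t ^+ 2 / 4)); last first.
  by apply/funext => t; exact: besselJ1E.
move=> x; apply: cvgM; first by apply: cvgMl; exact: cvg_id.
apply: (cvg_comp _ (bfun 1)); last exact: continuous_bfun.
exact: is_derive_continuous (is_derive_sqr4 x).
Qed.

End Bessel.

(** * Zeros of J_0 and orthogonality of the modes *)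

Section BesselZeros.
Context {R : realType}.
Implicit Types (x p l m : R) (n : nat).
Notation J0 := (@besselJ R 0).
Notation J1 := (@besselJ R 1).

(** Twice Lommel's primitive of [x * J0 x ^ 2]. It serves to show that the zeros are simple and to
    compute the norms of the modes. *)
Definition bessel_energy x : R := (x * J1 x) ^+ 2 + (x * J0 x) ^+ 2.

Lemma is_derive_bessel_energy x :
  is_derive x 1 bessel_energy (2 * x * J0 x ^+ 2).
Proof.
have d1 := is_derive_besselJ1 x; have d0 := is_derive_besselJ0 x.
apply: (is_derive_eq (is_derive_fD (is_derive_fX 1 d1)
  (is_derive_fX 1 (is_derive_fM (is_derive_fid x) d0)))).
by ring.
Qed.

(** If J_0 and J_1 vanished together at [l], the energy would be 0 there; but it is nondecreasing
    for [x >= 0], and positive for small [x > 0], where J_0 is close to 1. *)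
Lemma besselJ1_neq0 l : 0 < l -> J0 l = 0 -> J1 l != 0.
Proof.
move=> l0 Jl; apply/eqP => J1l.
have : \forall x \near (0 : R), 0 < J0 x.
  by apply: cvgr_gt (@continuous_besselJ0 R 0) _ _; rewrite besselJ00 ltr01.
move=> /nbhs_ballP[e /= e0 He].
pose d := Num.min (e / 2) l.
have d0 : 0 < d by rewrite lt_min l0 divr_gt0.
have Jd : 0 < J0 d.
  apply: He; rewrite /ball /= sub0r normrN gtr0_norm//.
  by rewrite gt_min ltr_pdivrMr// ltr_pMr// ltr1n.
have dl : d <= l by rewrite ge_min lexx orbT.
have := @is_derive_ndecr R bessel_energy (fun x => 2 * x * J0 x ^+ 2) d l dl.
move=> /(_ (fun x _ => is_derive_bessel_energy x)).
have le0 x : d <= x <= l -> 0 <= 2 * x * J0 x ^+ 2.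
  by move=> /andP[dx _]; rewrite mulr_ge0 ?sqr_ge0// mulr_ge0// (le_trans _ dx)// ltW.
move=> /(_ le0); apply/negP; rewrite -ltNge /bessel_energy Jl J1l !mulr0 expr0n/= addr0.
by rewrite ltr_pwDr ?sqr_ge0// exprn_gt0// mulr_gt0.
Qed.

(** Sturm comparison: [v = sqrt x * J0 x] solves [v'' + (1 + 1 / (4 x ^ 2)) v = 0], so it oscillates
    at least as fast as [sin (x - X)] and cannot keep a strict sign on an interval of length pi. The
    factor [s] carries the sign. *)
Lemma besselJ0_sturm (s X : R) : 0 < X ->
  ~ (forall x, X <= x <= X + pi -> 0 < s * J0 x).
Proof.
move=> X0 sJ.
(* [W = v' sin (x - X) - v cos (x - X)] is the Wronskian with the sine and
   [w = - v sin (x - X) / (4 x ^ 2)] its derivative. Under the assumption [- s * W] is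
   nondecreasing, yet it goes from a positive to a negative value. *)
pose W x : R := (Num.sqrt x)^-1 / 2 * J0 x * sin (x - X) - Num.sqrt x * J1 x * sin (x - X)
            - Num.sqrt x * J0 x * cos (x - X).
pose w x : R := - ((Num.sqrt x) ^- 3 / 4 * J0 x * sin (x - X)).
have dW x : 0 < x -> is_derive x 1 W (w x).
  move=> x0; have q0 : 0 < Num.sqrt x by rewrite sqrtr_gt0.
  have dq : is_derive x 1 (@Num.sqrt R) (2 * Num.sqrt x)^-1 by exact: is_derive1_sqrt.
  have dqV := is_derive_fV (lt0r_neq0 q0) dq.
  have d0 := is_derive_besselJ0 x.
  have d1 := is_derive_besselJ1_neq0 (lt0r_neq0 x0).
  have dX : is_derive x 1 (fun t => t - X) 1.
    by apply: (is_derive_eq (is_derive_fD (is_derive_fid x) (is_derive_fcst x (- X)))); rewrite addr0.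
  have ds := is_derive_fcomp (f := fun t => t - X) (is_derive_sin (x - X)) dX.
  have dc := is_derive_fcomp (f := fun t => t - X) (is_derive_cos (x - X)) dX.
  have A := is_derive_fM (is_derive_fM (is_derive_fM dqV (is_derive_fcst x 2^-1)) d0) ds.
  have B := is_derive_fM (is_derive_fM dq d1) ds.
  have C := is_derive_fM (is_derive_fM dq d0) dc.
  apply: (is_derive_eq (is_derive_fD (is_derive_fD A (is_derive_fN B)) (is_derive_fN C))).
  rewrite /w /=.
  have xE : x = Num.sqrt x ^+ 2 by rewrite sqr_sqrtr// ltW.
  have -> : J1 x / x = J1 x / Num.sqrt x ^+ 2 by rewrite -xE.
  by field; rewrite lt0r_neq0.
have Xpi : X <= X + pi by rewrite lerDl pi_ge0.
have pos x : X <= x <= X + pi -> 0 < x.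
  by move=> /andP[Xx _]; rewrite (lt_le_trans X0).
have h1 x : X <= x <= X + pi -> is_derive x 1 (fun x => - s * W x) (- s * w x).
  move=> xX; apply: (is_derive_eq (is_derive_fM (is_derive_fcst x (- s)) (dW x (pos x xX)))).
  by rewrite mul0r add0r.
have h2 x : X <= x <= X + pi -> 0 <= - s * w x.
  move=> xX; rewrite /w mulrNN.
  rewrite mulrA mulrCA.
  have /andP[Xx xpi] := xX.
  rewrite mulr_ge0//; last by rewrite sin_ge0_pi// subr_ge0 Xx lerBlDl.
  by rewrite mulr_ge0 ?(ltW (sJ _ _))// divr_ge0// invr_ge0 exprn_ge0 ?sqrtr_ge0.
have := @is_derive_ndecr R (fun x => - s * W x) (fun x => - s * w x) X (X + pi) Xpi h1 h2.
rewrite /W subrr sin0 cos0 [X + pi - X]addrAC subrr add0r sinpi cospi.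
have P1 : 0 < Num.sqrt X * (s * J0 X).
  by rewrite mulr_gt0 ?sqrtr_gt0// sJ// lexx Xpi.
have P2 : 0 < Num.sqrt (X + pi) * (s * J0 (X + pi)).
  by rewrite mulr_gt0 ?sqrtr_gt0 ?sJ ?pos// lexx Xpi.
lra.
Qed.

Lemma besselJ0_zero (X : R) : 0 < X -> exists2 x, X <= x & J0 x = 0.
Proof.
move=> X0; apply: contrapT => noz.
have nz x : X <= x -> J0 x != 0.
  by move=> Xx; apply/eqP => Jx; apply: noz; exists x.
(* Without a zero beyond [X], J_0 keeps the sign it has at [X]; the factor [s := J0 X] treats both
   signs at once. *)
apply: (@besselJ0_sturm (J0 X) X X0) => x /andP[Xx xpi].
rewrite lt_neqAle eq_sym mulf_neq0 ?nz// leNgt/=; apply/negP => lt0; apply: noz.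
have cJ : {within `[X, x], continuous J0} by apply: continuous_subspaceT; exact: continuous_besselJ0.
have [|c] := IVT (v := 0) Xx cJ; last by rewrite in_itv/= => /andP[Xc _] Jc; exists c.
rewrite ge_min le_max; move: lt0; have := nz _ (lexx X).
by case: (ltgtP (J0 X) 0) => // J0X _; [rewrite nmulr_rlt0// => /ltW->; rewrite orbT|rewrite pmulr_rlt0// => /ltW->; rewrite orbT].
Qed.

(** Where J_0 does not vanish this is continuity, which includes the start [p = 0] of the recursion.
    At a zero, another zero close by would give, by the mean value theorem, a zero of J_1 in a
    neighbourhood where J_1 has none. *)
Lemma besselJ0_isolated p : 0 <= p -> exists2 e : R, 0 < e &
  forall x, p < x < p + e -> J0 x != 0.
Proof.
move=> p0; have [Jp|Jp] := eqVneq (J0 p) 0; last first.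
  have /nbhs_ballP[e /= e0 He] : \forall x \near p, J0 x != 0.
    exact: (cvgr_neq0 _ (@continuous_besselJ0 R p)).
  exists e => // x /andP[px xe]; apply: He.
  by rewrite /ball /= ltr0_norm ?subr_lt0// opprB ltrBlDl.
have {p0} p0 : 0 < p.
  rewrite lt_neqAle p0 andbT; apply: contra_eqN Jp => /eqP <-.
  by rewrite besselJ00 oner_neq0.
have /nbhs_ballP[e /= e0 He] : \forall x \near p, J1 x != 0.
  by apply: (cvgr_neq0 _ (@continuous_besselJ1 R p)); exact: besselJ1_neq0.
exists e => // x /andP[px xe]; apply/eqP => Jx.
have [||c] := @MVT_segment R J0 (fun t => - J1 t) p x (ltW px).
- by move=> t _; exact: is_derive_besselJ0.
- by apply: continuous_subspaceT; exact: continuous_besselJ0.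
rewrite Jp Jx subrr in_itv/= => /andP[pc cx] /eqP.
rewrite eq_sym mulf_eq0 subr_eq0 (gt_eqF px) orbF oppr_eq0; apply/negP; apply: He.
rewrite /ball /= ler0_norm ?subr_le0// opprB ltrBlDl.
exact: le_lt_trans cx xe.
Qed.

(** Isolation keeps the infimum strictly beyond [p] and continuity puts it among the zeros, so that
    each step of [bessel_zero] reaches the next zero. *)
Lemma next_besselJ0_zero p : 0 <= p ->
  let m := inf [set x : R | p < x /\ J0 x = 0] in p < m /\ J0 m = 0.
Proof.
move=> p0; set S := [set x | _]; move=> m.
have [e e0 He] := besselJ0_isolated p0.
have S0 : S !=set0.
  have [|x px Jx] := @besselJ0_zero (p + 1); first by rewrite ltr_wpDl.
  by exists x; split => //; rewrite (lt_le_trans _ px)// ltrDl.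
have lbe : lbound S (p + e).
  move=> x [px Jx]; rewrite leNgt; apply/negP => xe.
  by move: (He x); rewrite px xe Jx eqxx => /(_ isT).
have hS : has_inf S by split => //; exists (p + e).
have pm : p < m by rewrite (lt_le_trans _ (lb_le_inf S0 lbe))// ltrDl.
split => //; apply/eqP; apply/negPn/negP => Jm.
have /nbhs_ballP[d /= d0 Hd] : \forall x \near m, J0 x != 0.
  exact: (cvgr_neq0 _ (@continuous_besselJ0 R m)).
have [x [px Jx] xm] := inf_adherent d0 hS.
have mx : m <= x by apply: ge_inf => //; case: hS.
move: (Hd x); rewrite Jx eqxx => /(_ _)/negP; apply => //.
by rewrite /ball /= ler0_norm ?subr_le0// opprB ltrBlDl.
Qed.


Lemma bessel_zeroP n : [/\ 0 < @bessel_zero R n, J0 (bessel_zero n) = 0 &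
  @bessel_zero R n < bessel_zero n.+1].
Proof.
have H k : 0 <= (if k is m.+1 then bessel_zero m else 0 : R) ->
    (if k is m.+1 then bessel_zero m else 0 : R) < bessel_zero k /\ J0 (bessel_zero k) = 0.
  by case: k => [|k] k0; exact: next_besselJ0_zero.
have H2 k : (if k is m.+1 then bessel_zero m else 0 : R) < bessel_zero k /\ J0 (bessel_zero k) = 0.
  apply: (H k); elim: k => [//|k ih]; by have [/ltW + _] := H k ih; move/(le_trans ih).
have p0 : 0 < @bessel_zero R n.
  by elim: n => [|n ih]; [case: (H2 0%N)|apply: (lt_trans ih); case: (H2 n.+1)].
by split => //; [case: (H2 n)|case: (H2 n.+1)].
Qed.

Lemma bessel_zero_gt0 n : 0 < @bessel_zero R n.
Proof. by have [] := bessel_zeroP n. Qed.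

Lemma besselJ0_bessel_zero n : J0 (bessel_zero n) = 0.
Proof. by have [] := bessel_zeroP n. Qed.

Lemma bessel_zero_inj : injective (@bessel_zero R).
Proof.
have lt : {homo @bessel_zero R : i j / (i < j)%N >-> i < j}.
  by apply: homo_ltn => [? ? ?|i]; [exact: lt_trans|have [] := bessel_zeroP i].
by move=> i j ij; case: (ltngtP i j) => // /lt; rewrite ij ltxx.
Qed.

Notation mu := (@lebesgue_measure R).

Lemma is_derive_besselJ0Z l x : is_derive x 1 (fun r => J0 (l * r)) (- J1 (l * x) * l).
Proof.
have dl : is_derive x 1 (fun r => l * r) l.
  by apply: (is_derive_eq (is_derive_fM (is_derive_fcst x l) (is_derive_fid x))); ring.
exact: is_derive_fcomp (is_derive_besselJ0 _) dl.
Qed.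

Lemma is_derive_besselJ1Z l x :
  is_derive x 1 (fun r => l * r * J1 (l * r)) (l ^+ 2 * x * J0 (l * x)).
Proof.
have dl : is_derive x 1 (fun r => l * r) l.
  by apply: (is_derive_eq (is_derive_fM (is_derive_fcst x l) (is_derive_fid x))); ring.
apply: (is_derive_eq (is_derive_fcomp (is_derive_besselJ1 _) dl)).
by ring.
Qed.

Lemma continuous_besselJ0Z l : continuous (fun r => J0 (l * r)).
Proof. by move=> x; apply: is_derive_continuous; exact: is_derive_besselJ0Z. Qed.

(** The primitive [F] is Lommel's, a Wronskian of the two modes: the products of two J_1 cancel in
    its derivative, and it vanishes at 0 and, [l] and [m] being zeros, at 1. *)
Lemma besselJ0_orthogonal l m : J0 l = 0 -> J0 m = 0 -> l ^+ 2 != m ^+ 2 ->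
  \int[mu]_(r in `[0, 1]) (J0 (l * r) * J0 (m * r) * r) = 0.
Proof.
move=> Jl Jm lm; have lm0 : l ^+ 2 - m ^+ 2 != 0 by rewrite subr_eq0.
pose F r := (l ^+ 2 - m ^+ 2)^-1 *
  (l * r * J1 (l * r) * J0 (m * r) - m * r * J1 (m * r) * J0 (l * r)).
transitivity (F 1 - F 0); last first.
  by rewrite /F !mulr1 Jl Jm; ring.
have dF x : is_derive x 1 F (J0 (l * x) * J0 (m * x) * x).
  have A := is_derive_fM (is_derive_besselJ1Z l x) (is_derive_besselJ0Z m x).
  have B := is_derive_fM (is_derive_besselJ1Z m x) (is_derive_besselJ0Z l x).
  apply: (is_derive_eq (is_derive_fM (is_derive_fcst x _) (is_derive_fD A (is_derive_fN B)))).
  by field.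
have cf : continuous (fun x => J0 (l * x) * J0 (m * x) * x).
  move=> x; apply: cvgM; last exact: cvg_id.
  by apply: cvgM; exact: continuous_besselJ0Z.
exact: (@Rintegral_derive R F _ 0 1 ler01 (fun x _ => dF x) (fun x _ => cf x)).
Qed.

Lemma besselJ0_normalized l : l != 0 -> J0 l = 0 ->
  \int[mu]_(r in `[0, 1]) (J0 (l * r) * J0 (l * r) * r) = J1 l ^+ 2 / 2.
Proof.
move=> l0 Jl.
(* At [r = 1] the energy reduces to [(l * J1 l) ^ 2], as [J0 l = 0]. *)
pose F r := (2 * l ^+ 2)^-1 * bessel_energy (l * r).
transitivity (F 1 - F 0); last first.
  by rewrite /F /bessel_energy !mulr1 Jl; field.
have dF x : is_derive x 1 F (J0 (l * x) * J0 (l * x) * x).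
  have dl : is_derive x 1 (fun r => l * r) l.
    by apply: (is_derive_eq (is_derive_fM (is_derive_fcst x l) (is_derive_fid x))); ring.
  have A := is_derive_fcomp (is_derive_bessel_energy _) dl.
  apply: (is_derive_eq (is_derive_fM (is_derive_fcst x _) A)).
  by field.
have cf : continuous (fun x => J0 (l * x) * J0 (l * x) * x).
  move=> x; apply: cvgM; last exact: cvg_id.
  by apply: cvgM; exact: continuous_besselJ0Z.
exact: (@Rintegral_derive R F _ 0 1 ler01 (fun x _ => dF x) (fun x _ => cf x)).
Qed.

Lemma bessel_coef_J0 n k :
  bessel_coef (fun r => J0 (bessel_zero n * r)) k = (k == n)%:R.
Proof.
rewrite /bessel_coef; have [->|kn] := eqVneq k n.
  rewrite besselJ0_normalized ?besselJ0_bessel_zero ?lt0r_neq0 ?bessel_zero_gt0//.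
  have := besselJ1_neq0 (bessel_zero_gt0 n) (besselJ0_bessel_zero n).
  by move=> J1n; rewrite [RHS](_ : _ = 1)//; field.
rewrite besselJ0_orthogonal ?besselJ0_bessel_zero ?mulr0 ?mul0r//.
rewrite eqrXn2 ?ltW ?bessel_zero_gt0//; apply: contra_neq kn => /bessel_zero_inj.
by [].
Qed.

End BesselZeros.

(** * The two-mode algebraic estimate *)

Section Admittance.
Context {R : realFieldType}.

Definition admittance (T k1 k2 : R) : R := k2 * (k1 + k2 * T) / (k2 + k1 * T).

(** Over a common denominator, the difference of the admittances has the quantity on the left as
    numerator; each of the two factors of the denominator is at most [2 * K], as [T <= 1]. *)
Lemma admittanceB_norm (T K k1 k2 l1 l2 : R) : 0 < T <= 1 ->
  1 <= k1 <= K -> 1 <= k2 <= K -> 1 <= l1 <= K -> 1 <= l2 <= K ->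
  `|k2 * (k1 + k2 * T) * (l2 + l1 * T) - l2 * (l1 + l2 * T) * (k2 + k1 * T)|
   <= 4 * K ^+ 2 * `|admittance T k1 k2 - admittance T l1 l2|.
Proof.
move=> /andP[T0 T1] /andP[k11 k1K] /andP[k21 k2K] /andP[l11 l1K] /andP[l21 l2K].
have Dpos (a b : R) : 1 <= a <= K -> 1 <= b <= K -> 0 < a + b * T <= 2 * K.
  move=> /andP[a1 aK] /andP[b1 bK].
  have bT0 : 0 < b * T by rewrite mulr_gt0// (lt_le_trans ltr01).
  have bT : b * T <= K by rewrite (le_trans _ bK)// ler_piMr// (le_trans ler01).
  by apply/andP; split; lra.
have /andP[D0 DK] := Dpos k2 k1 ltac:(by rewrite k21) ltac:(by rewrite k11).
have /andP[E0 EK] := Dpos l2 l1 ltac:(by rewrite l21) ltac:(by rewrite l11).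
set N := (X in `|X| <= _).
have -> : admittance T k1 k2 - admittance T l1 l2 = N / ((k2 + k1 * T) * (l2 + l1 * T)).
  by rewrite /admittance /N; field; rewrite !lt0r_neq0.
have DE : (k2 + k1 * T) * (l2 + l1 * T) <= 4 * K ^+ 2.
  apply: le_trans (ler_pM (ltW D0) (ltW E0) DK EK) _.
  by rewrite le_eqVlt; apply/orP; left; apply/eqP; ring.
have DE0 : 0 < (k2 + k1 * T) * (l2 + l1 * T) by rewrite mulr_gt0.
rewrite normrM normfV (gtr0_norm DE0) mulrCA ler_peMr//.
by rewrite ler_pdivlMr// mul1r.
Qed.

(* The two increments solve a 2 x 2 linear system, with determinant
   [(T2 - T1) * (a * b + a * p * (T1 + T2) + q * b * T1 * T2)]. *)
Lemma admittance_stable (T1 T2 K k1 k2 l1 l2 : R) : 0 < T1 -> T1 < T2 -> T2 <= 1 ->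
  1 <= k1 <= K -> 1 <= k2 <= K -> 1 <= l1 <= K -> 1 <= l2 <= K ->
  (T2 - T1) * (`|k2 - l2| + `|k1 - l1|) <= 24 * K ^+ 4 *
   (`|admittance T1 k1 k2 - admittance T1 l1 l2| +
    `|admittance T2 k1 k2 - admittance T2 l1 l2|).
Proof.
move=> T10 T12 T21 k1K k2K l1K l2K.
have N1 := @admittanceB_norm T1 K k1 k2 l1 l2 ltac:(by rewrite T10; lra) k1K k2K l1K l2K.
have N2 := @admittanceB_norm T2 K k1 k2 l1 l2 ltac:(by apply/andP; split; lra) k1K k2K l1K l2K.
move: N1 N2; set n1 := (X in `|X| <= _); set e1 := `|admittance _ _ _ - _|.
set n2 := (X in _ -> `|X| <= _ -> _); set e2 := `|admittance T2 _ _ - _|.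
move=> N1 N2.
move: k1K k2K l1K l2K => /andP[k11 k1K] /andP[k21 k2K] /andP[l11 l1K] /andP[l21 l2K].
have K0 : 0 <= K by lra.
have prodK (x y : R) : 1 <= x -> x <= K -> 1 <= y -> y <= K -> 1 <= x * y <= K ^+ 2.
  move=> x1 xK y1 yK; apply/andP; split.
    by rewrite -[1]mulr1; apply: ler_pM.
  by rewrite expr2; apply: ler_pM => //; lra.
(* Expanded, the numerator at [T] is [(a - T ^ 2 * q) * (k1 - l1) + (T * b + T ^ 2 * p) * (k2 -
   l2)]. The term in [T ^ 2] comes from writing [k2 ^ 2 * l1 - l2 ^ 2 * k1] as
   [p * (k2 - l2) - q * (k1 - l1)]. *)
pose a := k2 * l2; pose b := k1 * l1 + k2 * l2.
pose p := (k2 + l2) * (k1 + l1) / 2; pose q := (k2 ^+ 2 + l2 ^+ 2) / 2.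
have /andP[a1 aK] : 1 <= a <= K ^+ 2 by apply: prodK.
have /andP[b1 bK] : 1 <= b <= 2 * K ^+ 2.
  by have := @prodK k1 l1; have := @prodK k2 l2; rewrite /b; lra.
have /andP[p1 pK] : 1 <= p <= 2 * K ^+ 2.
  have := @prodK k2 l1; have := @prodK k2 k1; have := @prodK l2 l1; have := @prodK l2 k1.
  by rewrite /p; lra.
have /andP[q1 qK] : 1 <= q <= K ^+ 2.
  by have := @prodK k2 k2; have := @prodK l2 l2; rewrite /q; lra.
have TT (x : R) : 0 <= x -> x <= 1 -> 0 <= x ^+ 2 <= 1.
  by move=> x0 x1; rewrite sqr_ge0 expr_le1.
have /andP[T1s T1s1] := @TT T1 ltac:(lra) ltac:(lra).
have /andP[T2s T2s1] := @TT T2 ltac:(lra) ltac:(lra).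
pose det := (T2 - T1) * (a * b + a * p * (T1 + T2) + q * b * (T1 * T2)).
have det1 : T2 - T1 <= det.
  rewrite /det; apply: ler_peMr; first by rewrite subr_ge0 ltW.
  have ab1 : 1 <= a * b by rewrite -[1]mulr1; apply: ler_pM.
  have T20 : 0 < T2 := lt_trans T10 T12.
  have [a0 b0 p0 q0] : [/\ 0 <= a, 0 <= b, 0 <= p & 0 <= q].
    by split; apply: le_trans ler01 _.
  have h1 := mulr_ge0 (mulr_ge0 a0 p0) (addr_ge0 (ltW T10) (ltW T20)).
  have h2 := mulr_ge0 (mulr_ge0 q0 b0) (mulr_ge0 (ltW T10) (ltW T20)).
  by apply: le_trans ab1 _; rewrite -addrA lerDl; exact: addr_ge0.
have det0 : 0 <= det by lra.
(* Cramer's rule for the two equations, at [T1] and at [T2]. *)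
have E1 : det * (k1 - l1) = n1 * (T2 * b + T2 ^+ 2 * p) - n2 * (T1 * b + T1 ^+ 2 * p).
  by rewrite /det /n1 /n2 /a /b /p /q; field.
have E2 : det * (k2 - l2) = n2 * (a - T1 ^+ 2 * q) - n1 * (a - T2 ^+ 2 * q).
  by rewrite /det /n1 /n2 /a /b /p /q; field.
have up (x y z : R) : 0 <= x <= 1 -> 0 <= y <= z -> 0 <= x * y <= z.
  move=> /andP[x0 x1] /andP[y0 yz]; rewrite mulr_ge0//= (le_trans _ yz)//.
  by rewrite ler_piMl.
have c1 (x : R) : 0 <= x <= 1 -> 0 <= x ^+ 2 <= 1 -> `|x * b + x ^+ 2 * p| <= 4 * K ^+ 2.
  move=> x1 xx1; have := @up x b (2 * K ^+ 2) x1 ltac:(lra).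
  have := @up (x ^+ 2) p (2 * K ^+ 2) xx1 ltac:(lra).
  by move=> h1 h2; rewrite ger0_norm; lra.
have c2 (x : R) : 0 <= x ^+ 2 <= 1 -> `|a - x ^+ 2 * q| <= K ^+ 2.
  move=> x1; have := @up (x ^+ 2) q (K ^+ 2) x1 ltac:(lra).
  by move=> h; rewrite ler_norml; lra.
have D1 : (T2 - T1) * `|k1 - l1| <= (`|n1| + `|n2|) * (4 * K ^+ 2).
  apply: (@le_trans _ _ (det * `|k1 - l1|)); first by rewrite ler_wpM2r.
  rewrite -(ger0_norm det0) -normrM E1 (le_trans (ler_normB _ _))// !normrM mulrDl.
  by rewrite lerD// ler_wpM2l// c1//; lra.
have D2 : (T2 - T1) * `|k2 - l2| <= (`|n1| + `|n2|) * K ^+ 2.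
  apply: (@le_trans _ _ (det * `|k2 - l2|)); first by rewrite ler_wpM2r.
  rewrite -(ger0_norm det0) -normrM E2 (le_trans (ler_normB _ _))// !normrM addrC mulrDl.
  by rewrite lerD// ler_wpM2l// c2//; lra.
(* The constant is [4 * K ^ 2], from the denominators, times [6 * K ^ 2], which bounds the sum
   [5 * K ^ 2] of the two factors just obtained. *)
have S : (`|n1| + `|n2|) * (6 * K ^+ 2) <= 24 * K ^+ 4 * (e1 + e2).
  rewrite (_ : 24 * K ^+ 4 * _ = (4 * K ^+ 2 * e1 + 4 * K ^+ 2 * e2) * (6 * K ^+ 2)); last by ring.
  by rewrite ler_wpM2r ?lerD// mulr_ge0// exprn_ge0.
have : 0 <= (`|n1| + `|n2|) * K ^+ 2 by rewrite mulr_ge0 ?exprn_ge0 ?addr_ge0.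
by rewrite mulrDr; move: D1 D2 S; lra.
Qed.

End Admittance.

(** * Square-integrable functions *)

Section L2Theory.
Context d (T : measurableType d) (R : realType).
Variables (mu : {measure set T -> \bar R}) (D : set T).
Hypothesis mD : measurable D.
Implicit Types (f g : T -> R) (v w : nat -> T -> R).

Lemma L2_measurable f : L2 mu D f -> measurable_fun D f.
Proof. by case. Qed.

Lemma L2_integrable_sqr f : L2 mu D f ->
  mu.-integrable D (EFin \o (fun x => f x ^+ 2)).
Proof.
move=> [mf foo]; apply/integrableP; split.
  by apply/measurable_EFinP; exact: measurable_funX.
by under eq_integral do rewrite /= ger0_norm ?sqr_ge0//.
Qed.

Lemma integrable_L2 f : measurable_fun D f ->
  mu.-integrable D (EFin \o (fun x => f x ^+ 2)) -> L2 mu D f.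
Proof.
move=> mf /integrableP[_]; rewrite /L2.
by under eq_integral do rewrite /= ger0_norm ?sqr_ge0//.
Qed.

Lemma L2_le f g : measurable_fun D f -> (forall x, D x -> `|f x| <= `|g x|) ->
  L2 mu D g -> L2 mu D f.
Proof.
move=> mf fg Lg; apply: integrable_L2 => //.
apply: (le_integrable mD _ _ (L2_integrable_sqr Lg)).
  by apply/measurable_EFinP; exact: measurable_funX.
by move=> x Dx; rewrite /= lee_fin !normrX lerXn2r ?nnegrE// fg.
Qed.

Lemma L2_integrableM f g : L2 mu D f -> L2 mu D g ->
  mu.-integrable D (EFin \o (fun x => f x * g x)).
Proof.
move=> Lf Lg; have ifg := integrableD mD (L2_integrable_sqr Lf) (L2_integrable_sqr Lg).
apply: (le_integrable mD _ _ ifg).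
  by apply/measurable_EFinP; apply: measurable_funM; exact: L2_measurable.
move=> x Dx; rewrite /= lee_fin [leRHS]ger0_norm ?addr_ge0 ?sqr_ge0//.
rewrite normrM -[f x ^+ 2]real_normK ?num_real// -[g x ^+ 2]real_normK ?num_real//.
move: `|f x| `|g x| (normr_ge0 (f x)) (normr_ge0 (g x)) => a b a0 b0.
have := sqr_ge0 (a - b); have := mulr_ge0 a0 b0; nra.
Qed.

Lemma L2_cst (K : R) : (mu D < +oo)%E -> L2 mu D (cst K).
Proof.
move=> Doo; split; first exact: measurable_cst.
under eq_integral do rewrite /=.
by rewrite (integral_cst mu mD (K ^+ 2)%:E) lte_mul_pinfty// ?lee_fin ?sqr_ge0.
Qed.

Lemma L2_bounded f (K : R) : (mu D < +oo)%E -> measurable_fun D f ->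
  (forall x, D x -> `|f x| <= K) -> L2 mu D f.
Proof.
move=> Doo mf fK; apply: (L2_le mf _ (L2_cst K Doo)) => x Dx.
by rewrite /= (le_trans (fK x Dx))// ler_norm.
Qed.

Lemma L2Zl f (b : T -> R) (K : R) : measurable_fun D b -> (forall x, D x -> `|b x| <= K) ->
  L2 mu D f -> L2 mu D (fun x => b x * f x).
Proof.
move=> mb bK Lf; apply: (@L2_le _ (fun x => K * f x)).
- by apply: measurable_funM => //; exact: L2_measurable.
- by move=> x Dx; rewrite !normrM ler_wpM2r// (le_trans (bK x Dx))// ler_norm.
apply: integrable_L2; first by apply: measurable_funM => //; exact: L2_measurable.
have := integrableZl mD (K ^+ 2) (L2_integrable_sqr Lf).
by apply: eq_integrable => // x _; rewrite /= -EFinM exprMn.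
Qed.

Lemma L2N f : L2 mu D f -> L2 mu D (fun x => - f x).
Proof.
move=> Lf; apply: (L2_le _ _ Lf) => [|x _]; last by rewrite normrN.
by apply: measurable_funN; exact: L2_measurable.
Qed.

Lemma L2D f g : L2 mu D f -> L2 mu D g -> L2 mu D (fun x => f x + g x).
Proof.
move=> Lf Lg; apply: integrable_L2.
  by apply: measurable_funD; exact: L2_measurable.
have h := integrableD mD (integrableD mD (L2_integrable_sqr Lf) (L2_integrable_sqr Lg))
  (integrableZl mD 2 (L2_integrableM Lf Lg)).
by apply: eq_integrable h => // x _; rewrite /= -EFinM -!EFinD; congr EFin; ring.
Qed.

Lemma L2B f g : L2 mu D f -> L2 mu D g -> L2 mu D (fun x => f x - g x).
Proof. by move=> Lf Lg; apply: L2D => //; exact: L2N. Qed.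

Lemma L2_ae0 f : L2 mu D f -> \int[mu]_(x in D) (f x ^+ 2) = 0 ->
  {ae mu, forall x, D x -> f x = 0}.
Proof.
move=> Lf f0; have mf := L2_measurable Lf.
have : (\int[mu]_(x in D) `|(f x ^+ 2)%:E| = 0)%E.
  under eq_integral do rewrite gee0_abs ?lee_fin ?sqr_ge0//.
  rewrite -[LHS]fineK; first by rewrite -[fine _]/(\int[mu]_(x in D) (f x ^+ 2)) f0.
  exact: integrable_fin_num (L2_integrable_sqr Lf).
move/ae_eq_integral_abs => /(_ mD) h.
have {h} : ae_eq mu D (fun x => (f x ^+ 2)%:E) (cst 0%E).
  by apply: h; apply/measurable_EFinP; exact: measurable_funX.
apply: filterS => x h Dx; move: (h Dx) => [/eqP].
by rewrite sqrf_eq0 => /eqP.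
Qed.

Lemma cvgL2_Rintegral_sqr v f : cvgL2 mu D v f ->
  \int[mu]_(x in D) ((v k x - f x) ^+ 2) @[k --> \oo] --> 0.
Proof. by move=> vf; apply: fine_cvg. Qed.

(** Dominated convergence for the squares: the bound by [g] passes to the limit [f], so that
    [(2 * g) ^ 2] dominates [(v k - f) ^ 2]. *)
Lemma cvgL2_dominated v f g : (forall k, measurable_fun D (v k)) ->
  measurable_fun D f -> L2 mu D g -> (forall k x, D x -> `|v k x| <= g x) ->
  (forall x, D x -> v k x @[k --> \oo] --> f x) -> cvgL2 mu D v f.
Proof.
move=> mv mf Lg vg vf.
have fg x : D x -> `|f x| <= g x.
  move=> Dx; have := vf x Dx => /cvg_norm h.
  rewrite -(cvg_lim _ h)//; apply: limr_le; first by apply/cvg_ex; eexists; exact: h.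
  by apply: nearW => k; exact: vg.
have [] := @dominated_convergence _ _ _ mu D mD (fun k x => ((v k x - f x) ^+ 2)%:E) (cst 0%E)
  (fun x => (4 * g x ^+ 2)%:E).
- by move=> k; apply/measurable_EFinP; apply: measurable_funX; exact: measurable_funB.
- exact: measurable_cst.
- apply: aeW => x Dx; apply: cvg_EFin; first exact: nearW.
  rewrite [X in _ --> X](_ : _ = (f x - f x) ^+ 2); last by rewrite subrr expr0n.
  have h : v k x - f x @[k --> \oo] --> f x - f x.
    by apply: cvgB; [exact: vf|exact: cvg_cst].
  by rewrite expr2; under eq_fun do rewrite /= expr2; exact: cvgM.
- have := integrableZl mD 4 (L2_integrable_sqr Lg).
  by apply: eq_integrable => // x _; rewrite /= -EFinM.
- apply: aeW => x k Dx; rewrite /= lee_fin normrX.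
  rewrite (_ : 4 * g x ^+ 2 = (g x + g x) ^+ 2); last by ring.
  rewrite lerXn2r ?nnegrE//; first by rewrite addr_ge0// (le_trans _ (vg k x Dx)).
  by rewrite (le_trans (ler_normB _ _))// lerD ?vg ?fg.
move=> _ _; rewrite integral0; exact.
Qed.

(** In place of Cauchy-Schwarz, [|x * y| <= c * x ^ 2 + y ^ 2 / c]: a large [c] makes the second
    term small once and for all, after which the convergence makes the first one small. *)
Lemma cvgL2_RintegralM v f g : (forall k, L2 mu D (v k)) -> L2 mu D f ->
  L2 mu D g -> cvgL2 mu D v f ->
  \int[mu]_(x in D) (v k x * g x) @[k --> \oo] --> \int[mu]_(x in D) (f x * g x).
Proof.
move=> Lv Lf Lg /cvgL2_Rintegral_sqr vf.
set G := \int[mu]_(x in D) (g x ^+ 2).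
have G0 : 0 <= G by apply: Rintegral_ge0 => x _; exact: sqr_ge0.
apply/cvgrPdist_lt => e e0.
(* This makes [G / c] smaller than [e / 2]; the [+ 1] covers [G = 0]. *)
pose c := 2 * (G + 1) / e.
have c0 : 0 < c by rewrite divr_gt0// mulr_gt0// ltr_pwDr.
have bound k : `|\int[mu]_(x in D) (f x * g x) - \int[mu]_(x in D) (v k x * g x)|
    <= c * \int[mu]_(x in D) ((v k x - f x) ^+ 2) + c^-1 * G.
  have Ld := L2B (Lv k) Lf.
  rewrite distrC -RintegralB//; [|exact: L2_integrableM..].
  under eq_Rintegral do rewrite -mulrBl.
  have i1 := L2_integrable_sqr Ld; have i2 := L2_integrable_sqr Lg.
  have i3 := L2_integrableM Ld Lg.
  have j1 : mu.-integrable D (EFin \o (fun x => c * (v k x - f x) ^+ 2)).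
    by apply: eq_integrable (integrableZl mD c i1) => // x _; rewrite /= -EFinM.
  have j2 : mu.-integrable D (EFin \o (fun x => c^-1 * g x ^+ 2)).
    by apply: eq_integrable (integrableZl mD c^-1 i2) => // x _; rewrite /= -EFinM.
  apply: (le_trans (le_normr_Rintegral mD i3)).
  rewrite -RintegralZl// -RintegralZl// -RintegralD//.
  apply: le_Rintegral => //.
  - by have := integrable_abse i3; apply: eq_integrable.
  - by have := integrableD mD j1 j2; apply: eq_integrable.
  move=> x _; rewrite normrM.
  rewrite -[(_ - _) ^+ 2]real_normK ?num_real// -[g x ^+ 2]real_normK ?num_real//.
  move: `|v k x - f x| `|g x| (normr_ge0 (v k x - f x)) (normr_ge0 (g x)) => a b a0 b0.
  have h : 0 <= c^-1 * (c * a - b) ^+ 2 by rewrite mulr_ge0 ?sqr_ge0// invr_ge0 ltW.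
  have hE : c^-1 * (c * a - b) ^+ 2 = c * a ^+ 2 - 2 * (a * b) + c^-1 * b ^+ 2.
    by field; rewrite lt0r_neq0.
  have : 0 <= a * b by rewrite mulr_ge0.
  by rewrite hE in h; lra.
have cG : c^-1 * G < e / 2.
  rewrite /c invf_div -mulrA [_^-1 * _]mulrC mulrA ltr_pdivrMr ?mulr_gt0 ?ltr_pwDr//.
  rewrite (_ : e / 2 * (2 * (G + 1)) = e * (G + 1)); last by field.
  by rewrite ltr_pM2l// ltrDl.
have h : \forall k \near \oo, \int[mu]_(x in D) ((v k x - f x) ^+ 2) < e / 2 / c.
  have ec : 0 < e / 2 / c := divr_gt0 (divr_gt0 e0 (ltr0n _ 2)) c0.
  exact: (cvgr_lt _ vf _ ec).
near=> k; apply: (le_lt_trans (bound k)).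
have : c * \int[mu]_(x in D) ((v k x - f x) ^+ 2) < e / 2.
  by rewrite mulrC -ltr_pdivlMr//; near: k.
by move: cG; lra.
Unshelve. all: by end_near. Qed.

Lemma cvgL2B v w f g : (forall k, L2 mu D (v k)) -> (forall k, L2 mu D (w k)) ->
  L2 mu D f -> L2 mu D g -> cvgL2 mu D v f -> cvgL2 mu D w g ->
  cvgL2 mu D (fun k x => v k x - w k x) (fun x => f x - g x).
Proof.
move=> Lv Lw Lf Lg vf wg.
have Lvf k := L2B (Lv k) Lf; have Lwg k := L2B (Lw k) Lg.
have bound k : (\int[mu]_(x in D) ((v k x - w k x - (f x - g x)) ^+ 2)%:E <=
  2%:E * \int[mu]_(x in D) ((v k x - f x) ^+ 2)%:E +
  2%:E * \int[mu]_(x in D) ((w k x - g x) ^+ 2)%:E)%E.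
  have mz (h : T -> R) : L2 mu D h -> measurable_fun D (EFin \o (fun x => h x ^+ 2)).
    by move=> Lh; apply/measurable_EFinP/measurable_funX; exact: L2_measurable.
  rewrite -!ge0_integralZl//; first last.
  - by move=> x _; rewrite lee_fin sqr_ge0.
  - exact: mz.
  - by move=> x _; rewrite lee_fin sqr_ge0.
  - exact: mz.
  have mz2 (h : T -> R) : L2 mu D h -> measurable_fun D (fun x => (2%:E * (h x ^+ 2)%:E)%E).
    by move=> Lh; apply: emeasurable_funM => //; exact: mz.
  rewrite -ge0_integralD//; first last.
  - exact: mz2.
  - by move=> x _; rewrite mule_ge0// lee_fin ?sqr_ge0.
  - exact: mz2.
  - by move=> x _; rewrite mule_ge0// lee_fin ?sqr_ge0.
  apply: ge0_le_integral => //.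
  - by move=> x _; rewrite lee_fin sqr_ge0.
  - by apply: mz; apply: L2B; exact: L2B.
  - by apply: emeasurable_funD; exact: mz2.
  move=> x _; rewrite -!EFinM -EFinD lee_fin.
  have := sqr_ge0 ((v k x - f x) + (w k x - g x)); nra.
rewrite /cvgL2.
have h0 : (2%:E * \int[mu]_(x in D) ((v k x - f x) ^+ 2)%:E +
  2%:E * \int[mu]_(x in D) ((w k x - g x) ^+ 2)%:E)%E @[k --> \oo] --> 0%E.
  rewrite [X in _ --> X](_ : _ = 2%:E * 0 + 2%:E * 0)%E; last by rewrite !mule0 adde0.
  apply: cvgeD; first by rewrite !mule0.
    by apply: cvgeZl.
  by apply: cvgeZl.
apply: squeeze_cvge (cvg_cst 0%E) h0.
near=> k; rewrite bound andbT; apply: integral_ge0 => x _; by rewrite lee_fin sqr_ge0.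
Unshelve. all: by end_near. Qed.

End L2Theory.

(** * Functions of three variables *)

Lemma continuous_pair_at (T U V : topologicalType) (f : T -> U) (g : T -> V) x :
  {for x, continuous f} -> {for x, continuous g} ->
  {for x, continuous (fun t => (f t, g t))}.
Proof. by move=> cf cg; exact: (cvg_pair cf cg). Qed.

Lemma continuous_pair1 (T U V : topologicalType) (f : T * U -> V) y :
  continuous f -> continuous (fun x => f (x, y)).
Proof.
move=> cf x; apply: (@continuous_comp _ _ _ (fun x => (x, y)) f); last exact: cf.
by apply: continuous_pair_at; [exact: cvg_id|exact: cvg_cst].
Qed.

Lemma continuous_pair2 (T U V : topologicalType) (f : T * U -> V) x :
  continuous f -> continuous (fun y => f (x, y)).
Proof.
move=> cf y; apply: (@continuous_comp _ _ _ (fun y => (x, y)) f); last exact: cf.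
by apply: continuous_pair_at; [exact: cvg_cst|exact: cvg_id].
Qed.

Section Caratheodory.
Context d (T : measurableType d) (R : realType).

(** Rounding [y] down to a multiple of [1 / (k + 1)] gives functions whose preimages are countable
    unions of rectangles, and which tend to [f] by continuity in [y]. Measurability is thus obtained
    for the product sigma-algebra, on which the product measures live. *)
Lemma measurable_fun_caratheodory (f : T * R -> R) :
  (forall y, measurable_fun setT (fun x => f (x, y))) ->
  (forall x, continuous (fun y => f (x, y))) -> measurable_fun setT f.
Proof.
move=> mf cf.
pose r (k : nat) (y : R) : R := (Num.floor (y * k.+1%:R))%:~R / k.+1%:R.
have k0 (k : nat) : (0 : R) < k.+1%:R by rewrite ltr0n.
have rE k (y : R) i : (Num.floor (y * k.+1%:R) == i) =
    (y \in `[i%:~R / k.+1%:R, (i + 1)%:~R / k.+1%:R[).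
  rewrite in_itv/= ler_pdivrMr// ltr_pdivlMr//; apply/eqP/idP => [<-|].
    by rewrite floor_le ?floorD1_gt ?num_real.
  exact: floor_def.
apply: (@measurable_fun_cvg _ _ R setT (fun k p => f (p.1, r k p.2))).
  move=> k _ Y mY; rewrite setTI.
  rewrite (_ : _ @^-1` Y = \bigcup_(i : int)
     ((fun x => f (x, i%:~R / k.+1%:R)) @^-1` Y `*`
      `[i%:~R / k.+1%:R, (i + 1)%:~R / k.+1%:R[%classic)).
    apply: countable_bigcupT_measurable => // i.
    apply: measurableX; last exact: measurable_itv.
    by rewrite -[X in measurable X]setTI; exact: mf.
  apply/seteqP; split => [[x y] /= Yf|[x y] [i _ [/= Yf yi]]].
    exists (Num.floor (y * k.+1%:R)) => //; split => //=.
    by rewrite -rE.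
  have /eqP yi' : Num.floor (y * k.+1%:R) == i by rewrite rE.
  by rewrite /r yi'.
move=> [x y] _ /=.
apply: (cvg_comp (r ^~ y) (fun z => f (x, z))); last exact: cf.
apply/cvgrPdist_le => e e0.
near=> k.
have : Num.floor (y * k.+1%:R) == Num.floor (y * k.+1%:R) by [].
rewrite rE in_itv/= -/(r k y) => /andP[ry yr].
rewrite ger0_norm ?subr_ge0// lerBlDr (le_trans (ltW yr))//.
rewrite intrD mulrDl addrC lerD2r mul1r -[e]invrK lef_pV2 ?posrE ?invr_gt0//.
have : e^-1 <= k%:R by near: k; exact: nbhs_infty_ger.
by move/le_trans; apply; rewrite ler_nat.
Unshelve. all: by end_near. Qed.

End Caratheodory.

Section Measurability.
Context {R : realType}.
Local Notation R2 := (R * R)%type.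
Local Notation R3 := (R * R * R)%type.

Lemma continuous_measurable2 (f : R2 -> R) : continuous f -> measurable_fun setT f.
Proof.
move=> cf; apply: measurable_fun_caratheodory => y.
  by apply: continuous_measurable_fun; exact: continuous_pair1.
exact: continuous_pair2.
Qed.

Lemma continuous_measurable3 (f : R3 -> R) : continuous f -> measurable_fun setT f.
Proof.
move=> cf; apply: measurable_fun_caratheodory => y.
  by apply: continuous_measurable2; exact: continuous_pair1.
exact: continuous_pair2.
Qed.

Lemma measurable_disk : measurable (@disk R).
Proof.
pose f (q : R2) := q.1 ^+ 2 + q.2 ^+ 2.
have mf : measurable_fun setT f.
  by apply: measurable_funD; apply: measurable_funX; [exact: measurable_fst|exact: measurable_snd].
rewrite (_ : disk = f @^-1` `]-oo, 1[%classic).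
  by rewrite -[X in measurable X]setTI; apply: mf => //; exact: measurable_itv.
by apply/seteqP; split => q; rewrite /disk /= in_itv.
Qed.

Lemma cylinderE : @cylinder R = disk `*` `]0, +oo[%classic.
Proof. by apply/seteqP; split => -[q z] /=; rewrite in_itv/= andbT. Qed.

Lemma measurable_cylinder : measurable (@cylinder R).
Proof.
by rewrite cylinderE; apply: measurableX; [exact: measurable_disk|exact: measurable_itv].
Qed.

End Measurability.

(** * Partial derivatives and C^1 functions with compact support *)

Section Partial.
Context {R : realType}.
Local Notation R2 := (R * R)%type.
Local Notation R3 := (R * R * R)%type.
Implicit Types (v w : R3 -> R) (p : R3) (i : 'I_3) (t : R).

(** The line through [p] in the direction [i], parametrized by the coordinate itself and not by the
    displacement from [p]: any other point of the line gives the same parametrization, and partial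
    derivatives become derivatives in one variable. *)
Definition upd3 i p t : R3 :=
  (if i == 0%N :> nat then t else p.1.1, if i == 1%N :> nat then t else p.1.2,
   if i == 2%N :> nat then t else p.2).

Definition coord3 i p : R :=
  if i == 0%N :> nat then p.1.1 else if i == 1%N :> nat then p.1.2 else p.2.

Lemma ord3P i : [\/ i = ord0, i = inord 1 | i = inord 2].
Proof.
case: i => -[|[|[|//]]] h; [apply: Or31|apply: Or32|apply: Or33];
  by apply/val_inj; rewrite /= ?inordK.
Qed.

Lemma upd3_coord i p : upd3 i p (coord3 i p) = p.
Proof.
case: p => [[x y] z]; rewrite /upd3 /coord3.
by case: i => -[|[|[|//]]] h.
Qed.

Lemma upd3_upd3 i p t s : upd3 i (upd3 i p t) s = upd3 i p s.
Proof. by rewrite /upd3 /=; case: i => -[|[|[|//]]] h. Qed.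

Lemma coord3_upd3 i p t : coord3 i (upd3 i p t) = t.
Proof. by rewrite /upd3 /coord3 /=; case: i => -[|[|[|//]]] h. Qed.

Lemma shift_unit3 i p t : t *: unit3 i + p = upd3 i p (t + coord3 i p).
Proof.
case: p => [[x y] z].
transitivity (t * (i == 0%N :> nat)%:R + x, t * (i == 1%N :> nat)%:R + y,
              t * (i == 2%N :> nat)%:R + z); first by [].
by rewrite /upd3 /coord3; case: i => -[|[|[|//]]] h;
  rewrite /= !mulr1n !mulr0n !mulr1 !mulr0 !add0r.
Qed.

Lemma derive_quotient i p v :
  (fun h : R => h^-1 *: ((v \o shift p) (h *: unit3 i) - v p)) =
  (fun h : R => h^-1 *: (((fun t => v (upd3 i p t)) \o shift (coord3 i p)) (h *: 1)
                         - v (upd3 i p (coord3 i p)))).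
Proof.
apply/funext => h; rewrite /= upd3_coord.
by rewrite shift_unit3 -[h *: 1]/(h * 1) mulr1.
Qed.

Lemma is_derive_derivable i p v d :
  is_derive (coord3 i p) 1 (fun t => v (upd3 i p t)) d ->
  derivable v p (unit3 i) /\ partial i v p = d.
Proof.
move=> [dv <-]; rewrite /derivable /partial /derive derive_quotient.
by split.
Qed.

Lemma derivable_is_derive i p v : derivable v p (unit3 i) ->
  is_derive (coord3 i p) 1 (fun t => v (upd3 i p t)) (partial i v p).
Proof.
rewrite /derivable derive_quotient => dv; apply: DeriveDef; first exact: dv.
by rewrite /partial /derive derive_quotient.
Qed.

Lemma C1_is_derive v : C1 v -> forall i p t,
  is_derive t 1 (fun t => v (upd3 i p t)) (partial i v (upd3 i p t)).
Proof.
move=> [_ dv] i p t; have [/(_ (upd3 i p t)) + _] := dv i.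
move=> /derivable_is_derive; rewrite coord3_upd3.
by under eq_fun do rewrite upd3_upd3.
Qed.

Lemma is_derive_C1 v (dv : 'I_3 -> R3 -> R) : continuous v ->
  (forall i, continuous (dv i)) ->
  (forall i p, is_derive (coord3 i p) 1 (fun t => v (upd3 i p t)) (dv i p)) ->
  C1 v /\ forall i, partial i v = dv i.
Proof.
move=> cv cdv dvE.
have pE i : partial i v = dv i.
  by apply/funext => p; have [] := is_derive_derivable (dvE i p).
split => //; split => // i; split; last by rewrite pE; exact: cdv.
by move=> p; have [] := is_derive_derivable (dvE i p).
Qed.

Lemma C1M v w : C1 v -> C1 w -> C1 (fun p => v p * w p) /\
  forall i, partial i (fun p => v p * w p) =
            fun p => partial i v p * w p + v p * partial i w p.
Proof.
move=> C1v C1w; have [cv dv] := C1v; have [cw dw] := C1w.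
apply: is_derive_C1.
- by move=> p; apply: cvgM; [exact: cv|exact: cw].
- move=> i p; apply: cvgD; apply: cvgM.
  + by have [_] := dv i; exact.
  + exact: cw.
  + exact: cv.
  + by have [_] := dw i; exact.
- move=> i p; have := is_derive_fM (C1_is_derive C1v i p (coord3 i p)) (C1_is_derive C1w i p (coord3 i p)).
  by rewrite upd3_coord.
Qed.

Lemma C1c_C1 (O : set R3) v : C1c O v -> C1 v.
Proof. by case. Qed.

Lemma C1c_mul (O : set R3) v w : C1 v -> C1c O w -> C1c O (fun p => v p * w p).
Proof.
move=> C1v [C1w [K cK K0]]; split; first by have [] := C1M C1v C1w.
by exists K => // p Kp; rewrite K0// mulr0.
Qed.

Lemma C1cS (O1 O2 : set R3) v : O1 `<=` O2 -> C1c O1 v -> C1c O2 v.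
Proof.
by move=> O12 [C1v [K [cK KO] K0]]; split => //; exists K => //; split => // p /KO /O12.
Qed.

Definition box3 (L : R) : set R3 :=
  `[- L, L]%classic `*` `[- L, L]%classic `*` `[- L, L]%classic.

Lemma compact_box3 L : compact (box3 L).
Proof. by do 2?apply: compact_setX; exact: segment_compact. Qed.

Lemma compact_box3P (K : set R3) : compact K -> exists2 L : R, 0 < L & K `<=` box3 L.
Proof.
move=> /compact_bounded[M [_ HM]].
exists (`|M| + 1); first by rewrite ltr_wpDl.
have := HM (`|M| + 1); rewrite (le_lt_trans (ler_norm M)) ?ltrDl// => /(_ isT) {}HM.
move=> [[x y] z] /HM /=; rewrite !prod_normE/= !ge_max => /andP[/andP[hx hy] hz].
by rewrite /box3 /= !in_itv/= -!ler_norml.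
Qed.

Lemma partial_eq0 v (K : set R3) i p : compact K ->
  (forall p, ~ K p -> v p = 0) -> ~ K p -> partial i v p = 0.
Proof.
move=> cK K0 Kp.
have -> : partial i v p = 'D_(unit3 i) (cst 0) p.
  apply: near_eq_derive.
  have : nbhs p (~` K).
    apply: open_nbhs_nbhs; split => //; rewrite openC.
    exact: compact_closed.
  by apply: filterS => q /K0.
exact: derive_cst.
Qed.

Lemma continuous_box3_bounded v L : continuous v ->
  exists2 M : R, 0 <= M & forall p, box3 L p -> `|v p| <= M.
Proof.
move=> cv.
have : compact (v @` box3 L).
  by apply: continuous_compact; [exact: continuous_subspaceT|exact: compact_box3].
move=> /compact_bounded[M [_ HM]].
exists (`|M| + 1); first by rewrite addr_ge0.
move=> p Lp; apply: HM; last by exists p.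
by rewrite (le_lt_trans (ler_norm M))// ltrDl.
Qed.

Lemma C1c_bounded v : C1c setT v -> exists L M : R,
  [/\ 0 < L, 0 <= M, forall p, `|v p| <= M, forall i p, `|partial i v p| <= M &
   forall p, ~ box3 L p -> v p = 0 /\ forall i, partial i v p = 0].
Proof.
move=> [[cv dv] [K [cK _] K0]]; have [L L0 KL] := compact_box3P cK.
have cd i : continuous (partial i v) by have [] := dv i.
have [M M0 HM] := continuous_box3_bounded L cv.
have [M1 M10 HM1] := continuous_box3_bounded L (cd ord0).
have [M2 M20 HM2] := continuous_box3_bounded L (cd (inord 1)).
have [M3 M30 HM3] := continuous_box3_bounded L (cd (inord 2)).
have out p : ~ box3 L p -> v p = 0 /\ forall i, partial i v p = 0.
  move=> Lp; have Kp : ~ K p by move/KL.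
  by split => [|i]; [exact: K0|exact: partial_eq0 K0 Kp].
have MM : 0 <= M + M1 + M2 + M3 by rewrite !addr_ge0.
exists L, (M + M1 + M2 + M3); split => //.
- move=> p; have [Lp|Lp] := pselect (box3 L p); last by rewrite (out p Lp).1 normr0.
  by rewrite (le_trans (HM p Lp))// -!addrA lerDl !addr_ge0.
- move=> i p; have [Lp|Lp] := pselect (box3 L p); last by rewrite (out p Lp).2 normr0.
  case: (ord3P i) => ->.
  + by rewrite (le_trans (HM1 p Lp))// -!addrA addrCA lerDl !addr_ge0.
  + by rewrite (le_trans (HM2 p Lp))// -!addrA addrA addrCA lerDl !addr_ge0.
  + by rewrite (le_trans (HM3 p Lp))// lerDr !addr_ge0.
Qed.

End Partial.

(** * The divergence theorem in the cylinder *)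

Section BoundedSupport.
Context d (T : measurableType d) (R : realType).
Variables (mu : {measure set T -> \bar R}) (D : set T).
Hypothesis mD : measurable D.

Lemma integrable_indic_lty (A : set T) : measurable A -> (mu A < +oo)%E ->
  mu.-integrable setT (fun x => (\1_A x)%:E : \bar R).
Proof.
move=> mA Aoo; apply/integrableP; split; first exact/measurable_EFinP.
under eq_integral do rewrite gee0_abs ?lee_fin//.
by rewrite integral_indic// setIT.
Qed.

Lemma L2_finite_support (f : T -> R) (A : set T) (M : R) : measurable A ->
  (mu A < +oo)%E -> measurable_fun D f -> 0 <= M ->
  (forall x, D x -> `|f x| <= M) -> (forall x, D x -> ~ A x -> f x = 0) ->
  L2 mu D f.
Proof.
move=> mA Aoo mf M0 fM f0.
have mI : measurable_fun D (fun x => M * \1_A x).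
  by apply: measurable_funM => //; apply: measurable_funTS; exact: measurable_indic.
apply: (L2_le mD (g := fun x => M * \1_A x)) => //.
  move=> x Dx; have [Ax|Ax] := pselect (A x).
    by rewrite indicE mem_set// mulr1 [leRHS]ger0_norm// fM.
  by rewrite f0// normr0.
apply: integrable_L2 => //.
have h := integrableZl measurableT (M ^+ 2) (integrable_indic_lty mA Aoo).
have := integrableS measurableT mD (@subsetT _ _) h.
apply: eq_integrable => // x _; rewrite /= -EFinM exprMn indicE; case: (x \in A); rewrite ?expr1n ?expr0n//.
Qed.

Lemma integrable_finite_support (f : T -> R) (A : set T) (M : R) : measurable A ->
  (mu A < +oo)%E -> measurable_fun D f ->
  (forall x, D x -> `|f x| <= M) -> (forall x, D x -> ~ A x -> f x = 0) ->
  mu.-integrable D (EFin \o f).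
Proof.
move=> mA Aoo mf fM f0.
have h := integrableZl measurableT M (integrable_indic_lty mA Aoo).
apply: (le_integrable mD _ _ (integrableS measurableT mD (@subsetT _ _) h)).
  exact/measurable_EFinP.
move=> x Dx; rewrite /= lee_fin indicE.
have [Ax|Ax] := pselect (A x); last by rewrite f0// normr0.
by rewrite mem_set// mulr1 (le_trans (fM x Dx))// ler_norm.
Qed.

End BoundedSupport.

(** * Gauss-Green on the unit disk: from chords to arcs *)

Section Arcs.
Context {R : realType}.
Notation mu := (@lebesgue_measure R).
Local Notation R2 := (R * R)%type.
Implicit Types (g : R2 -> R).

(** As the square root of a negative number is 0, both ends of the chord are 0 when [|y| >= 1]; the
    formulas then hold for all [y], with no contribution from outside the disk. *)
Definition halfchord (y : R) : R := Num.sqrt (1 - y ^+ 2).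

Lemma halfchord_continuous : continuous halfchord.
Proof.
move=> y; apply: (@continuous_comp _ _ _ (fun y : R => 1 - y ^+ 2) Num.sqrt); last exact: sqrt_continuous.
by apply: cvgB; [exact: cvg_cst|rewrite expr2; under eq_fun do rewrite expr2; apply: cvgM; exact: cvg_id].
Qed.

Lemma halfchord_sin (t : R) : halfchord (sin t) = `|cos t|.
Proof. by rewrite /halfchord -cos2sin2 sqrtr_sqr. Qed.

Lemma halfchord_cos (t : R) : halfchord (cos t) = `|sin t|.
Proof. by rewrite /halfchord -sin2cos2 sqrtr_sqr. Qed.

Lemma halfchord_eq0 (y : R) : 1 <= `|y| -> halfchord y = 0.
Proof.
move=> y1; apply: ler0_sqrtr; rewrite subr_le0 -real_normK ?num_real//.
by rewrite exprn_ege1.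
Qed.

Lemma lt_halfchord (x y : R) : (x ^+ 2 + y ^+ 2 < 1) = (- halfchord y < x < halfchord y).
Proof.
rewrite -ltr_norml; have [y1|y1] := leP 1 (y ^+ 2).
  have -> : halfchord y = 0 by apply: ler0_sqrtr; rewrite subr_le0.
  by rewrite normr_lt0 ltNge (le_trans y1)// lerDr sqr_ge0.
rewrite /halfchord -ltrBrDr -real_normK ?num_real// -[in RHS]ltr_sqr ?nnegrE ?sqrtr_ge0//.
by rewrite sqr_sqrtr// subr_ge0 ltW.
Qed.

Lemma integral_chord (F f : R -> R) (y : R) :
  (forall x : R, is_derive x 1 F (f x)) ->
  continuous f ->
  (\int[mu]_x (((fun x => f x) \_ [set x : R | x ^+ 2 + y ^+ 2 < 1]) x)%:E =
   (F (halfchord y) - F (- halfchord y))%:E)%E.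
Proof.
move=> dF cf; have c0 : - halfchord y <= halfchord y.
  by rewrite (@le_trans _ _ 0) ?oppr_le0 ?sqrtr_ge0.
have <- := @integral_derive R F f _ _ c0 (fun x _ => dF x) (fun x _ => cf x).
rewrite [LHS](_ : _ = \int[mu]_(x in `](- halfchord y)%R, halfchord y[) (f x)%:E)%E; last first.
  rewrite [RHS]integral_mkcond; apply: eq_integral => x _.
  rewrite restrict_EFin; congr (_%:E); rewrite /patch; congr (if _ then _ else _).
  by apply/idP/idP; rewrite !inE /= in_itv/= lt_halfchord.
symmetry; apply: integral_itv_bndoo.
by apply/measurable_EFinP; apply: measurable_funTS; exact: continuous_measurable_fun.
Qed.

Lemma continuous_graph g (h k : R -> R) : continuous g -> continuous h -> continuous k ->
  continuous (fun t => g (h t, k t)).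
Proof.
move=> cg ch ck t; apply: (@continuous_comp _ _ _ (fun t => (h t, k t)) g); last exact: cg.
by apply: continuous_pair_at; [exact: ch|exact: ck].
Qed.

Lemma continuous_halfchordN : continuous (fun t => - halfchord t).
Proof. by move=> t; apply: cvgN; exact: halfchord_continuous. Qed.

Lemma continuous_fid : continuous (fun t : R => t).
Proof. by move=> t; exact: cvg_id. Qed.

(** The integrand vanishes off [-1, 1]. The primitives live on the larger interval ]-2, 2[ so as to
    be differentiable at -1 and 1, values which the sine and the cosine attain. *)
Lemma difference_primitives (H K : R -> R) : continuous H -> continuous K ->
  (forall y : R, 1 <= `|y| -> H y = K y) -> exists P Q : R -> R,
  [/\ forall y : R, -2 < y < 2 -> is_derive y 1 P (H y),
      forall y : R, -2 < y < 2 -> is_derive y 1 Q (K y) &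
      (\int[mu]_y (H y - K y)%:E = ((P 1 - Q 1) - (P (- 1) - Q (- 1)))%:E)%E].
Proof.
move=> cH cK HK.
have [P dP] := exists_primitive 2 cH; have [Q dQ] := exists_primitive 2 cK.
exists P, Q; split => //.
have cHK : continuous (fun y => H y - K y) by move=> y; apply: cvgB; [exact: cH|exact: cK].
have dPQ (y : R) : -1 <= y <= 1 -> is_derive y 1 (fun y => P y - Q y) (H y - K y).
  move=> /andP[y1 y2]; apply: is_derive_fD; [apply: dP|apply: is_derive_fN; apply: dQ]; lra.
have le11 : -1 <= 1 :> R by lra.
have <- := @integral_derive R (fun y => P y - Q y) _ _ _ le11 dPQ (fun y _ => cHK y).
rewrite [RHS]integral_mkcond; apply: eq_integral => y _.
rewrite restrict_EFin; congr (_%:E); rewrite /patch; case: ifPn => //.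
rewrite notin_setE/= in_itv/= => /negP; rewrite -ler_norml -ltNge => /ltW y1.
by rewrite HK// subrr.
Qed.

(** The second clause lets each arc have its own primitive [G]: all increments are those of a common
    [F], and they telescope. *)
Lemma arc_primitive (f : R -> R) : continuous f -> exists F : R -> R,
  forall a b : R, 0 <= a -> a <= b -> b <= 2 * pi ->
    \int[mu]_(t in `[a, b]) f t = F b - F a /\
    forall G : R -> R, (forall t : R, a <= t <= b -> is_derive t 1 G (f t)) ->
      G b - G a = F b - F a.
Proof.
move=> cf; have [F dF] := exists_primitive (2 * pi + 1) cf; have pi0 := @pi_gt0 R.
exists F => a b a0 ab bpi.
have FE : \int[mu]_(t in `[a, b]) f t = F b - F a.
  apply: (Rintegral_derive ab) => t /andP[at_ tb]; last exact: cf.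
  by apply: dF; apply/andP; split; lra.
split => // G dG; rewrite -FE; symmetry.
by apply: (Rintegral_derive ab) => t _; exact: cf.
Qed.

(* On each arc where the cosine has constant sign, a primitive of the values of
   [g] along a half circle, composed with the sine, is a primitive of the
   integrand. *)
Lemma integral_arc_cos g : continuous g ->
  (\int[mu]_y (g (halfchord y, y) - g (- halfchord y, y))%:E =
   (\int[mu]_(t in `[0, 2 * pi]) (g (cos t, sin t) * cos t))%:E)%E.
Proof.
move=> cg.
have [| | |P [Q [dP dQ ->]]] := @difference_primitives
    (fun y => g (halfchord y, y)) (fun y => g (- halfchord y, y)).
- by apply: continuous_graph => //; [exact: halfchord_continuous|exact: continuous_fid].
- by apply: continuous_graph => //; [exact: continuous_halfchordN|exact: continuous_fid].
- by move=> y y1; rewrite halfchord_eq0// oppr0.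
congr (_%:E).
have [|F FE] := @arc_primitive (fun t => g (cos t, sin t) * cos t).
  move=> t; apply: cvgM; last exact: continuous_cos.
  by apply: continuous_graph => //; [exact: continuous_cos|exact: continuous_sin].
have pi0 := @pi_gt0 R.
have sin1 (t : R) : -2 < sin t < 2.
  by have := @sin_max R t; rewrite ler_norml => /andP[? ?]; apply/andP; split; lra.
have dPs (t : R) : 0 <= cos t -> is_derive t 1 (fun t => P (sin t)) (g (cos t, sin t) * cos t).
  move=> c0; apply: (is_derive_eq (is_derive_fcomp (dP _ (sin1 t)) (is_derive_sin t))).
  by rewrite halfchord_sin ger0_norm.
have dQs (t : R) : cos t <= 0 -> is_derive t 1 (fun t => Q (sin t)) (g (cos t, sin t) * cos t).
  move=> c0; apply: (is_derive_eq (is_derive_fcomp (dQ _ (sin1 t)) (is_derive_sin t))).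
  by rewrite halfchord_sin ler0_norm// opprK.
have s32 : sin (pi + pi / 2) = -1 :> R by rewrite addrC sinDpi sin_pihalf.
have s2 : sin (2 * pi) = 0 :> R by rewrite mulr_natl sin2pi.
have [_ /(_ (fun t => P (sin t)))] := FE 0 (pi / 2) ltac:(lra) ltac:(lra) ltac:(lra).
rewrite sin0 sin_pihalf => e1.
have [_ /(_ (fun t => Q (sin t)))] :=
  FE (pi / 2) (pi + pi / 2) ltac:(lra) ltac:(lra) ltac:(lra).
rewrite s32 sin_pihalf => e2.
have [_ /(_ (fun t => P (sin t)))] :=
  FE (pi + pi / 2) (2 * pi) ltac:(lra) ltac:(lra) ltac:(lra).
rewrite s32 s2 => e3.
have [-> _] := FE 0 (2 * pi) ltac:(lra) ltac:(lra) ltac:(lra).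
have {}e1 : P 1 - P 0 = F (pi / 2) - F 0.
  by apply: e1 => t /andP[t0 tpi]; apply: dPs; apply: cos_ge0_pihalf; apply/andP; split; lra.
have {}e2 : Q (-1) - Q 1 = F (pi + pi / 2) - F (pi / 2).
  apply: e2 => t /andP[t0 tpi]; apply: dQs; rewrite -[t](subrK pi) cosDpi oppr_le0.
  by apply: cos_ge0_pihalf; apply/andP; split; lra.
have {}e3 : P 0 - P (-1) = F (2 * pi) - F (pi + pi / 2).
  apply: e3 => t /andP[t0 tpi]; apply: dPs.
  have -> : cos t = cos (t - 2 * pi) by rewrite -[RHS]cosD2pi; congr cos; ring.
  by apply: cos_ge0_pihalf; apply/andP; split; lra.
by move: e1 e2 e3; lra.
Qed.

(** Here two arcs suffice, [0, pi] and [pi, 2 pi], on which the sine has constant sign. The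
    primitives are composed with the cosine, whose derivative accounts for the minus signs. *)
Lemma integral_arc_sin g : continuous g ->
  (\int[mu]_x (g (x, halfchord x) - g (x, - halfchord x))%:E =
   (\int[mu]_(t in `[0, 2 * pi]) (g (cos t, sin t) * sin t))%:E)%E.
Proof.
move=> cg.
have [| | |P [Q [dP dQ ->]]] := @difference_primitives
    (fun x => g (x, halfchord x)) (fun x => g (x, - halfchord x)).
- by apply: continuous_graph => //; [exact: continuous_fid|exact: halfchord_continuous].
- by apply: continuous_graph => //; [exact: continuous_fid|exact: continuous_halfchordN].
- by move=> y y1; rewrite halfchord_eq0// oppr0.
congr (_%:E).
have [|F FE] := @arc_primitive (fun t => g (cos t, sin t) * sin t).
  move=> t; apply: cvgM; last exact: continuous_sin.
  by apply: continuous_graph => //; [exact: continuous_cos|exact: continuous_sin].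
have pi0 := @pi_gt0 R.
have cos1 (t : R) : -2 < cos t < 2.
  by have := @cos_max R t; rewrite ler_norml => /andP[? ?]; apply/andP; split; lra.
have dPs (t : R) : 0 <= sin t -> is_derive t 1 (fun t => - P (cos t)) (g (cos t, sin t) * sin t).
  move=> c0; apply: (is_derive_eq (is_derive_fN (is_derive_fcomp (dP _ (cos1 t)) (is_derive_cos t)))).
  by rewrite halfchord_cos ger0_norm// mulrN opprK.
have dQs (t : R) : sin t <= 0 -> is_derive t 1 (fun t => - Q (cos t)) (g (cos t, sin t) * sin t).
  move=> c0; apply: (is_derive_eq (is_derive_fN (is_derive_fcomp (dQ _ (cos1 t)) (is_derive_cos t)))).
  by rewrite halfchord_cos ler0_norm// opprK mulrN opprK.
have c2 : cos (2 * pi) = 1 :> R by rewrite mulr_natl cos2pi.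
have [_ /(_ (fun t => - P (cos t)))] := FE 0 pi ltac:(lra) ltac:(lra) ltac:(lra).
rewrite cos0 cospi => e1.
have [_ /(_ (fun t => - Q (cos t)))] := FE pi (2 * pi) ltac:(lra) ltac:(lra) ltac:(lra).
rewrite c2 cospi => e2.
have [-> _] := FE 0 (2 * pi) ltac:(lra) ltac:(lra) ltac:(lra).
have {}e1 : - P (-1) - - P 1 = F pi - F 0.
  by apply: e1 => t /andP[t0 tpi]; apply: dPs; apply: sin_ge0_pi; rewrite t0.
have {}e2 : - Q 1 - - Q (-1) = F (2 * pi) - F pi.
  apply: e2 => t /andP[t0 tpi]; apply: dQs; rewrite -[t](subrK pi) sinDpi oppr_le0.
  by apply: sin_ge0_pi; apply/andP; split; lra.
by move: e1 e2; lra.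
Qed.

End Arcs.

Lemma in_setb (T : Type) (b : T -> bool) x : (x \in [set y | b y]) = b x.
Proof. by apply/idP/idP; rewrite inE. Qed.

Lemma in_disk (R : realType) (x y : R) : ((x, y) \in disk) = (x ^+ 2 + y ^+ 2 < 1).
Proof. exact: (@in_setb _ (fun q : R * R => q.1 ^+ 2 + q.2 ^+ 2 < 1)). Qed.

Lemma in_cylinder (R : realType) (q : R * R) z :
  ((q, z) \in cylinder) = (q \in disk) && (0 < z).
Proof.
apply/idP/idP; first by rewrite inE => -[/= qD ->]; rewrite andbT inE.
by move=> /andP[]; rewrite !inE; split.
Qed.

Section SigmaFiniteCopy.
Context d (T : measurableType d) (R : realType) (m : {measure set T -> \bar R}).

(** The same measure under a name that carries the proof, so that a sigma-finite structure can be
    attached to it; convertibility then lets Fubini apply to the original measure. *)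
Definition sigma_finite_copy of sigma_finite setT m : set T -> \bar R := m.

Variable mfin : sigma_finite setT m.
HB.instance Definition _ := Measure.copy (sigma_finite_copy mfin) m.
HB.instance Definition _ :=
  @Measure_isSigmaFinite.Build d T R (sigma_finite_copy mfin) mfin.

End SigmaFiniteCopy.

Section Fubini.
Context d1 d2 (T1 : measurableType d1) (T2 : measurableType d2) (R : realType).
Variable m1 : {sigma_finite_measure set T1 -> \bar R}.
Variable m2 : {sigma_finite_measure set T2 -> \bar R}.
Implicit Types f : T1 * T2 -> R.

Lemma Rintegral_prod1 f (G : T1 -> R) :
  (m1 \x m2)%E.-integrable setT (EFin \o f) ->
  (forall x, (\int[m2]_y (f (x, y))%:E)%E = (G x)%:E) ->
  \int[(m1 \x m2)%E]_p f p = \int[m1]_x G x.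
Proof.
move=> intf fG; rewrite /Rintegral -(integral12_prod_meas1 intf).
by congr fine; apply: eq_integral => x _; exact: fG.
Qed.

Lemma Rintegral_prod2 f (G : T2 -> R) :
  (m1 \x m2)%E.-integrable setT (EFin \o f) ->
  (forall y, (\int[m1]_x (f (x, y))%:E)%E = (G y)%:E) ->
  \int[(m1 \x m2)%E]_p f p = \int[m2]_y G y.
Proof.
move=> intf fG; rewrite /Rintegral -(integral21_prod_meas1 intf).
by congr fine; apply: eq_integral => y _; exact: fG.
Qed.

End Fubini.

Section Divergence.
Context {R : realType}.
Local Notation R2 := (R * R)%type.
Local Notation R3 := (R * R * R)%type.
Local Notation mu := (@lebesgue_measure R).
Local Notation mu2 := (mu \x mu)%E.
Local Notation mu3 := (mu2 \x mu)%E.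
Implicit Types (v w : R3 -> R).

Definition lateral : set R2 := `[0, 2 * pi]%classic `*` `]0, +oo[%classic.

Lemma in_lateral (t z : R) :
  ((t, z) \in lateral) = (t \in `[0, 2 * pi]%classic) && (0 < z).
Proof.
rewrite /lateral in_setX/=; congr (_ && _).
by apply/idP/idP; rewrite inE/= in_itv/= andbT.
Qed.

(* The Lebesgue measure lives on this type, which is only convertible to [R] as a
   measurable type. *)
Local Notation RT := (measurableTypeR R).

Lemma mu2_measurable_disk : @measurable _ (RT * RT)%type (@disk R).
Proof. exact: measurable_disk. Qed.

Lemma mu3_measurable_cylinder : @measurable _ (RT * RT * RT)%type (@cylinder R).
Proof. exact: measurable_cylinder. Qed.

Lemma mu2_measurable_rectangle (i j : interval R) :
  @measurable _ (RT * RT)%type ([set` i] `*` [set` j] : set R2).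
Proof. by apply: measurableX; exact: measurable_itv. Qed.

Lemma mu2_measurable_lateral : @measurable _ (RT * RT)%type lateral.
Proof. exact: mu2_measurable_rectangle. Qed.

Lemma mu3_measurable_box3 L : @measurable _ (RT * RT * RT)%type (@box3 R L).
Proof. by do 2?apply: measurableX; exact: measurable_itv. Qed.

Lemma lebesgue_itv_lty (a b : R) : (mu `[a, b]%classic < +oo)%E.
Proof. by rewrite lebesgue_measure_itv; case: ifP => // _; rewrite -EFinB ltry. Qed.

Lemma mu2_rectangle_lty (a b c e : R) :
  (mu2 (`[a, b]%classic `*` `[c, e]%classic) < +oo)%E.
Proof.
rewrite product_measure1E; [|exact: measurable_itv|exact: measurable_itv].
by rewrite lte_mul_pinfty// ?lebesgue_itv_lty// ge0_fin_numE ?lebesgue_itv_lty.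
Qed.

Lemma mu3_box3_lty L : (mu3 (box3 L) < +oo)%E.
Proof.
rewrite product_measure1E; [|exact: mu2_measurable_rectangle|exact: measurable_itv].
by rewrite lte_mul_pinfty// ?lebesgue_itv_lty// ge0_fin_numE ?mu2_rectangle_lty.
Qed.

Lemma mu2_disk_lty : (mu2 (@disk R) < +oo)%E.
Proof.
apply: (le_lt_trans _ (mu2_rectangle_lty (-1) 1 (-1) 1)).
apply: le_measure; rewrite ?inE.
- exact: mu2_measurable_disk.
- exact: mu2_measurable_rectangle.
move=> [x y]; rewrite /disk /= !in_itv/= -!ler_norml => xy1.
split; rewrite -(@expr_le1 _ 2)// real_normK ?num_real// ltW//.
  by apply: le_lt_trans xy1; rewrite lerDl sqr_ge0.
by apply: le_lt_trans xy1; rewrite lerDr sqr_ge0.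
Qed.

Lemma continuous_lateral (v : R3 -> R) : continuous v ->
  measurable_fun setT (fun tz : R2 => v (cos tz.1, sin tz.1, tz.2)).
Proof.
move=> cv; apply: continuous_measurable2 => tz.
apply: (@continuous_comp _ _ _ (fun tz : R2 => (cos tz.1, sin tz.1, tz.2)) v); last exact: cv.
have c1 : {for tz, continuous (fst : R2 -> R)} by exact: cvg_fst.
have c2 : {for tz, continuous (snd : R2 -> R)} by exact: cvg_snd.
apply: continuous_pair_at => //; apply: continuous_pair_at.
  by apply: (@continuous_comp _ _ _ fst cos) => //; exact: continuous_cos.
by apply: (@continuous_comp _ _ _ fst sin) => //; exact: continuous_sin.
Qed.

Lemma continuous_bottom (v : R3 -> R) : continuous v ->
  continuous (fun q : R2 => v (q, 0)).
Proof. by move=> cv; apply: (continuous_pair1 (f := v)). Qed.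

Let mu1s : {sigma_finite_measure set RT -> \bar R} := mu.
Lemma sigma_finite_mu2 : sigma_finite setT mu2.
Proof.
exists (fun n : nat => `[- n%:R, n%:R]%classic `*` `[- n%:R, n%:R]%classic); last first.
  by move=> n; split; [exact: mu2_measurable_rectangle|exact: mu2_rectangle_lty].
apply/seteqP; split=> // -[x y] _.
exists (maxn (Num.bound `|x|) (Num.bound `|y|)) => //=.
rewrite !in_itv/= -!ler_norml; split; apply: (le_trans (ltW (archi_boundP (normr_ge0 _))));
  by rewrite ler_nat ?leq_maxl ?leq_maxr.
Qed.

Let mu2s : {sigma_finite_measure set (RT * RT)%type -> \bar R} :=
  sigma_finite_copy sigma_finite_mu2.

Lemma Rintegral_mu3_bottom (f : R3 -> R) (G : R2 -> R) :
  mu3.-integrable setT (EFin \o f) ->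
  (forall q, (\int[mu]_z (f (q, z))%:E)%E = (G q)%:E) ->
  \int[mu3]_p f p = \int[mu2]_q G q.
Proof. by move=> intf fG; exact: (@Rintegral_prod1 _ _ _ _ R mu2s mu1s f G intf fG). Qed.

Lemma Rintegral_mu3_height (f : R3 -> R) (G : R -> R) :
  mu3.-integrable setT (EFin \o f) ->
  (forall z, (\int[mu2]_q (f (q, z))%:E)%E = (G z)%:E) ->
  \int[mu3]_p f p = \int[mu]_z G z.
Proof. by move=> intf fG; exact: (@Rintegral_prod2 _ _ _ _ R mu2s mu1s f G intf fG). Qed.

Lemma Rintegral_mu2_height (f : R2 -> R) (G : R -> R) :
  mu2.-integrable setT (EFin \o f) ->
  (forall z, (\int[mu]_t (f (t, z))%:E)%E = (G z)%:E) ->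
  \int[mu2]_p f p = \int[mu]_z G z.
Proof. by move=> intf fG; exact: (@Rintegral_prod2 _ _ _ _ R mu1s mu1s f G intf fG). Qed.

Section C1cFunctions.
Variable v : R3 -> R.
Hypothesis C1cv : C1c setT v.

Let cv : continuous v. Proof. by have [[]] := C1cv. Qed.
Let cdv i : continuous (partial i v).
Proof. by have [[_ dv] _] := C1cv; have [] := dv i. Qed.

Lemma C1c_measurable : measurable_fun setT v.
Proof. exact: continuous_measurable3. Qed.

Lemma C1c_partial_measurable i : measurable_fun setT (partial i v).
Proof. exact: continuous_measurable3. Qed.

Lemma C1c_L2 : L2 mu3 cylinder v.
Proof.
have [L [M [L0 M0 vM _ v0]]] := C1c_bounded C1cv.
apply: (L2_finite_support mu3_measurable_cylinder (mu3_measurable_box3 L) (mu3_box3_lty L) _ M0).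
- by apply: measurable_funTS; exact: C1c_measurable.
- by move=> p _; exact: vM.
- by move=> p _ /v0[].
Qed.

Lemma C1c_partial_L2 i : L2 mu3 cylinder (partial i v).
Proof.
have [L [M [L0 M0 _ dvM v0]]] := C1c_bounded C1cv.
apply: (L2_finite_support mu3_measurable_cylinder (mu3_measurable_box3 L) (mu3_box3_lty L) _ M0).
- by apply: measurable_funTS; exact: C1c_partial_measurable.
- by move=> p _; exact: dvM.
- by move=> p _ /v0[_].
Qed.

Lemma C1c_bottom_L2 : L2 mu2 disk (fun q => v (q, 0)).
Proof.
have [L [M [L0 M0 vM _ v0]]] := C1c_bounded C1cv.
apply: (L2_bounded mu2_measurable_disk mu2_disk_lty (K := M)) => //.
by apply: measurable_funTS; apply: continuous_measurable2; exact: continuous_bottom.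
Qed.

Lemma C1c_lateral_L2 : L2 mu2 lateral (fun tz => v (cos tz.1, sin tz.1, tz.2)).
Proof.
have [L [M [L0 M0 vM _ v0]]] := C1c_bounded C1cv.
apply: (L2_finite_support mu2_measurable_lateral (mu2_measurable_rectangle `[0, 2 * pi] `[- L, L]) (mu2_rectangle_lty _ _ _ _) _ M0).
- by apply: measurable_funTS; exact: continuous_lateral.
- by move=> tz _; exact: vM.
- move=> [t z] [/= t2 _] nA; apply: (v0 _ _).1 => -[_ zL]; apply: nA.
  by split.
Qed.

Lemma integral_halfline_partial (q : R2) :
  (\int[mu]_z (((fun z : R => partial (inord 2) v (q, z)) \_ `]0%R, +oo[%classic) z)%:E)%E =
  (- v (q, 0))%:E.
Proof.
have [L [M [L0 M0 vM _ v0]]] := C1c_bounded C1cv.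
have dvz (z : R) : is_derive z 1 (fun z => v (q, z)) (partial (inord 2) v (q, z)).
  have := C1_is_derive (C1c_C1 C1cv) (inord 2) (q, 0) z.
  by rewrite /upd3 inordK//= -surjective_pairing.
have cz : continuous (fun z => partial (inord 2) v (q, z)).
  exact: (continuous_pair2 (f := partial (inord 2) v)).
(* The support lies in the box of half-side [L]; at height [L + 1] the function is 0, and the
   half-line reduces to a segment. *)
have L10 : 0 <= L + 1 by rewrite addr_ge0// ltW.
have out z : L < z -> ~ box3 L (q, z).
  by move=> Lz [_ /=]; rewrite in_itv/= => /andP[_]; rewrite leNgt Lz.
have := @integral_derive R _ _ 0 (L + 1) L10 (fun z _ => dvz z) (fun z _ => cz z).
rewrite (v0 (q, L + 1) _).1; last by apply: out; rewrite ltrDl.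
rewrite sub0r => <-.
rewrite -integral_itv_obnd_cbnd; last first.
  by apply/measurable_EFinP; apply: measurable_funTS; exact: continuous_measurable_fun.
rewrite [RHS]integral_mkcond; apply: eq_integral => z _.
rewrite restrict_EFin; congr (_%:E); rewrite /patch !mem_setE !in_itv/= andbT.
case: ifPn => //= z0; case: leP => // Lz.
by apply: (v0 (q, z) _).2; apply: out; rewrite (lt_trans _ Lz)// ltrDl.
Qed.

(** The vertical direction is tangent to the lateral boundary, so that the bottom alone contributes;
    the sign is that of the exterior normal, which points down. The integration in [z] is done
    first, over each point of the disk. *)
Lemma divergence_bottom :
  \int[mu3]_(p in cylinder) partial (inord 2) v p = - \int[mu2]_(q in disk) v (q, 0).
Proof.
rewrite Rintegral_mkcond.
transitivity (\int[mu2]_q (((fun q => - v (q, 0)) \_ disk) q)); last first.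
  rewrite -Rintegral_mkcond -mulN1r -RintegralZl//; last 2 first.
  - exact: mu2_measurable_disk.
  - have [L [M [L0 M0 vM _ v0]]] := C1c_bounded C1cv.
    apply: (integrable_finite_support mu2_measurable_disk mu2_measurable_disk mu2_disk_lty (M := M)) => //.
    by apply: measurable_funTS; apply: continuous_measurable2; exact: continuous_bottom.
  by apply: eq_Rintegral => q _; rewrite mulN1r.
apply: Rintegral_mu3_bottom.
- have [L [M [L0 M0 _ dvM v0]]] := C1c_bounded C1cv.
  rewrite -restrict_EFin; apply/(integrable_mkcond _ mu3_measurable_cylinder).
  apply: (integrable_finite_support mu3_measurable_cylinder (mu3_measurable_box3 L) (mu3_box3_lty L) (M := M)) => //.
  + by apply: measurable_funTS; exact: C1c_partial_measurable.
  + by move=> p _ /v0[_].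
- move=> q; rewrite {2}/patch; case: ifPn => qD.
    rewrite -integral_halfline_partial; apply: eq_integral => z _; congr (_%:E).
    rewrite /patch cylinderE; congr (if _ then _ else _).
    by rewrite in_setX qD.
  rewrite (eq_integral (fun=> 0%E)) ?integral0// => z _; congr (_%:E).
  by rewrite /patch cylinderE in_setX (negbTE qD).
Qed.

End C1cFunctions.

(** Fubini reduces the integral to chords in the direction of the derivative, the fundamental
    theorem of calculus to their ends, and the arc lemmas to the circle, where (cos t, sin t) is the
    normal. The boolean selects the first or the second coordinate. *)
Lemma integral_disk_partial (w wd : R2 -> R) (i : bool) : continuous w -> continuous wd ->
  (forall q : R2, if i then forall t : R, is_derive t 1 (fun t => w (t, q.2)) (wd (t, q.2))
        else forall t : R, is_derive t 1 (fun t => w (q.1, t)) (wd (q.1, t))) ->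
  (\int[mu2]_(q in disk) (wd q)%:E)%E =
  (\int[mu]_(t in `[0, 2 * pi]) (w (cos t, sin t) * (if i then cos t else sin t)))%:E.
Proof.
move=> cw cwd dw.
have [M M0 HM] : exists2 M : R, 0 <= M & forall q, disk q -> `|wd q| <= M.
  have [M M0 HM] := @continuous_box3_bounded R (fun p => wd p.1) 1
    (fun p => @continuous_comp _ _ _ (fst : R3 -> R2) wd p (@cvg_fst _ _ _ _ _) (cwd p.1)).
  exists M => // -[x y]; rewrite /disk /= => xy1; apply: (HM (x, y, 0)).
  rewrite /box3 /= !in_itv/= -!ler_norml normr0 ler01; split => //.
  split; rewrite -(@expr_le1 _ 2)// real_normK ?num_real// ltW//.
    by apply: le_lt_trans xy1; rewrite lerDl sqr_ge0.
  by apply: le_lt_trans xy1; rewrite lerDr sqr_ge0.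
have intw : mu2.-integrable setT (EFin \o (wd \_ disk)).
  rewrite -restrict_EFin; apply/(integrable_mkcond _ mu2_measurable_disk).
  apply: (integrable_finite_support mu2_measurable_disk mu2_measurable_disk mu2_disk_lty (M := M)) => //.
  by apply: measurable_funTS; exact: continuous_measurable2.
rewrite integral_mkcond restrict_EFin.
case: i dw => dw.
  rewrite -integral_arc_cos// -(integral21_prod_meas1 intw).
  apply: eq_integral => y _.
  have <- := @integral_chord R (fun x => w (x, y)) (fun x => wd (x, y)) y
    (dw (0, y)) (continuous_pair1 cwd).
  by apply: eq_integral => x _; congr (_%:E); rewrite /patch in_disk in_setb.
rewrite -integral_arc_sin// -(integral12_prod_meas1 intw).
apply: eq_integral => x _.
have <- := @integral_chord R (fun y => w (x, y)) (fun y => wd (x, y)) x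
  (dw (x, 0)) (continuous_pair2 cwd).
by apply: eq_integral => y _; congr (_%:E); rewrite /patch in_disk in_setb addrC.
Qed.

(** A weight in [z] alone commutes with the horizontal derivatives, so measurability and a bound are
    enough for it. This admits the conductivity, discontinuous at [h], as a factor of [b]. *)
Lemma divergence_lateral v (b : R -> R) (B : R) (i : bool) : C1c setT v ->
  measurable_fun setT b -> (forall z, 0 < z -> `|b z| <= B) ->
  \int[mu3]_(p in cylinder) (b p.2 * partial (if i then ord0 else inord 1) v p) =
  \int[mu2]_(tz in lateral) (b tz.2 * (if i then cos tz.1 else sin tz.1)
                             * v (cos tz.1, sin tz.1, tz.2)).
Proof.
move=> C1cv mb bB.
have [L [M [L0 M0 vM dvM v0]]] := C1c_bounded C1cv.
have cv : continuous v by have [[]] := C1cv.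
have cdv j : continuous (partial j v) by have [[_ dv] _] := C1cv; have [] := dv j.
set k := if i then _ else _.
pose s (t : R) : R := if i then cos t else sin t.
have s1 t : `|s t| <= 1.
  by rewrite /s; case: (i); [exact: cos_max|exact: sin_max].
have cs : continuous s by rewrite /s; case: (i); [exact: continuous_cos|exact: continuous_sin].
pose arc z := \int[mu]_(t in `[0, 2 * pi]) (v (cos t, sin t, z) * s t).
pose G z := b z * arc z.
have mb2 d (T : measurableType d) : measurable_fun setT (fun p : T * R => b p.2).
  by apply: (measurableT_comp mb); exact: measurable_snd.
have carc z : continuous (fun t => v (cos t, sin t, z) * s t).
  move=> t; apply: cvgM; last exact: cs.
  apply: (@continuous_graph R (fun q => v (q, z)) cos sin).
  - exact: continuous_pair1.
  - exact: continuous_cos.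
  - exact: continuous_sin.
have iarc z : mu.-integrable `[0, 2 * pi]%classic (EFin \o (fun t => v (cos t, sin t, z) * s t)).
  by apply: continuous_compact_integrable; [exact: segment_compact|exact: continuous_subspaceT].
transitivity (\int[mu]_z ((G \_ `]0, +oo[%classic) z)).
  rewrite Rintegral_mkcond; apply: Rintegral_mu3_height.
    rewrite -restrict_EFin; apply/(integrable_mkcond _ mu3_measurable_cylinder).
    apply: (integrable_finite_support mu3_measurable_cylinder (mu3_measurable_box3 L) (mu3_box3_lty L) (M := B * M)).
    + apply: measurable_funTS; apply: measurable_funM; first exact: mb2.
      exact: C1c_partial_measurable.
    + by move=> p [_ p0]; rewrite normrM ler_pM// bB.
    + by move=> p _ /v0[_ ->]; rewrite mulr0.
  move=> z; rewrite [in RHS]/patch mem_setE in_itv/= andbT; case: ifPn => z0; last first.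
    rewrite (eq_integral (fun=> 0%E)) ?integral0// => q _; congr (_%:E).
    by rewrite /patch in_cylinder (negbTE z0) andbF.
  have := @integral_disk_partial (fun q => v (q, z)) (fun q => partial k v (q, z)) i
    (continuous_pair1 cv) (continuous_pair1 (cdv k)).
  rewrite -/(s _) => E.
  have {}E : (\int[mu2]_(q in disk) (partial k v (q, z))%:E = (arc z)%:E)%E.
    rewrite E; last first.
      move=> q; rewrite /k; case: (i) => t.
        have := C1_is_derive (C1c_C1 C1cv) ord0 (0, q.2, z) t.
        by rewrite /upd3 /=.
      have := C1_is_derive (C1c_C1 C1cv) (inord 1) (q.1, 0, z) t.
      by rewrite /upd3 inordK.
    by [].
  rewrite /G EFinM -E -integralZl; last 2 first.
  - exact: mu2_measurable_disk.
  - apply: (integrable_finite_support mu2_measurable_disk mu2_measurable_disk mu2_disk_lty (M := M)) => //.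
    by apply: measurable_funTS; apply: continuous_measurable2; exact: continuous_pair1.
  rewrite [RHS]integral_mkcond; apply: eq_integral => q _.
  rewrite /patch in_cylinder z0 andbT.
  by case: ifPn.
symmetry; rewrite Rintegral_mkcond; apply: Rintegral_mu2_height.
  rewrite -restrict_EFin; apply/(integrable_mkcond _ mu2_measurable_lateral).
  apply: (integrable_finite_support mu2_measurable_lateral (mu2_measurable_rectangle `[0, 2 * pi] `[- L, L]) (mu2_rectangle_lty _ _ _ _) (M := B * M)).
  - apply: measurable_funTS; apply: measurable_funM; last exact: continuous_lateral.
    apply: measurable_funM; first exact: mb2.
    by apply: (measurableT_comp (continuous_measurable_fun cs)); exact: measurable_fst.
  - move=> [t z] [/= _]; rewrite in_itv/= andbT => z0.
    rewrite normrM ler_pM// normrM -[B]mulr1 ler_pM// ?bB//; exact: s1.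
  - move=> [t z] [/= t2 _] nA; rewrite (v0 _ _).1 ?mulr0// => -[_ zL]; apply: nA.
    by split.
move=> z; rewrite [in RHS]/patch mem_setE in_itv/= andbT; case: ifPn => z0; last first.
  rewrite (eq_integral (fun=> 0%E)) ?integral0// => q _; congr (_%:E).
  by rewrite /patch in_lateral (negbTE z0) andbF.
rewrite /G EFinM /arc /Rintegral fineK; last exact: (integrable_fin_num _ (iarc z)).
rewrite -integralZl//; last exact: iarc.
rewrite [RHS]integral_mkcond; apply: eq_integral => t _.
rewrite /patch in_lateral z0 andbT.
by case: ifPn => // _; rewrite -/(s t) -EFinM mulrAC mulrA.
Qed.

End Divergence.

(** * Green formulas and uniqueness of weak solutions *)

Lemma Rintegral_eq0 d (T : measurableType d) (R : realType)
    (m : {measure set T -> \bar R}) (D : set T) (f : T -> R) :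
  (forall x, D x -> f x = 0) -> \int[m]_(x in D) f x = 0.
Proof.
move=> f0; rewrite /Rintegral (eq_integral (fun=> 0%E)) ?integral0// => x.
by rewrite inE => /f0 ->.
Qed.

Section Green.
Context {R : realType}.
Local Notation R2 := (R * R)%type.
Local Notation R3 := (R * R * R)%type.
Local Notation mu := (@lebesgue_measure R).
Local Notation mu2 := (mu \x mu)%E.
Local Notation mu3 := (mu2 \x mu)%E.
Implicit Types (u v w : R3 -> R) (Du Dv : 'I_3 -> R3 -> R).

Lemma cvgn_eq (f g : nat -> R) (a b : R) : f k @[k --> \oo] --> a ->
  g k @[k --> \oo] --> b -> (forall k, f k = g k) -> a = b.
Proof.
move=> fa gb fg; have E : f = g by apply/funext.
by rewrite E in fa; exact: (cvg_unique _ fa gb).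
Qed.

Lemma cvgnD (f g : nat -> R) (a b : R) : f k @[k --> \oo] --> a ->
  g k @[k --> \oo] --> b -> f k + g k @[k --> \oo] --> a + b.
Proof. by move=> fa gb; exact: cvgD. Qed.

Lemma cvgnN (f : nat -> R) (a : R) : f k @[k --> \oo] --> a ->
  - f k @[k --> \oo] --> - a.
Proof. by move=> fa; exact: cvgN. Qed.

Lemma C1cM v w : C1c setT v -> C1c setT w -> C1c setT (fun p => v p * w p).
Proof. by move=> [C1v _]; exact: C1c_mul. Qed.

Lemma C1c_out (O : set R3) v p : C1c O v -> ~ O p -> v p = 0.
Proof. by move=> [_ [K [_ KO] K0]] Op; apply: K0 => /KO. Qed.

Lemma not_disk_circle (t : R) : ~ disk (cos t, sin t).
Proof. by rewrite /disk /= cos2Dsin2 ltxx. Qed.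

Lemma Rintegral_partial_eq0 i w : C1c cylinder w ->
  \int[mu3]_(p in cylinder) partial i w p = 0.
Proof.
move=> C1w; have C1w' := C1cS (@subsetT _ _) C1w.
have lat (b : bool) : \int[mu3]_(p in cylinder) partial (if b then ord0 else inord 1) w p = 0.
  have b1 (z : R) : 0 < z -> `|cst 1 z| <= 1 :> R by rewrite normr1.
  have E := @divergence_lateral R w (cst 1) 1 b C1w' (measurable_cst _) b1.
  transitivity (\int[mu3]_(p in cylinder) (cst 1 p.2 * partial (if b then ord0 else inord 1) w p)).
    by apply: eq_Rintegral => p _; rewrite mul1r.
  rewrite E; apply: Rintegral_eq0 => tz _.
  by rewrite (C1c_out C1w) ?mulr0// => -[/not_disk_circle].
case: (ord3P i) => ->; [exact: (lat true)|exact: (lat false)|].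
rewrite divergence_bottom// Rintegral_eq0 ?oppr0// => q _.
by rewrite (C1c_out C1w)// => -[_]/=; rewrite ltxx.
Qed.

Lemma RintegralM_partial i v w : C1c setT v -> C1c setT w ->
  \int[mu3]_(p in cylinder) partial i (fun p => v p * w p) p =
  \int[mu3]_(p in cylinder) (partial i v p * w p) +
  \int[mu3]_(p in cylinder) (v p * partial i w p).
Proof.
move=> C1v C1w; have [_ pE] := C1M (C1c_C1 C1v) (C1c_C1 C1w).
rewrite pE RintegralD//; first exact: mu3_measurable_cylinder.
- apply: L2_integrableM; [exact: mu3_measurable_cylinder|exact: C1c_partial_L2|exact: C1c_L2].
- apply: L2_integrableM; [exact: mu3_measurable_cylinder|exact: C1c_L2|exact: C1c_partial_L2].
Qed.

Section Limits.
Variables (u : R3 -> R) (Du : 'I_3 -> R3 -> R) (vk : nat -> R3 -> R).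
Hypotheses (C1vk : forall k, C1c setT (vk k)) (Lu : L2 mu3 cylinder u)
  (LDu : forall i, L2 mu3 cylinder (Du i)) (cu : cvgL2 mu3 cylinder vk u)
  (cDu : forall i, cvgL2 mu3 cylinder (fun k => partial i (vk k)) (Du i)).

Let mC := @mu3_measurable_cylinder R.

Lemma cvg_Rintegral_vk (f : R3 -> R) : L2 mu3 cylinder f ->
  \int[mu3]_(p in cylinder) (vk k p * f p) @[k --> \oo] -->
  \int[mu3]_(p in cylinder) (u p * f p).
Proof.
by move=> Lf; apply: cvgL2_RintegralM => // k; exact: C1c_L2.
Qed.

Lemma cvg_Rintegral_partial_vk i (f : R3 -> R) : L2 mu3 cylinder f ->
  \int[mu3]_(p in cylinder) (partial i (vk k) p * f p) @[k --> \oo] -->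
  \int[mu3]_(p in cylinder) (Du i p * f p).
Proof.
move=> Lf.
exact: (cvgL2_RintegralM mC (fun k => C1c_partial_L2 (C1vk k) i) (LDu i) Lf (cDu i)).
Qed.

(** Integration by parts holds for each approximant and passes to the limit; so approximation in the
    sense of [has_trace] yields the weak gradient required by [H1]. *)
Lemma limit_weak_partial i : weak_partial i u (Du i).
Proof.
move=> w C1w; have C1w' := C1cS (@subsetT _ _) C1w.
have h1 := cvg_Rintegral_vk (C1c_partial_L2 C1w' i).
have h2 := cvg_Rintegral_partial_vk (i := i) (C1c_L2 C1w').
apply: (cvgn_eq h1 (cvgnN h2)) => k; apply/eqP; rewrite -addr_eq0 addrC.
rewrite -(RintegralM_partial i (C1vk k) C1w').
by rewrite Rintegral_partial_eq0//; apply: C1c_mul => //; exact: C1c_C1 (C1vk k).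
Qed.

Lemma limit_H1 : H1 u Du.
Proof. by split => // i; split => //; exact: limit_weak_partial. Qed.

Lemma limit_green_bottom (g : R2 -> R) w : L2 mu2 disk g ->
  cvgL2 mu2 disk (fun k q => vk k (q, 0)) g -> C1c setT w ->
  \int[mu3]_(p in cylinder) (Du (inord 2) p * w p) +
  \int[mu3]_(p in cylinder) (u p * partial (inord 2) w p) =
  - \int[mu2]_(q in disk) (g q * w (q, 0)).
Proof.
move=> Lg cg C1w.
have h1 := cvg_Rintegral_vk (C1c_partial_L2 C1w (inord 2)).
have h2 := cvg_Rintegral_partial_vk (i := inord 2) (C1c_L2 C1w).
have h3 := cvgL2_RintegralM (@mu2_measurable_disk R)
  (fun k => C1c_bottom_L2 (C1vk k)) Lg (C1c_bottom_L2 C1w) cg.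
apply: (cvgn_eq (cvgnD h2 h1) (cvgnN h3)) => k.
rewrite -(RintegralM_partial _ (C1vk k) C1w).
by rewrite divergence_bottom//; exact: C1cM.
Qed.

(** The smooth factor [a] is separated from the rough weight [b], which horizontal derivatives do
    not see. The boundary term pairs the lateral values of [vk] with a fixed L^2 function, and tends
    to 0 with them. *)
Lemma limit_green_lateral (a : R3 -> R) (b : R -> R) (B : R) (i : bool) :
  C1 a -> measurable_fun setT b -> (forall z, 0 < z -> `|b z| <= B) ->
  L2 mu3 cylinder (fun p => b p.2 * a p) ->
  L2 mu3 cylinder (fun p => b p.2 * partial (if i then ord0 else inord 1) a p) ->
  L2 mu2 lateral (fun tz => b tz.2 * (if i then cos tz.1 else sin tz.1)
                            * a (cos tz.1, sin tz.1, tz.2)) ->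
  cvgL2 mu2 lateral (fun k tz => vk k (cos tz.1, sin tz.1, tz.2)) (fun=> 0) ->
  \int[mu3]_(p in cylinder)
    (u p * (b p.2 * partial (if i then ord0 else inord 1) a p)) +
  \int[mu3]_(p in cylinder) (Du (if i then ord0 else inord 1) p * (b p.2 * a p)) = 0.
Proof.
move=> C1a mb bB La Lda Lat clat; set j := if i then _ else _.
have h1 := cvg_Rintegral_vk Lda.
have h2 := cvg_Rintegral_partial_vk (i := j) La.
have mL := @mu2_measurable_lateral R.
have L0 : L2 mu2 (@lateral R) (fun=> 0).
  apply: (L2_le mL (g := fun tz => b tz.2 * (if i then cos tz.1 else sin tz.1)
                            * a (cos tz.1, sin tz.1, tz.2))) => //.
  by move=> tz _; rewrite normr0.
have h3 := cvgL2_RintegralM mL (fun k => C1c_lateral_L2 (C1vk k)) L0 Lat clat.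
transitivity (\int[mu2]_(tz in lateral) (0 *
     (b tz.2 * (if i then cos tz.1 else sin tz.1) * a (cos tz.1, sin tz.1, tz.2)))); last first.
  by apply: Rintegral_eq0 => tz _; rewrite mul0r.
apply: (cvgn_eq (cvgnD h1 h2) h3) => k.
have [C1av dav] := C1M C1a (C1c_C1 (C1vk k)).
have := @divergence_lateral R _ b B i (C1c_mul C1a (C1vk k)) mb bB.
rewrite -/j dav => e.
rewrite -RintegralD//; last 2 first.
- by apply: L2_integrableM => //; exact: C1c_L2.
- by apply: L2_integrableM => //; exact: C1c_partial_L2.
transitivity (\int[mu3]_(p in cylinder) (b p.2 * (partial j a p * vk k p + a p * partial j (vk k) p))).
  by apply: eq_Rintegral => p _; ring.
by rewrite e; apply: eq_Rintegral => tz _; ring.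
Qed.

End Limits.

(** Two successive limits: first in [u], against a fixed approximant of [v], by
    [limit_green_bottom]; then in [v]. One factor is fixed at each stage, so that convergence
    against a fixed L^2 function is enough. *)
Lemma green_vertical u Du g l v Dv g' l' :
  L2 mu3 cylinder u -> (forall i, L2 mu3 cylinder (Du i)) -> L2 mu2 disk g ->
  L2 mu3 cylinder v -> (forall i, L2 mu3 cylinder (Dv i)) -> L2 mu2 disk g' ->
  has_trace u Du g l -> has_trace v Dv g' l' ->
  \int[mu3]_(p in cylinder) (Du (inord 2) p * v p) +
  \int[mu3]_(p in cylinder) (u p * Dv (inord 2) p) =
  - \int[mu2]_(q in disk) (g q * g' q).
Proof.
move=> Lu LDu Lg Lv LDv Lg' [uk [C1u cu cDu cg _]] [vk [C1v cv cDv cg' _]].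
have mC := @mu3_measurable_cylinder R.
have h1 := cvg_Rintegral_vk C1v Lv cv (LDu (inord 2)).
have h2 := @cvg_Rintegral_partial_vk _ _ C1v LDv cDv (inord 2) _ Lu.
have h3 := cvgL2_RintegralM (@mu2_measurable_disk R)
  (fun k => C1c_bottom_L2 (C1v k)) Lg' Lg cg'.
have E k := limit_green_bottom C1u Lu LDu cu cDu Lg cg (C1v k).
have mulC d (T : measurableType d) (m : {measure set T -> \bar R}) (D : set T) (f f' : T -> R) :
    \int[m]_(p in D) (f p * f' p) = \int[m]_(p in D) (f' p * f p).
  by apply: eq_Rintegral => p _; rewrite mulrC.
rewrite mulC [X in _ + X]mulC [X in - X]mulC.
apply: (cvgn_eq (cvgnD h1 h2) (cvgnN h3)) => k.
by rewrite mulC [X in _ + X]mulC E [X in - X]mulC.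
Qed.

End Green.

Lemma ae_imp d (T : measurableType d) (R : realType) (m : {measure set T -> \bar R})
    (P Q : T -> Prop) : (forall x, P x -> Q x) ->
  {ae m, forall x, P x} -> {ae m, forall x, Q x}.
Proof. by move=> PQ; apply: filterS. Qed.

Lemma sqr_splitB (R : realDomainType) (x y : R) :
  x ^+ 2 <= 2 * (x - y) ^+ 2 + 2 * y ^+ 2.
Proof. have := sqr_ge0 (x - 2 * y); nra. Qed.

Lemma poincare_arith (R : realDomainType) (I E W D : R) :
  I - E + (I - E) = - W -> 2 * I <= E + D -> E <= W + D.
Proof. lra. Qed.

Lemma zero_trace_arith (R : realDomainType) (X E W D B C : R) :
  E <= W + D -> X <= 2 * E + 2 * C -> D <= 2 * B -> X <= 2 * W + 4 * B + 2 * C.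
Proof. lra. Qed.

Lemma eq0_le_cvgn0 (R : realType) (X : R) (x y z : nat -> R) : 0 <= X ->
  (forall k, X <= 2 * x k + 4 * y k + 2 * z k) -> x k @[k --> \oo] --> 0 ->
  y k @[k --> \oo] --> 0 -> z k @[k --> \oo] --> 0 -> X = 0.
Proof.
move=> X0 H cx cy cz; apply/eqP; rewrite eq_le X0 andbT.
have c : 2 * x k + 4 * y k + 2 * z k @[k --> \oo] --> 2 * 0 + 4 * 0 + 2 * (0 : R).
  by apply: cvgnD; [apply: cvgnD|]; apply: cvgMr.
rewrite !mulr0 !addr0 in c.
rewrite -(cvg_lim _ c)//; apply: limr_ge; first by apply/cvg_ex; eexists; exact: c.
by apply: nearW => k; exact: H.
Qed.

(** * Weighted Poincare inequality and uniqueness *)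

Section Uniqueness.
Context {R : realType}.
Local Notation R2 := (R * R)%type.
Local Notation R3 := (R * R * R)%type.
Local Notation mu := (@lebesgue_measure R).
Local Notation mu2 := (mu \x mu)%E.
Local Notation mu3 := (mu2 \x mu)%E.
Implicit Types (u v w : R3 -> R) (Du Dv : 'I_3 -> R3 -> R).

Let mC := @mu3_measurable_cylinder R.

Definition decay (p : R3) : R := expR (- p.2).

Lemma decay_gt0 p : 0 < decay p.
Proof. exact: expR_gt0. Qed.

Lemma decay_le1 p : cylinder p -> decay p <= 1.
Proof. by move=> [_ p0]; rewrite /decay expR_le1 oppr_le0 ltW. Qed.

Lemma norm_decay_le1 p : cylinder p -> `|decay p| <= 1.
Proof. by move=> Cp; rewrite gtr0_norm ?decay_gt0// decay_le1. Qed.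

Lemma decay_continuous : continuous decay.
Proof.
move=> p; apply: (@continuous_comp _ _ _ (fun p : R3 => - p.2) expR); last exact: continuous_expR.
by apply: cvgN; exact: cvg_snd.
Qed.

Lemma decay_measurable : measurable_fun cylinder decay.
Proof. by apply: measurable_funTS; apply: continuous_measurable3; exact: decay_continuous. Qed.

Lemma decay_C1 : C1 decay /\ partial (inord 2) decay = fun p => - decay p.
Proof.
have [|i|i p|? ->] := @is_derive_C1 R decay (fun i p => if i == 2%N :> nat then - decay p else 0).
- exact: decay_continuous.
- case: (i == 2%N :> nat); last by move=> p; exact: cvg_cst.
  by move=> p; apply: cvgN; exact: decay_continuous.
- rewrite /decay /upd3 /coord3; case: i => -[|[|[|//]]] h /=; try exact: is_derive_fcst.
  have dN := is_derive_fN (is_derive_fid p.2).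
  apply: (is_derive_eq (is_derive_fcomp (is_derive_expR (- p.2)) dN)).
  by rewrite mulrN1.
- by split => //; apply/funext => p; rewrite inordK.
Qed.

Lemma L2_decay u : L2 mu3 cylinder u -> L2 mu3 cylinder (fun p => decay p * u p).
Proof.
by apply: (L2Zl mC decay_measurable (K := 1)); exact: norm_decay_le1.
Qed.

(* Integrating the vertical derivative of [(decay * w) ^ 2]. *)
Lemma poincare_C1c w : C1c setT w ->
  \int[mu3]_(p in cylinder) ((decay p * w p) ^+ 2) <=
  \int[mu2]_(q in disk) (w (q, 0) ^+ 2) +
  \int[mu3]_(p in cylinder) (partial (inord 2) w p ^+ 2).
Proof.
move=> C1w; have [C1e pe] := decay_C1; pose e := fun p => decay p * w p.
have C1ce : C1c setT e by exact: C1c_mul.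
have [_ pew] := C1M C1e (C1c_C1 C1w).
have Le := C1c_L2 C1ce; have Ld := C1c_partial_L2 C1w (inord 2).
have Led := L2_decay Ld.
have := @divergence_bottom R _ (C1cM C1ce C1ce).
rewrite (RintegralM_partial _ C1ce C1ce) (pew (inord 2)) pe => H.
have i1 := L2_integrable_sqr Le.
have i2 := L2_integrableM mC Le Led.
have i3 := L2_integrable_sqr Ld.
have i4 := L2_integrable_sqr Led.
have E1 : \int[mu3]_(p in cylinder) ((- decay p * w p + decay p * partial (inord 2) w p) * e p)
   = \int[mu3]_(p in cylinder) (e p * (decay p * partial (inord 2) w p)) - \int[mu3]_(p in cylinder) (e p ^+ 2).
  by rewrite -RintegralB//; apply: eq_Rintegral => p _; rewrite /e; ring.
have E2 : \int[mu3]_(p in cylinder) (e p * (- decay p * w p + decay p * partial (inord 2) w p))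
   = \int[mu3]_(p in cylinder) (e p * (decay p * partial (inord 2) w p)) - \int[mu3]_(p in cylinder) (e p ^+ 2).
  by rewrite -RintegralB//; apply: eq_Rintegral => p _; rewrite /e; ring.
have E3 : \int[mu2]_(q in disk) (e (q, 0) * e (q, 0)) = \int[mu2]_(q in disk) (w (q, 0) ^+ 2).
  by apply: eq_Rintegral => q _; rewrite /e /decay oppr0 expR0 mul1r.
rewrite E1 E2 E3 in H.
(* [2 x y <= x ^ 2 + y ^ 2], with the weight bounded by 1. The integral of [e ^ 2] on the right is
   then absorbed by the one, twice as large, that comes from the derivative of the weight. *)
have le1 : 2 * \int[mu3]_(p in cylinder) (e p * (decay p * partial (inord 2) w p)) <=
   \int[mu3]_(p in cylinder) (e p ^+ 2) + \int[mu3]_(p in cylinder) (partial (inord 2) w p ^+ 2).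
  rewrite -RintegralZl// -RintegralD//; apply: le_Rintegral => //.
  - by have := integrableZl mC 2 i2; apply: eq_integrable.
  - by have := integrableD mC i1 i3; apply: eq_integrable.
  move=> p Cp; set a := e p; set b := partial _ w p; set c := decay p.
  have cb : (c * b) ^+ 2 <= b ^+ 2.
    rewrite exprMn ler_piMl ?sqr_ge0// expr_le1 ?decay_le1//.
    by rewrite ltW// decay_gt0.
  by have := sqr_ge0 (a - c * b); rewrite sqrrB; lra.
exact: (poincare_arith H le1).
Qed.

(** The Poincare inequality applies to the approximants, whose bottom values and vertical
    derivatives tend to 0 in L^2. In the limit [decay * u] has norm 0, and the weight is
    positive. *)
Lemma zero_trace_eq0 u Du l : L2 mu3 cylinder u -> (forall i, L2 mu3 cylinder (Du i)) ->
  has_trace u Du (fun=> 0) l ->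
  \int[mu3]_(p in cylinder) (Du (inord 2) p ^+ 2) = 0 ->
  {ae mu3, forall p, cylinder p -> u p = 0}.
Proof.
move=> Lu LDu [uk [C1u cu cDu cg _]] Du0.
have Leu := L2_decay Lu.
have H k : \int[mu3]_(p in cylinder) ((decay p * u p) ^+ 2) <=
    2 * (\int[mu2]_(q in disk) ((uk k (q, 0) - 0) ^+ 2)) +
    4 * (\int[mu3]_(p in cylinder) ((partial (inord 2) (uk k) p - Du (inord 2) p) ^+ 2)) +
    2 * (\int[mu3]_(p in cylinder) ((uk k p - u p) ^+ 2)).
  have P := poincare_C1c (C1u k).
  have Lk := C1c_L2 (C1u k); have Ldk := C1c_partial_L2 (C1u k) (inord 2).
  have i1 := L2_integrable_sqr (L2_decay Lk).
  have i2 := L2_integrable_sqr (L2B mC Lk Lu).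
  have i3 := L2_integrable_sqr (L2B mC Ldk (LDu (inord 2))).
  have i4 := L2_integrable_sqr (LDu (inord 2)).
  have i5 := L2_integrable_sqr Ldk.
  have i6 := L2_integrable_sqr Leu.
  have iZ (f : R3 -> R) (c : R) : mu3.-integrable cylinder (EFin \o f) ->
      mu3.-integrable cylinder (EFin \o (fun p => c * f p)).
    by move=> /(integrableZl mC c); apply: eq_integrable.
  have iD (f g : R3 -> R) : mu3.-integrable cylinder (EFin \o f) ->
      mu3.-integrable cylinder (EFin \o g) -> mu3.-integrable cylinder (EFin \o (fun p => f p + g p)).
    by move=> fi gi; have := integrableD mC fi gi; apply: eq_integrable.
  have Q1 : \int[mu3]_(p in cylinder) ((decay p * u p) ^+ 2) <=
     2 * \int[mu3]_(p in cylinder) ((decay p * uk k p) ^+ 2) +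
     2 * \int[mu3]_(p in cylinder) ((uk k p - u p) ^+ 2).
    rewrite -!RintegralZl// -RintegralD//; [|exact: iZ|exact: iZ].
    apply: le_Rintegral => //; first by apply: iD; exact: iZ.
    move=> p Cp; have c1 := decay_le1 Cp; have c0 := decay_gt0 p.
    have cb : (decay p * u p - decay p * uk k p) ^+ 2 <= (uk k p - u p) ^+ 2.
      rewrite -[(uk k p - u p) ^+ 2]sqrrN opprB -mulrBr exprMn.
      by rewrite ler_piMl ?sqr_ge0// expr_le1// ltW.
    by apply: le_trans (sqr_splitB _ (decay p * uk k p)) _; rewrite addrC lerD2l ler_pM2l.
  have Q2 : \int[mu3]_(p in cylinder) (partial (inord 2) (uk k) p ^+ 2) <=
     2 * \int[mu3]_(p in cylinder) ((partial (inord 2) (uk k) p - Du (inord 2) p) ^+ 2) +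
     2 * \int[mu3]_(p in cylinder) (Du (inord 2) p ^+ 2).
    rewrite -!RintegralZl// -RintegralD//; [|exact: iZ|exact: iZ].
    apply: le_Rintegral => //; first by apply: iD; exact: iZ.
    by move=> p _; exact: sqr_splitB.
  rewrite Du0 mulr0 addr0 in Q2.
  have E0 : \int[mu2]_(q in disk) ((uk k (q, 0) - 0) ^+ 2) = \int[mu2]_(q in disk) (uk k (q, 0) ^+ 2).
    by apply: eq_Rintegral => q _; rewrite subr0.
  by rewrite E0; exact: (zero_trace_arith P Q1 Q2).
have c1 := cvgL2_Rintegral_sqr cg.
have c2 := cvgL2_Rintegral_sqr (cDu (inord 2)).
have c3 := cvgL2_Rintegral_sqr cu.
have X0 : \int[mu3]_(p in cylinder) ((decay p * u p) ^+ 2) = 0.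
  apply: (eq0_le_cvgn0 _ H c1 c2 c3).
  by apply: Rintegral_ge0 => p _; exact: sqr_ge0.
apply: ae_imp (L2_ae0 mC Leu X0) => p h Cp.
have /eqP := h Cp; rewrite mulf_eq0 gt_eqF ?decay_gt0//= => /eqP.
by [].
Qed.

Lemma C1B v w : C1 v -> C1 w -> C1 (fun p => v p - w p) /\
  forall i, partial i (fun p => v p - w p) = fun p => partial i v p - partial i w p.
Proof.
move=> C1v C1w; have [cv dv] := C1v; have [cw dw] := C1w.
apply: is_derive_C1.
- by move=> p; apply: cvgB; [exact: cv|exact: cw].
- by move=> i p; apply: cvgB; [have [_] := dv i; exact|have [_] := dw i; exact].
- move=> i p; have d1 := C1_is_derive C1v i p (coord3 i p).
  have d2 := C1_is_derive C1w i p (coord3 i p).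
  by have := is_derive_fD d1 (is_derive_fN d2); rewrite upd3_coord.
Qed.

Lemma C1cB v w : C1c setT v -> C1c setT w -> C1c setT (fun p => v p - w p).
Proof.
move=> [C1v [K [cK _] K0]] [C1w [K' [cK' _] K0']]; split; first by have [] := C1B C1v C1w.
exists (K `|` K'); first by split => //; exact: compactU.
by move=> p /not_orP[Kp Kp']; rewrite K0// K0'// subrr.
Qed.

Lemma L2_zero d (T : measurableType d) (m : {measure set T -> \bar R}) (D : set T) :
  L2 m D (fun=> 0).
Proof.
split; first exact: measurable_cst.
rewrite (eq_integral (fun=> 0%E)) ?integral0// => x _; by rewrite expr0n.
Qed.

Lemma has_traceB u Du g v Dv : L2 mu3 cylinder u -> L2 mu3 cylinder v ->
  (forall i, L2 mu3 cylinder (Du i)) -> (forall i, L2 mu3 cylinder (Dv i)) ->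
  L2 mu2 disk g -> has_trace u Du g (fun=> 0) -> has_trace v Dv g (fun=> 0) ->
  has_trace (fun p => u p - v p) (fun i p => Du i p - Dv i p) (fun=> 0) (fun=> 0).
Proof.
move=> Lu Lv LDu LDv Lg [uk [C1u cu cDu cg cl]] [vk [C1v cv cDv cg' cl']].
exists (fun k p => uk k p - vk k p); split.
- by move=> k; exact: C1cB.
- exact: (cvgL2B mC (fun k => C1c_L2 (C1u k)) (fun k => C1c_L2 (C1v k)) Lu Lv cu cv).
- move=> i.
  have -> : (fun k => partial i (fun p => uk k p - vk k p)) =
            (fun k p => partial i (uk k) p - partial i (vk k) p).
    by apply/funext => k; have [_ ->] := C1B (C1c_C1 (C1u k)) (C1c_C1 (C1v k)).
  apply: (cvgL2B mC (fun k => C1c_partial_L2 (C1u k) i) (fun k => C1c_partial_L2 (C1v k) i)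
    (LDu i) (LDv i) (cDu i) (cDv i)).
- have -> : (fun=> 0) = (fun q : R2 => g q - g q) by apply/funext => q; rewrite subrr.
  exact: (cvgL2B (@mu2_measurable_disk R) (fun k => C1c_bottom_L2 (C1u k))
    (fun k => C1c_bottom_L2 (C1v k)) Lg Lg cg cg').
- have -> : (fun=> 0) = (fun q : R2 => 0 - 0 : R) by apply/funext => q; rewrite subrr.
  have L0 := @L2_zero _ _ mu2 (@lateral R).
  exact: (cvgL2B (@mu2_measurable_lateral R) (fun k => C1c_lateral_L2 (C1u k))
    (fun k => C1c_lateral_L2 (C1v k)) L0 L0 cl cl').
Qed.

Lemma has_trace_H1 u Du g l : L2 mu3 cylinder u -> (forall i, L2 mu3 cylinder (Du i)) ->
  has_trace u Du g l -> H1 u Du.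
Proof. by move=> Lu LDu [uk [C1u cu cDu _ _]]; exact: (limit_H1 C1u). Qed.

Lemma measurable_conductivity (h : R) (a : R2) :
  measurable_fun setT (conductivity h a).
Proof.
rewrite /conductivity; apply: measurable_fun_ifT => //.
by apply: measurable_fun_ler.
Qed.

Lemma conductivity_ge1 (h : R) (a : R2) z : 0 <= a.1 -> 0 <= a.2 ->
  1 <= conductivity h a z.
Proof. by move=> a1 a2; rewrite /conductivity; case: ifP => _; rewrite lerDl. Qed.

Lemma conductivity_le (h : R) (a : R2) z : 0 <= a.1 -> 0 <= a.2 ->
  `|conductivity h a z| <= 1 + a.1 + a.2.
Proof.
move=> a1 a2; rewrite ger0_norm ?(le_trans ler01 (conductivity_ge1 _ _ _ _))//.
by rewrite /conductivity; case: ifP => _; lra.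
Qed.

Lemma L2_conductivity (h : R) (a : R2) u : 0 <= a.1 -> 0 <= a.2 ->
  L2 mu3 cylinder u -> L2 mu3 cylinder (fun p => conductivity h a p.2 * u p).
Proof.
move=> a1 a2; apply: (L2Zl mC (K := 1 + a.1 + a.2)).
  apply: measurable_funTS; apply: (measurableT_comp (measurable_conductivity h a)).
  exact: measurable_snd.
by move=> p _; exact: conductivity_le.
Qed.

Lemma weak_solution_unique (h : R) (a : R2) (f : R -> R) (U U' : R -> R -> R) :
  0 <= a.1 -> 0 <= a.2 -> L2 mu2 disk (radial2 f) ->
  weak_solution h a f U -> weak_solution h a f U' ->
  {ae mu3, forall p, cylinder p -> radial3 U p = radial3 U' p}.
Proof.
move=> a1 a2 Lf [Du [[Lu HDu] tu] su] [Du' [[Lu' HDu'] tu'] su'].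
have LDu i : L2 mu3 cylinder (Du i) by have [] := HDu i.
have LDu' i : L2 mu3 cylinder (Du' i) by have [] := HDu' i.
pose v p := radial3 U p - radial3 U' p; pose Dv i p := Du i p - Du' i p.
have Lv : L2 mu3 cylinder v := L2B mC Lu Lu'.
have LDv i : L2 mu3 cylinder (Dv i) := L2B mC (LDu i) (LDu' i).
have tv : has_trace v Dv (fun=> 0) (fun=> 0) := has_traceB Lu Lu' LDu LDu' Lf tu tu'.
have Hv : H1 v Dv := has_trace_H1 Lv LDv tv.
have Lg i : L2 mu3 cylinder (fun p => conductivity h a p.2 * Dv i p).
  exact: L2_conductivity.
have int3 (D : 'I_3 -> R3 -> R) : (forall i, L2 mu3 cylinder (D i)) ->
    mu3.-integrable cylinder (EFin \o
      (fun p => conductivity h a p.2 * \sum_(i < 3) D i p * Dv i p)).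
  move=> LD.
  have i1 := integrableD mC (integrableD mC (L2_integrableM mC (LD ord0) (Lg ord0))
    (L2_integrableM mC (LD (inord 1)) (Lg (inord 1))))
    (L2_integrableM mC (LD (inord 2)) (Lg (inord 2))).
  apply: eq_integrable i1 => // p _.
  rewrite /= -!EFinD; congr (_%:E); rewrite !big_ord_recl big_ord0.
  have -> : lift ord0 ord0 = inord 1 :> 'I_3 by apply/val_inj; rewrite /= inordK.
  have -> : lift ord0 (lift ord0 ord0) = inord 2 :> 'I_3 by apply/val_inj; rewrite /= inordK.
  ring.
have E : \int[mu3]_(p in cylinder) (conductivity h a p.2 * \sum_(i < 3) Dv i p * Dv i p) = 0.
  have := su v Dv Hv tv; have := su' v Dv Hv tv => e' e.
  transitivity (\int[mu3]_(p in cylinder) (conductivity h a p.2 * \sum_(i < 3) Du i p * Dv i p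
     - conductivity h a p.2 * \sum_(i < 3) Du' i p * Dv i p)).
    apply: eq_Rintegral => p _; rewrite -mulrBr -sumrB; congr (_ * _).
    by apply: eq_bigr => i _; rewrite /Dv mulrBl.
  by rewrite RintegralB// ?e ?e' ?subrr//; exact: int3.
(* Ellipticity: the conductivity is at least 1, and the square of the vertical derivative is one of
   three nonnegative terms. *)
have Dv0 : \int[mu3]_(p in cylinder) (Dv (inord 2) p ^+ 2) = 0.
  apply/eqP; rewrite eq_le Rintegral_ge0 ?andbT; last by move=> p _; exact: sqr_ge0.
  rewrite -E; apply: le_Rintegral => //.
  - exact: L2_integrable_sqr.
  - exact: int3.
  move=> p _; have c1 := conductivity_ge1 h p.2 a1 a2.
  have s0 : 0 <= \sum_(i < 3) Dv i p * Dv i p by apply: sumr_ge0 => i _; rewrite -expr2 sqr_ge0.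
  apply: (@le_trans _ _ (\sum_(i < 3) Dv i p * Dv i p)); last by rewrite ler_peMl.
  by rewrite (bigD1 (inord 2))//= -expr2 lerDl; apply: sumr_ge0 => i _; rewrite -expr2 sqr_ge0.
apply: ae_imp (zero_trace_eq0 Lv LDv tv Dv0) => p h0 Cp.
by apply/eqP; rewrite -subr_eq0; apply/eqP; exact: h0.
Qed.

End Uniqueness.

(** * The explicit solution *)

Section Cutoff.
Context {R : realType}.
Implicit Types (s t z : R).

Definition pospart t : R := (t + `|t|) / 2.

Lemma pospart_ge t : 0 <= t -> pospart t = t.
Proof. by move=> t0; rewrite /pospart ger0_norm//; field. Qed.

Lemma pospart_le t : t <= 0 -> pospart t = 0.
Proof. by move=> t0; rewrite /pospart ler0_norm// subrr mul0r. Qed.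

Lemma pospart_ge0 t : 0 <= pospart t.
Proof.
by case: (leP 0 t) => t0; [rewrite pospart_ge|rewrite pospart_le// ltW].
Qed.

Lemma continuous_pospart : continuous pospart.
Proof.
by move=> t; apply: cvgMl; apply: cvgD; [exact: cvg_id|exact: norm_continuous].
Qed.

Definition possqr t : R := pospart t ^+ 2.

Lemma continuous_possqr : continuous possqr.
Proof.
move=> t; rewrite /continuous_at /possqr expr2; under eq_fun do rewrite expr2.
by apply: cvgM; exact: continuous_pospart.
Qed.

Lemma is_derive_possqr t : is_derive t 1 possqr (2 * pospart t).
Proof.
case: (ltgtP t 0) => t0.
- rewrite pospart_le ?ltW// mulr0.
  apply: (near_eq_is_derive (f := fun=> 0)).
  near=> s; rewrite /possqr pospart_le ?expr0n//; apply/ltW; near: s; exact: lt_nbhsl.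
- rewrite pospart_ge ?ltW//.
  apply: (near_eq_is_derive (f := fun s => s ^+ 2)); last first.
    by apply: (is_derive_eq (is_derive_fX 1 (is_derive_fid t))); ring.
  near=> s; rewrite /possqr pospart_ge//; apply/ltW; near: s; exact: lt_nbhsr.
(* At 0 the quotient [possqr s / s] is [pospart s], a continuous function: this is Caratheodory's
   criterion. *)
- rewrite t0; apply/is_derive1_caratheodory; exists (fun s => pospart s); split.
  + move=> s; rewrite /possqr (pospart_le (lexx 0)) expr0n !subr0.
    by case: (leP 0 s) => s0; [rewrite pospart_ge// expr2|rewrite pospart_le ?ltW// expr0n mul0r].
  + exact: continuous_pospart.
  + by rewrite pospart_le// mulr0.
Unshelve. all: by end_near. Qed.

(** A C^1 spline equal to 1 for [s <= 1] and to 0 for [s >= 2]; being explicit, it has explicit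
    bounds, 1 for itself and 4 for its derivative. *)
Definition cutoff s : R := possqr (1 - possqr (s - 1)).

Definition cutoff' s : R := - (4 * pospart (1 - possqr (s - 1)) * pospart (s - 1)).

Lemma is_derive_cutoff s : is_derive s 1 cutoff (cutoff' s).
Proof.
have d1 : is_derive s 1 (fun t => t - 1) 1.
  by apply: (is_derive_eq (is_derive_fD (is_derive_fid s) (is_derive_fcst s (- 1)))); rewrite addr0.
have d2 := is_derive_fcomp (f := fun t => t - 1) (is_derive_possqr (s - 1)) d1.
have d3 := is_derive_fD (is_derive_fcst s 1) (is_derive_fN d2).
apply: (is_derive_eq (is_derive_fcomp (f := fun t => 1 - possqr (t - 1)) (is_derive_possqr _) d3)).
by rewrite /cutoff'; ring.
Qed.

Lemma continuous_cutoff : continuous cutoff.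
Proof. by move=> s; exact: is_derive_continuous (is_derive_cutoff s). Qed.

Lemma continuous_cutoff' : continuous cutoff'.
Proof.
have c1 : continuous (fun s : R => s - 1) by move=> s; apply: cvgB; [exact: cvg_id|exact: cvg_cst].
have c2 : continuous (fun s => 1 - possqr (s - 1)).
  move=> s; apply: cvgB; first exact: cvg_cst.
  by apply: (continuous_comp (c1 s)); exact: continuous_possqr.
move=> s; apply: cvgN; apply: cvgM.
  by apply: cvgMr; apply: (continuous_comp (c2 s)); exact: continuous_pospart.
by apply: (continuous_comp (c1 s)); exact: continuous_pospart.
Qed.

Lemma cutoff_le1 s : s <= 1 -> cutoff s = 1.
Proof.
move=> s1; rewrite /cutoff {2}/possqr pospart_le ?subr_le0// expr0n subr0.
by rewrite /possqr pospart_ge// expr1n.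
Qed.

Lemma cutoff'_le1 s : s <= 1 -> cutoff' s = 0.
Proof. by move=> s1; rewrite /cutoff' (@pospart_le (s - 1)) ?subr_le0// mulr0 oppr0. Qed.

Lemma cutoff_ge2 s : 2 <= s -> cutoff s = 0.
Proof.
move=> s2; rewrite /cutoff /possqr (@pospart_ge (s - 1)); last by rewrite subr_ge0; lra.
rewrite pospart_le ?expr0n// subr_le0 exprn_ege1//; lra.
Qed.

Lemma norm_cutoff s : `|cutoff s| <= 1.
Proof.
rewrite /cutoff /possqr ger0_norm ?sqr_ge0// expr_le1 ?pospart_ge0//.
set x := 1 - _; have [x0|x0] := leP 0 x; last by rewrite pospart_le ?ltW.
by rewrite pospart_ge// /x lerBlDr lerDl sqr_ge0.
Qed.

Lemma norm_cutoff' s : `|cutoff' s| <= 4.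
Proof.
rewrite /cutoff' normrN ger0_norm; last exact: mulr_ge0 (mulr_ge0 (ler0n R 4) (pospart_ge0 _)) (pospart_ge0 _).
have q0 := pospart_ge0 (s - 1); rewrite /possqr.
move: (pospart (s - 1)) q0 => q q0.
have [x0|x0] := leP 0 (1 - q ^+ 2); last by rewrite pospart_le ?ltW// mulr0 mul0r.
rewrite pospart_ge// -[leRHS]mulr1 -mulrA ler_pM2l//.
have q1 : q <= 1 by rewrite -(@expr_le1 _ 2)// -subr_ge0.
by apply: mulr_ile1 => //; rewrite lerBlDr lerDl sqr_ge0.
Qed.

End Cutoff.

Section Profile.
Context {R : realType}.
Implicit Types (e t z c r l h : R) (k : nat).

(* A C^1 approximation of the positive part as [e] tends to 0. *)
Definition softpos e t : R := t * possqr t / (t ^+ 2 + e ^+ 2).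

Definition softpos' e t : R :=
  3 * possqr t / (t ^+ 2 + e ^+ 2) - 2 * t ^+ 2 * possqr t / (t ^+ 2 + e ^+ 2) ^+ 2.

Lemma softden_gt0 e t : 0 < e -> 0 < t ^+ 2 + e ^+ 2.
Proof. by move=> e0; rewrite ltr_wpDl ?sqr_ge0// exprn_gt0. Qed.

Lemma mul_pospart t : t * pospart t = possqr t.
Proof.
rewrite /possqr; case: (leP 0 t) => t0; first by rewrite pospart_ge// expr2.
by rewrite pospart_le ?ltW// mulr0 expr0n.
Qed.

Lemma is_derive_softpos e t : 0 < e -> is_derive t 1 (softpos e) (softpos' e t).
Proof.
move=> e0; have d0 := softden_gt0 t e0.
have dd : is_derive t 1 (fun t => t ^+ 2 + e ^+ 2) (2 * t).
  apply: (is_derive_eq (is_derive_fD (is_derive_fX 1 (is_derive_fid t)) (is_derive_fcst t (e ^+ 2)))).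
  by ring.
have dn : is_derive t 1 (fun s => s * possqr s) _ := is_derive_fM (is_derive_fid t) (is_derive_possqr t).
rewrite (_ : softpos e = fun t => t * possqr t * (t ^+ 2 + e ^+ 2)^-1)//.
have dv := is_derive_fV (f := fun s => s ^+ 2 + e ^+ 2) (lt0r_neq0 d0) dd.
apply: (is_derive_eq (is_derive_fM dn dv)).
rewrite /softpos' [t * (2 * _)]mulrCA mul_pospart.
by field; rewrite lt0r_neq0.
Qed.

Lemma continuous_softden e : continuous (fun t => t ^+ 2 + e ^+ 2 : R).
Proof.
move=> t; apply: cvgD; last exact: cvg_cst.
by rewrite expr2; under eq_fun do rewrite expr2; apply: cvgM; exact: cvg_id.
Qed.

Lemma continuous_softpos' e : 0 < e -> continuous (softpos' e).
Proof.
move=> e0 t; have d0 := softden_gt0 t e0.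
apply: cvgB; apply: cvgM.
- by apply: cvgMr; exact: continuous_possqr.
- by apply: cvgV; [exact: lt0r_neq0|exact: continuous_softden].
- apply: cvgM; last exact: continuous_possqr.
  by apply: cvgMr; rewrite expr2; under eq_fun do rewrite expr2; apply: cvgM; exact: cvg_id.
- apply: cvgV; first by rewrite expf_neq0 ?lt0r_neq0.
  by rewrite expr2; under eq_fun do rewrite expr2; apply: cvgM; exact: continuous_softden.
Qed.

Lemma softpos_le0 e t : t <= 0 -> softpos e t = 0.
Proof. by move=> t0; rewrite /softpos /possqr pospart_le// expr0n mulr0 mul0r. Qed.

Lemma softpos'_le0 e t : t <= 0 -> softpos' e t = 0.
Proof.
by move=> t0; rewrite /softpos' /possqr pospart_le// expr0n !mulr0 !mul0r subr0.
Qed.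

Lemma softpos_itv e t : 0 < e -> 0 <= t -> 0 <= softpos e t <= t.
Proof.
move=> e0 t0; have d0 := softden_gt0 t e0.
rewrite /softpos /possqr pospart_ge//; apply/andP; split.
  exact: divr_ge0 (mulr_ge0 t0 (sqr_ge0 t)) (ltW d0).
by rewrite ler_pdivrMr// ler_wpM2l// lerDl sqr_ge0.
Qed.

(** The fractions [possqr t] and [t ^ 2] over the denominator lie in [0, 1], whence 5 = 3 + 2,
    uniformly in [e]. *)
Lemma norm_softpos' e t : 0 < e -> `|softpos' e t| <= 5.
Proof.
move=> e0; have d0 := softden_gt0 t e0.
have p1 : 0 <= possqr t / (t ^+ 2 + e ^+ 2) <= 1.
  rewrite divr_ge0 ?sqr_ge0 ?(ltW d0)//= ler_pdivrMr// mul1r.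
  rewrite /possqr; case: (leP 0 t) => t0; first by rewrite pospart_ge// lerDl sqr_ge0.
  by rewrite (pospart_le (ltW t0)) expr0n; exact: ltW d0.
have p2 : 0 <= t ^+ 2 / (t ^+ 2 + e ^+ 2) <= 1.
  by rewrite divr_ge0 ?sqr_ge0 ?(ltW d0)//= ler_pdivrMr// mul1r lerDl sqr_ge0.
have -> : softpos' e t = 3 * (possqr t / (t ^+ 2 + e ^+ 2)) -
   2 * ((t ^+ 2 / (t ^+ 2 + e ^+ 2)) * (possqr t / (t ^+ 2 + e ^+ 2))).
  by rewrite /softpos'; field; rewrite lt0r_neq0.
move: p1 p2; move: (possqr t / _) (t ^+ 2 / _) => x y /andP[x0 x1] /andP[y0 y1].
have yx0 : 0 <= y * x by rewrite mulr_ge0.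
have yx1 : y * x <= 1 by apply: mulr_ile1.
by rewrite ler_norml; apply/andP; split; lra.
Qed.

Lemma cvg_softden t : t ^+ 2 + harmonic k ^+ 2 @[k --> \oo] --> t ^+ 2.
Proof.
rewrite -[X in _ --> X]addr0 -[X in _ + X](mulr0 0).
apply: cvgD; first exact: cvg_cst.
by under eq_fun do rewrite expr2; apply: cvgM; exact: cvg_harmonic.
Qed.

Lemma cvg_softpos t : softpos (harmonic k) t @[k --> \oo] --> pospart t.
Proof.
have [t0|t0] := leP t 0.
  rewrite pospart_le//; under eq_fun do rewrite softpos_le0//; exact: cvg_cst.
have -> : pospart t = t * possqr t / t ^+ 2.
  by rewrite /possqr pospart_ge ?ltW//; field; rewrite gt_eqF.
apply: cvgM; first exact: cvg_cst.
by apply: cvgV; [rewrite expf_neq0// gt_eqF|exact: cvg_softden].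
Qed.

(** For [t > 0] the two terms tend to 3 and 2. At the kink the limit is 0, the left derivative of
    the positive part, in agreement with the value given to [profile'] at [h]. *)
Lemma cvg_softpos' t : softpos' (harmonic k) t @[k --> \oo] --> (if 0 < t then 1 else 0 : R).
Proof.
have [t0|t0] := leP t 0.
  under eq_fun do rewrite softpos'_le0//; exact: cvg_cst.
have -> : 1 = 3 * possqr t / t ^+ 2 - 2 * t ^+ 2 * possqr t / (t ^+ 2) ^+ 2 :> R.
  by rewrite /possqr pospart_ge ?ltW//; field; rewrite gt_eqF.
have tn : t ^+ 2 != 0 by rewrite expf_neq0// gt_eqF.
apply: cvgB; apply: cvgM; try exact: cvg_cst.
  by apply: cvgV => //; exact: cvg_softden.
apply: cvgV; first by rewrite expf_neq0.
by rewrite [X in _ --> X]expr2; under eq_fun do rewrite [(_ + _) ^+ 2]expr2; apply: cvgM; exact: cvg_softden.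
Qed.

Definition sinhR t : R := (expR t - expR (- t)) / 2.
Definition coshR t : R := (expR t + expR (- t)) / 2.

Lemma is_derive_sinhR t : is_derive t 1 sinhR (coshR t).
Proof.
have dN := is_derive_fN (is_derive_fid t).
have d := is_derive_fcomp (is_derive_expR (- t)) dN.
apply: (is_derive_eq (is_derive_fM (is_derive_fD (is_derive_expR t) (is_derive_fN d)) (is_derive_fcst t 2^-1))).
by rewrite /coshR; ring.
Qed.

Lemma continuous_sinhR : continuous sinhR.
Proof. by move=> t; exact: is_derive_continuous (is_derive_sinhR t). Qed.

Lemma continuous_coshR : continuous coshR.
Proof.
move=> t; apply: cvgMl; apply: cvgD; first exact: continuous_expR.
apply: (continuous_comp (g := expR)); last exact: continuous_expR.
by apply: cvgN; exact: cvg_id.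
Qed.

Lemma coshDsinh t : coshR t + sinhR t = expR t.
Proof. by rewrite /coshR /sinhR; field. Qed.

Lemma sinhR0 : sinhR 0 = 0.
Proof. by rewrite /sinhR oppr0 subrr mul0r. Qed.

Lemma norm_sinhR_le s t : 0 <= s <= t -> `|sinhR s| <= expR t.
Proof.
move=> /andP[s0 st]; have es : expR s <= expR t by rewrite ler_expR.
have e1 : expR (- s) <= expR s by rewrite ler_expR; lra.
have e0 := expR_ge0 (- s).
by rewrite /sinhR ger0_norm ?divr_ge0 ?subr_ge0//; lra.
Qed.

Lemma norm_coshR_le s t : 0 <= s <= t -> `|coshR s| <= expR t.
Proof.
move=> /andP[s0 st]; have es : expR s <= expR t by rewrite ler_expR.
have e1 : expR (- s) <= expR s by rewrite ler_expR; lra.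
have e0 := expR_ge0 (- s).
by rewrite /coshR ger0_norm ?divr_ge0 ?addr_ge0 ?expR_ge0//; lra.
Qed.

End Profile.

Section Strip.
Context d (T : measurableType d) (R : realType).
Variable mu : {sigma_finite_measure set T -> \bar R}.
Local Notation leb := (@lebesgue_measure R).

(** The square of the exponential is [1 / (2 l)] times the density of the exponential law of rate
    [2 l], of total mass 1, and Tonelli concludes. The base is abstract so as to cover both the
    cylinder over the disk and the lateral surface over [0, 2 pi]. *)
Lemma L2_expR_strip (D : set T) (l : R) : measurable D -> (mu D < +oo)%E -> 0 < l ->
  L2 (mu \x leb)%E (D `*` `]0, +oo[%classic) (fun p => expR (- (l * p.2))).
Proof.
move=> mD Doo l0.
have me : measurable_fun setT (fun p : T * measurableTypeR R => expR (- (l * p.2))).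
  have c : continuous (fun z : R => expR (- (l * z))).
    move=> z; apply: (@continuous_comp _ _ _ (fun z => - (l * z)) expR); last exact: continuous_expR.
    by apply: cvgN; apply: cvgMr; exact: cvg_id.
  have m2 := continuous_measurable_fun c.
  exact: (measurableT_comp m2 (@measurable_snd _ _ T (measurableTypeR R))).
split; first exact: measurable_funTS me.
have l20 : 0 < l + l by rewrite addr_gt0.
pose F (p : T * measurableTypeR R) : R := (l + l)^-1 * (\1_D p.1 * exponential_pdf (l + l) p.2).
have F0 p : 0 <= F p.
  by rewrite /F mulr_ge0 ?invr_ge0 ?(ltW l20)// mulr_ge0// exponential_pdf_ge0// ltW.
have mF : measurable_fun setT F.
  apply: measurable_funM => //; apply: measurable_funM.
    have m1 : measurable_fun setT (\1_D : T -> R) by exact: measurable_indic.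
    exact: (measurableT_comp m1 (@measurable_fst _ _ T (measurableTypeR R))).
  exact: (measurableT_comp (@measurable_exponential_pdf R (l + l)) (@measurable_snd _ _ T (measurableTypeR R))).
have mS : @measurable _ (T * measurableTypeR R)%type (D `*` `]0, +oo[%classic).
  by apply: measurableX => //; exact: measurable_itv.
apply: (@le_lt_trans _ _ (\int[(mu \x leb)%E]_p (F p)%:E)%E).
  have le1 : (\int[mu \x leb]_(p in D `*` `]0%R, +oo[) (expR (- (l * p.2)) ^+ 2)%:E <= \int[mu \x leb]_(p in D `*` `]0%R, +oo[) (F p)%:E)%E.
    apply: ge0_le_integral => //.
    - by apply/measurable_EFinP; apply: measurable_funX; exact: measurable_funTS me.
    - by apply/measurable_EFinP; exact: measurable_funTS mF.
    move=> [x z] [/= Dx]; rewrite in_itv/= andbT => z0; rewrite lee_fin /F/=.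
    rewrite indicE mem_set// mul1r (exponential_pdfE _ (ltW z0)) mulrA mulVf ?gt_eqF// mul1r.
    by rewrite -expRM_natl ler_expR; lra.
  apply: (le_trans le1); apply: ge0_subset_integral => //.
    by apply/measurable_EFinP; exact: mF.
  by move=> p _; rewrite lee_fin.
rewrite (@fubini_tonelli1 _ _ _ _ R mu leb (EFin \o F)); last 2 first.
- by apply/measurable_EFinP; exact: mF.
- by move=> p; rewrite lee_fin.
rewrite /fubini_F /=.
under eq_integral => x _.
  under eq_integral do rewrite /F/= mulrA EFinM.
  rewrite ge0_integralZl//; last 3 first.
  - by apply/measurable_EFinP; exact: measurable_exponential_pdf.
  - by move=> z _; rewrite lee_fin exponential_pdf_ge0// ltW.
  - by rewrite lee_fin mulr_ge0// invr_ge0 ltW.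
  rewrite integral_exponential_pdf// mule1 EFinM.
  over.
rewrite ge0_integralZl//; last 2 first.
- by apply/measurable_EFinP; exact: measurable_indic.
- by rewrite lee_fin invr_ge0 ltW.
rewrite integral_indic// setIT.
by rewrite lte_mul_pinfty// lee_fin invr_ge0 ltW.
Qed.

End Strip.

(** * Separated functions of the squared radius and the height *)

Section Separated.
Context {R : realType}.
Local Notation R3 := (R * R * R)%type.
Implicit Types (p : R3) (i j : 'I_3) (g b : R -> R).

(** Radial factors are functions of the squared radius, which is smooth across the axis, where the
    radius itself is not. *)
Definition rsq p : R := p.1.1 ^+ 2 + p.1.2 ^+ 2.

Definition sep g b p : R := g (rsq p) * b p.2.

Definition dsep g (g' b b' : R -> R) i p : R :=
  if i == 2%N :> nat then g (rsq p) * b' p.2 else 2 * coord3 i p * g' (rsq p) * b p.2.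

Lemma continuous_height : continuous (fun p : R3 => p.2).
Proof. by move=> p; exact: cvg_snd. Qed.

Lemma continuous_coord3 i : continuous (@coord3 R i).
Proof.
rewrite /coord3; case: (_ == _); [|case: (_ == _); last exact: continuous_height] => p.
  by apply: (@continuous_comp _ _ _ fst fst); [exact: cvg_fst|exact: cvg_fst].
by apply: (@continuous_comp _ _ _ fst snd); [exact: cvg_fst|exact: cvg_snd].
Qed.

Lemma continuous_rsq : continuous rsq.
Proof.
move=> p; rewrite /continuous_at /rsq.
have c0 := @continuous_coord3 ord0 p.
have c1 : {for p, continuous (fun p : R3 => p.1.2)} by exact: (@continuous_coord3 (Ordinal (isT : (1 < 3)%N)) p).
under eq_fun do rewrite !expr2; rewrite !expr2.
by apply: cvgD; [exact: (cvgM c0 c0)|exact: (cvgM c1 c1)].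
Qed.

Lemma continuous_sep g b : continuous g -> continuous b -> continuous (sep g b).
Proof.
move=> cg cb p; apply: cvgM.
  by apply: (@continuous_comp _ _ _ rsq g); [exact: continuous_rsq|exact: cg].
by apply: (@continuous_comp _ _ _ (fun p : R3 => p.2) b); [exact: continuous_height|exact: cb].
Qed.

Lemma continuous_dsep g (g' b b' : R -> R) i : continuous g -> continuous g' ->
  continuous b -> continuous b' -> continuous (dsep g g' b b' i).
Proof.
move=> cg cg' cb cb'; rewrite /dsep; case: (_ == _); first exact: continuous_sep.
rewrite (_ : (fun p => _) = fun p => 2 * coord3 i p * sep g' b p); last first.
  by apply/funext => p; rewrite /sep mulrA.
move=> p; apply: cvgM; last exact: (continuous_sep cg' cb).
by apply: cvgMr; exact: continuous_coord3.
Qed.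

Lemma measurable_sep g b : measurable_fun setT g -> measurable_fun setT b ->
  @measurable_fun _ _ (measurableTypeR R * measurableTypeR R * measurableTypeR R)%type _ setT (sep g b).
Proof.
move=> mg mb; apply: measurable_funM.
  apply: (measurableT_comp mg); exact: (continuous_measurable3 continuous_rsq).
by apply: (measurableT_comp mb); exact: (continuous_measurable3 continuous_height).
Qed.

Lemma measurable_dsep g (g' b b' : R -> R) i : measurable_fun setT g ->
  measurable_fun setT g' -> measurable_fun setT b -> measurable_fun setT b' ->
  @measurable_fun _ _ (measurableTypeR R * measurableTypeR R * measurableTypeR R)%type _ setT (dsep g g' b b' i).
Proof.
move=> mg mg' mb mb'; rewrite /dsep; case: (_ == _); first exact: measurable_sep.
rewrite (_ : (fun p => _) = fun p => 2 * coord3 i p * sep g' b p); last first.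
  by apply/funext => p; rewrite /sep mulrA.
apply: measurable_funM; last exact: (measurable_sep mg' mb).
apply: measurable_funM; first exact: measurable_cst.
exact: (continuous_measurable3 (@continuous_coord3 i)).
Qed.

Lemma C1_sep g (g' b b' : R -> R) : (forall s : R, is_derive s 1 g (g' s)) ->
  continuous g' -> (forall s : R, is_derive s 1 b (b' s)) -> continuous b' ->
  C1 (sep g b) /\ forall i, partial i (sep g b) = dsep g g' b b' i.
Proof.
move=> dg cg' db cb'.
have cg : continuous g by move=> s; exact: is_derive_continuous (dg s).
have cb : continuous b by move=> s; exact: is_derive_continuous (db s).
apply: is_derive_C1; [exact: continuous_sep|by move=> i; exact: continuous_dsep|].
move=> i p; rewrite /sep /dsep /upd3 /rsq /coord3.
have dcomp (x y : R) : is_derive x 1 (fun t => g (t ^+ 2 + y)) (2 * x * g' (x ^+ 2 + y)).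
  have d2 := is_derive_fD (is_derive_fX 1 (is_derive_fid x)) (is_derive_fcst x y).
  apply: (is_derive_eq (is_derive_fcomp (f := fun t => t ^+ 2 + y) (dg _) d2)).
  by rewrite /=; ring.
case: i => -[|[|[|//]]] h /=.
- have d := is_derive_fM (dcomp p.1.1 (p.1.2 ^+ 2)) (is_derive_fcst p.1.1 (b p.2)).
  by apply: (is_derive_eq d); rewrite mulr0 addr0.
- have := is_derive_fM (dcomp p.1.2 (p.1.1 ^+ 2)) (is_derive_fcst p.1.2 (b p.2)).
  rewrite mulr0 addr0 [p.1.2 ^+ 2 + _]addrC.
  by under [X in is_derive _ _ X]eq_fun do rewrite addrC.
- have d := is_derive_fM (is_derive_fcst p.2 (g (p.1.1 ^+ 2 + p.1.2 ^+ 2))) (db p.2).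
  by apply: (is_derive_eq d); rewrite mul0r add0r.
Qed.

Lemma C1_coord3 i : C1 (@coord3 R i) /\
  forall j, partial j (@coord3 R i) = fun=> (j == i)%:R.
Proof.
apply: is_derive_C1; first exact: continuous_coord3.
  by move=> j p; exact: cvg_cst.
move=> j p; rewrite /coord3 /upd3.
case: i => -[|[|[|//]]] h; case: j => -[|[|[|//]]] h' /=;
  by [exact: is_derive_fid|exact: is_derive_fcst].
Qed.

Lemma cylinder_rsq p : cylinder p -> 0 <= rsq p < 1 /\ 0 < p.2.
Proof. by move=> [p1 p2]; split => //; rewrite /rsq addr_ge0 ?sqr_ge0. Qed.

Lemma norm_coord3_le i p : cylinder p -> i != 2%N :> nat -> `|coord3 i p| <= 1.
Proof.
move=> [p1 _]; rewrite /disk/= in p1.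
have h (x y : R) : x ^+ 2 + y ^+ 2 < 1 -> `|x| <= 1.
  move=> xy; rewrite -(@expr_le1 _ 2)// real_normK ?num_real// ltW//.
  by apply: le_lt_trans xy; rewrite lerDl sqr_ge0.
by case: i => -[|[|[|//]]] h' //= _; rewrite /coord3/=; [exact: h p1|apply: h; rewrite addrC; exact: p1].
Qed.

Lemma continuous_bounded01 g : continuous g ->
  exists2 G : R, 0 <= G & forall s : R, 0 <= s <= 1 -> `|g s| <= G.
Proof.
move=> cg; have : compact (g @` `[0, 1]%classic).
  by apply: continuous_compact; [exact: continuous_subspaceT|exact: segment_compact].
move=> /compact_bounded[M [_ HM]]; exists (`|M| + 1); first by rewrite addr_ge0.
move=> s s01; apply: HM; last by exists s => //; rewrite /= in_itv.
by rewrite (le_lt_trans (ler_norm M))// ltrDl.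
Qed.

Local Notation mu := (@lebesgue_measure R).
Local Notation mu2 := (mu \x mu)%E.
Local Notation mu3 := (mu2 \x mu)%E.
Local Notation RT := (measurableTypeR R).

Let mC := @mu3_measurable_cylinder R.
Let mD := @mu2_measurable_disk R.

Lemma L2_expR_cylinder (l : R) : 0 < l -> L2 mu3 cylinder (fun p => expR (- (l * p.2))).
Proof.
rewrite cylinderE.
exact: (@L2_expR_strip _ (RT * RT)%type R (sigma_finite_copy (@sigma_finite_mu2 R)) disk l mD (@mu2_disk_lty R)).
Qed.

Lemma L2_expR_lateral (l : R) : 0 < l -> L2 mu2 lateral (fun tz => expR (- (l * tz.2))).
Proof.
apply: (@L2_expR_strip _ RT R mu `[0, 2 * pi]%classic l); last exact: lebesgue_itv_lty.
exact: measurable_itv.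
Qed.

Lemma L2_sep g b (G K l : R) : measurable_fun setT g -> measurable_fun setT b -> 0 < l ->
  (forall s : R, 0 <= s <= 1 -> `|g s| <= G) ->
  (forall z : R, 0 < z -> `|b z| <= K * expR (- (l * z))) -> L2 mu3 cylinder (sep g b).
Proof.
move=> mg mb l0 gG bK; pose e (p : R3) := expR (- (l * p.2)).
have G0 : 0 <= G by apply: le_trans (gG 0 _); rewrite ?normr_ge0// lexx ler01.
have Le : L2 mu3 cylinder (fun p => (G * K) * e p).
  by apply: (L2Zl mC (K := `|G * K|)) => //; exact: L2_expR_cylinder.
apply: (L2_le mC _ _ Le); first by apply: measurable_funTS; exact: measurable_sep.
move=> p Cp; have [/andP[s0 s1] p0] := cylinder_rsq Cp.
apply: le_trans (ler_norm _); rewrite /sep normrM -mulrA.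
by apply: ler_pM => //; [apply: gG; rewrite s0 ltW|exact: bK].
Qed.

Lemma L2_dsep g (g' b b' : R -> R) (G K l : R) i : measurable_fun setT g ->
  measurable_fun setT g' -> measurable_fun setT b -> measurable_fun setT b' -> 0 < l ->
  (forall s : R, 0 <= s <= 1 -> `|g s| <= G) -> (forall s : R, 0 <= s <= 1 -> `|g' s| <= G) ->
  (forall z : R, 0 < z -> `|b z| <= K * expR (- (l * z))) ->
  (forall z : R, 0 < z -> `|b' z| <= K * expR (- (l * z))) ->
  L2 mu3 cylinder (dsep g g' b b' i).
Proof.
move=> mg mg' mb mb' l0 gG g'G bK b'K; rewrite /dsep.
case: eqP => i2; first exact: (L2_sep mg mb' l0 gG b'K).
rewrite (_ : (fun p => _) = fun p => 2 * coord3 i p * sep g' b p); last first.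
  by apply/funext => p; rewrite /sep mulrA.
apply: (L2Zl mC (K := 2)).
- apply: measurable_funTS; apply: measurable_funM; first exact: measurable_cst.
  exact: (continuous_measurable3 (@continuous_coord3 i)).
- move=> p Cp; rewrite normrM ger0_norm// ler_piMr//.
  by apply: norm_coord3_le => //; exact/eqP.
- exact: (L2_sep mg' mb l0 g'G bK).
Qed.

(** The approximants are separated too: [g] times a cutoff in the squared radius that is 1 on the
    disk, times [fk k]. An exponential bound uniform in [k] gives the L^2 limits by dominated
    convergence, and [g 1 = 0] makes each approximant vanish on the lateral boundary. *)
Lemma has_trace_sep g (g' : R -> R) (f f' : R -> R) (fk fk' : nat -> R -> R) (K l : R) :
  (forall s : R, is_derive s 1 g (g' s)) -> continuous g' -> g 1 = 0 ->
  (forall k (s : R), is_derive s 1 (fk k) (fk' k s)) -> (forall k, continuous (fk' k)) ->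
  (forall k, exists L : R, forall z : R, L <= `|z| -> fk k z = 0) ->
  measurable_fun setT f -> measurable_fun setT f' -> 0 < l ->
  (forall k (z : R), 0 <= z -> `|fk k z| <= K * expR (- (l * z))) ->
  (forall k (z : R), 0 < z -> `|fk' k z| <= K * expR (- (l * z))) ->
  (forall z : R, 0 <= z -> fk k z @[k --> \oo] --> f z) ->
  (forall z : R, 0 < z -> fk' k z @[k --> \oo] --> f' z) ->
  has_trace (sep g f) (dsep g g' f f') (fun q => g (q.1 ^+ 2 + q.2 ^+ 2) * f 0) (fun=> 0).
Proof.
move=> dg cg' g1 dfk cfk' supp mf mf' l0 fkK fk'K cvf cvf'.
have cg : continuous g by move=> s; exact: is_derive_continuous (dg s).
have cfk k : continuous (fk k) by move=> s; exact: is_derive_continuous (dfk k s).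
have [G1 _ gG1] := continuous_bounded01 cg; have [G2 _ gG2] := continuous_bounded01 cg'.
pose G := `|G1| + `|G2|.
have gG s : 0 <= s <= 1 -> `|g s| <= G.
  by move=> /gG1 /le_trans; apply; rewrite (le_trans (ler_norm _))// lerDl.
have g'G s : 0 <= s <= 1 -> `|g' s| <= G.
  by move=> /gG2 /le_trans; apply; rewrite (le_trans (ler_norm _))// lerDr.
pose gc s := g s * cutoff s; pose gc' s := g' s * cutoff s + g s * cutoff' s.
have dgc (s : R) : is_derive s 1 gc (gc' s) by exact: is_derive_fM (dg s) (is_derive_cutoff s).
have cgc' : continuous gc'.
  move=> s; apply: cvgD; apply: cvgM;
    by [exact: cg'|exact: continuous_cutoff|exact: cg|exact: continuous_cutoff'].
have gcE s : s <= 1 -> gc s = g s by move=> s1; rewrite /gc cutoff_le1// mulr1.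
have gc'E s : s <= 1 -> gc' s = g' s.
  by move=> s1; rewrite /gc' cutoff_le1// cutoff'_le1// mulr1 mulr0 addr0.
have C1k k := C1_sep dgc cgc' (dfk k) (cfk' k).
exists (fun k => sep gc (fk k)); split.
- move=> k; have [C1s _] := C1k k; split => //.
  have [L HL] := supp k; exists (box3 (`|L| + 2)); first by split=> //; exact: compact_box3.
  have out (x y : R) : ~ - (`|L| + 2) <= x <= `|L| + 2 -> cutoff (x ^+ 2 + y ^+ 2) = 0.
    move=> /negP; rewrite -ler_norml -ltNge => Lx; apply: cutoff_ge2.
    have x2 : 2 <= `|x| by rewrite ltW// (le_lt_trans _ Lx)// lerDr.
    have : 2 * 2 <= `|x| * `|x| by apply: ler_pM.
    by rewrite -(real_normK (num_real x)) [_ ^+ 2]expr2; have := sqr_ge0 y; lra.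
  move=> [[x y] z] nbox; rewrite /sep /gc /rsq /=.
  have [xL|/out->] := pselect (- (`|L| + 2) <= x <= `|L| + 2); last by rewrite mulr0 mul0r.
  have [yL|/out yL] := pselect (- (`|L| + 2) <= y <= `|L| + 2); last first.
    by rewrite addrC yL mulr0 mul0r.
  rewrite HL ?mulr0// leNgt; apply/negP => zL; apply: nbox.
  have {}zL : - (`|L| + 2) <= z <= `|L| + 2.
    by rewrite -ler_norml ltW// (lt_le_trans zL)// (le_trans (ler_norm L))// lerDl.
  by rewrite /box3 /= !in_itv/=.
- apply: (cvgL2_dominated mC (g := fun p => (G * K) * expR (- (l * p.2)))).
  + move=> k; apply: measurable_funTS; apply: continuous_measurable3.
    by have [[]] := C1k k.
  + by apply: measurable_funTS; apply: measurable_sep => //; exact: continuous_measurable_fun.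
  + apply: (L2Zl mC (K := `|G * K|)) => //; exact: L2_expR_cylinder.
  + move=> k p Cp; have [/andP[s0 s1] p0] := cylinder_rsq Cp.
    rewrite /sep normrM -mulrA gcE ?(ltW s1)//.
    by apply: ler_pM => //; [apply: gG; rewrite s0 ltW|apply: fkK; exact: ltW].
  + move=> p Cp; have [/andP[s0 s1] p0] := cylinder_rsq Cp.
    rewrite /sep; under eq_fun do rewrite gcE ?(ltW s1)//.
    by apply: cvgMr; apply: cvf; exact: ltW.
- move=> i; have mdk k : measurable_fun cylinder (dsep gc gc' (fk k) (fk' k) i).
    apply: measurable_funTS; apply: continuous_measurable3; apply: continuous_dsep => //.
    by move=> s; exact: is_derive_continuous (dgc s).
  rewrite (_ : (fun k => partial i (sep gc (fk k))) = fun k => dsep gc gc' (fk k) (fk' k) i); last first.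
    by apply/funext => k; have [_] := C1k k.
  (* The factor 2 comes from the horizontal derivatives [2 * x_i * g'], where [|x_i| <= 1] in the
     cylinder. *)
  apply: (cvgL2_dominated mC (g := fun p => (2 * (G * K)) * expR (- (l * p.2)))).
  + exact: mdk.
  + by apply: measurable_funTS; apply: measurable_dsep => //; exact: continuous_measurable_fun.
  + apply: (L2Zl mC (K := `|2 * (G * K)|)) => //; exact: L2_expR_cylinder.
  + move=> k p Cp; have [/andP[s0 s1] p0] := cylinder_rsq Cp.
    have s01 : 0 <= rsq p <= 1 by rewrite s0 ltW.
    rewrite /dsep; case: eqP => i2.
      rewrite normrM gcE ?(ltW s1)// -2!mulrA; apply: (@le_trans _ _ (G * (K * expR (- (l * p.2))))).
        by apply: ler_pM => //; [exact: gG|exact: fk'K].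
      rewrite ler_peMl ?ler1n// mulr_ge0//; first by rewrite addr_ge0.
      by apply: le_trans (fk'K k _ p0).
    rewrite gc'E ?(ltW s1)// -!mulrA normrM ger0_norm// ler_wpM2l//.
    rewrite normrM -[leRHS]mul1r; apply: ler_pM => //.
      by apply: norm_coord3_le => //; exact/eqP.
    by rewrite normrM; apply: ler_pM => //; [exact: g'G|apply: fkK; exact: ltW].
  + move=> p Cp; have [/andP[s0 s1] p0] := cylinder_rsq Cp.
    rewrite /dsep; case: eqP => i2.
      by under eq_fun do rewrite gcE ?(ltW s1)//; apply: cvgMr; exact: cvf'.
    by under eq_fun do rewrite gc'E ?(ltW s1)//; apply: cvgMr; apply: cvf; exact: ltW.
- apply: (cvgL2_dominated mD (g := cst (G * K))).
  + move=> k; apply: measurable_funTS; apply: continuous_measurable2; apply: continuous_bottom.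
    by have [[]] := C1k k.
  + apply: measurable_funTS; apply: measurable_funM => //.
    apply: (measurableT_comp (continuous_measurable_fun cg)); apply: continuous_measurable2.
    exact: (continuous_bottom continuous_rsq).
  + exact: (L2_cst mD (G * K) (@mu2_disk_lty R)).
  + move=> k q Dq; rewrite /disk/= in Dq.
    rewrite /sep/= normrM gcE ?(ltW Dq)// /cst; apply: ler_pM => //.
      by apply: gG; rewrite /rsq/= (ltW Dq) andbT addr_ge0 ?sqr_ge0.
    by have := fkK k 0 (lexx 0); rewrite mulr0 oppr0 expR0 mulr1.
  + move=> q Dq; rewrite /disk/= in Dq.
    rewrite /sep/=; under eq_fun do rewrite gcE ?(ltW Dq)//.
    by apply: cvgMr; exact: cvf.
- rewrite /cvgL2 (_ : (fun k => _) = fun=> 0%E); first exact: cvg_cst.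
  apply/funext => k; rewrite integral0_eq// => tz _.
  by rewrite /sep /rsq/= cos2Dsin2 /gc g1 !mul0r subr0 expr0n.
Qed.

End Separated.

(** * The vertical profile and its C^1 approximants *)

Section LayerProfile.
Context {R : realType}.
Variables (l h : R).
Hypotheses (l_gt0 : 0 < l) (h_gt0 : 0 < h).
Implicit Types (c rho : R).

(* The decaying solution, up to a factor, of the transmission problem
   [u'' = l ^ 2 * u], [u] continuous at [h], [u' (h-) = rho * u' (h+)]. *)
Definition profile c rho (z : R) : R :=
  c * (expR (l * (h - z)) + (rho - 1) * sinhR (l * pospart (h - z))).

(** At [z = h] this is the derivative from above, as [conductivity] takes its upper value there; the
    flux identities thus hold at every [z]. *)
Definition profile' c rho (z : R) : R :=
  - (c * l) * (expR (l * (h - z)) +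
    (rho - 1) * (if 0 < h - z then coshR (l * (h - z)) else 0)).

(** The positive part is smoothed with parameter [harmonic k = 1 / (k + 1)]. The first cutoff bounds
    the support from above, at a height that grows with [k]; the second bounds it from below and is
    1 for [z >= -1]. *)
Definition profile_k c rho (k : nat) (z : R) : R :=
  c * (expR (l * (h - z)) + (rho - 1) * sinhR (l * softpos (harmonic k) (h - z)))
  * (cutoff (harmonic k * z) * cutoff (- z)).

Definition profile_k' c rho (k : nat) (z : R) : R :=
  - (c * l) * (expR (l * (h - z)) +
     (rho - 1) * (coshR (l * softpos (harmonic k) (h - z)) * softpos' (harmonic k) (h - z)))
   * (cutoff (harmonic k * z) * cutoff (- z)) +
  c * (expR (l * (h - z)) + (rho - 1) * sinhR (l * softpos (harmonic k) (h - z)))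
   * (harmonic k * cutoff' (harmonic k * z) * cutoff (- z) - cutoff (harmonic k * z) * cutoff' (- z)).

Lemma is_derive_affine (b a z : R) : is_derive z 1 (fun t => b * (a - t)) (- b).
Proof.
have d := is_derive_fM (is_derive_fcst z b) (is_derive_fD (is_derive_fcst z a) (is_derive_fN (is_derive_fid z))).
by apply: (is_derive_eq d); ring.
Qed.

Lemma is_derive_profile_k c rho k (z : R) :
  is_derive z 1 (profile_k c rho k) (profile_k' c rho k z).
Proof.
have k0 : 0 < harmonic k :> R by exact: harmonic_gt0.
have d1 := is_derive_fcomp (f := fun t => l * (h - t)) (is_derive_expR _) (is_derive_affine l h z).
have dB : is_derive z 1 (fun t => h - t) (- 1).
  by apply: (is_derive_eq (is_derive_fD (is_derive_fcst z h) (is_derive_fN (is_derive_fid z)))); rewrite add0r.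
have d2 := is_derive_fcomp (f := fun t => h - t) (is_derive_softpos (h - z) k0) dB.
have d3 := is_derive_fM (is_derive_fcst z l) d2.
have d4 := is_derive_fcomp (f := fun t => l * softpos (harmonic k) (h - t)) (is_derive_sinhR _) d3.
have d5 := is_derive_fM (is_derive_fcst z c) (is_derive_fD d1 (is_derive_fM (is_derive_fcst z (rho - 1)) d4)).
have dk := is_derive_fM (is_derive_fcst z (harmonic k)) (is_derive_fid z).
have d6 := is_derive_fcomp (f := fun t => harmonic k * t) (is_derive_cutoff _) dk.
have d7 := is_derive_fcomp (f := fun t => - t) (is_derive_cutoff (- z)) (is_derive_fN (is_derive_fid z)).
by apply: (is_derive_eq (is_derive_fM d5 (is_derive_fM d6 d7))); rewrite /profile_k'; ring.
Qed.

Lemma continuous_affine (b a : R) : continuous (fun t : R => b * (a - t)).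
Proof. by move=> z; exact: is_derive_continuous (is_derive_affine b a z). Qed.

Lemma continuous_scale (b : R) : continuous (fun t : R => b * t).
Proof. by move=> z; apply: cvgMr; exact: cvg_id. Qed.

Lemma continuous_profile_k' c rho k : continuous (profile_k' c rho k).
Proof.
have k0 : 0 < harmonic k :> R by exact: harmonic_gt0.
have cE : continuous (fun z => expR (l * (h - z))).
  by move=> z; apply: (continuous_comp (@continuous_affine l h z)); exact: continuous_expR.
have cB : continuous (fun z : R => h - z) by move=> z; apply: cvgB; [exact: cvg_cst|exact: cvg_id].
have cS : continuous (fun z : R => l * softpos (harmonic k) (h - z)).
  move=> z; apply: cvgMr; apply: (continuous_comp (cB z)).
  exact: is_derive_continuous (is_derive_softpos _ k0).
have cS' : continuous (fun z : R => softpos' (harmonic k) (h - z)).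
  by move=> z; apply: (continuous_comp (cB z)); exact: continuous_softpos'.
have cs : continuous (fun z => sinhR (l * softpos (harmonic k) (h - z))).
  by move=> z; apply: (continuous_comp (cS z)); exact: continuous_sinhR.
have cc : continuous (fun z => coshR (l * softpos (harmonic k) (h - z))).
  by move=> z; apply: (continuous_comp (cS z)); exact: continuous_coshR.
have ck (f : R -> R) : continuous f -> continuous (fun z : R => f (harmonic k * z)).
  by move=> cf z; apply: (continuous_comp (@continuous_scale (harmonic k) z)); exact: cf.
have cN (f : R -> R) : continuous f -> continuous (fun z => f (- z)).
  by move=> cf z; apply: (@continuous_comp _ _ _ -%R f); [apply: cvgN; exact: cvg_id|exact: cf].
have cchi := @continuous_cutoff R; have cchi' := @continuous_cutoff' R.
move=> z; apply: cvgD; apply: cvgM.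
- apply: cvgMr; apply: cvgD; first exact: cE.
  by apply: cvgMr; apply: cvgM; [exact: cc|exact: cS'].
- by apply: cvgM; [exact: ck|exact: cN].
- by apply: cvgMr; apply: cvgD; [exact: cE|apply: cvgMr; exact: cs].
- apply: cvgB; apply: cvgM; [|exact: cN|exact: ck|exact: cN].
  by apply: cvgMr; exact: ck.
Qed.

Lemma profile_k_supp c rho k : exists L : R, forall z : R, L <= `|z| -> profile_k c rho k z = 0.
Proof.
have k0 : 0 < harmonic k :> R by exact: harmonic_gt0.
exists (2 + 2 / harmonic k) => z Lz; rewrite /profile_k.
have hk : 0 <= 2 / harmonic k :> R := divr_ge0 (ler0n R 2) (ltW k0).
have [z0|z0] := leP 0 z.
  rewrite cutoff_ge2 ?mul0r ?mulr0// -ler_pdivrMl// mulrC.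
  by rewrite (le_trans _ (le_trans Lz _)) ?lerDr// ger0_norm.
rewrite (cutoff_ge2 (s := - z)) ?mulr0//.
by rewrite (le_trans _ (le_trans Lz _)) ?lerDl// ltr0_norm.
Qed.

(** A crude constant for the approximants and for their derivatives, uniform in [k]: 5 bounds
    [softpos'], [l] comes from differentiating the exponentials, and 4 bounds [cutoff']. *)
Definition profile_bound c rho : R := `|c| * (1 + 5 * `|rho - 1|) * (l + 4) * expR (l * h).

Lemma softpos_range k (z : R) : 0 <= z ->
  (softpos (harmonic k) (h - z) = 0 /\ softpos' (harmonic k) (h - z) = 0) \/
  0 <= l * softpos (harmonic k) (h - z) <= l * (h - z).
Proof.
have k0 : 0 < harmonic k :> R by exact: harmonic_gt0.
move=> z0; have [hz|hz] := leP (h - z) 0.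
  by left; rewrite softpos_le0// softpos'_le0.
right; have /andP[s0 s1] := softpos_itv k0 (ltW hz).
by rewrite mulr_ge0 ?(ltW l_gt0)//= ler_wpM2l// ltW.
Qed.

Lemma norm_cutoffM (s t : R) : `|cutoff s * cutoff t| <= 1.
Proof. by rewrite normrM mulr_ile1 ?norm_cutoff. Qed.

Lemma profile_bound_arith (a e s r b : R) : 0 <= e -> `|s| <= b * e ->
  `|a * (e + r * s)| <= `|a| * ((1 + b * `|r|) * e).
Proof.
move=> e0 sb; rewrite normrM ler_wpM2l// (le_trans (ler_normD _ _))//.
rewrite normrM (ger0_norm e0) mulrDl mul1r lerD2l (mulrC b) -mulrA.
exact: ler_wpM2l.
Qed.

Lemma expR_layer (z : R) : expR (l * (h - z)) = expR (l * h) * expR (- (l * z)).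
Proof. by rewrite -expRD mulrBr. Qed.

Lemma norm_profile_k c rho k (z : R) : 0 <= z ->
  `|profile_k c rho k z| <= profile_bound c rho * expR (- (l * z)).
Proof.
move=> z0; pose e := expR (l * (h - z)); have e0 : 0 <= e := expR_ge0 _.
have s1 : `|sinhR (l * softpos (harmonic k) (h - z))| <= 1 * e.
  rewrite mul1r; have [[-> _]|/norm_sinhR_le//] := softpos_range k z0.
  by rewrite mulr0 sinhR0 normr0.
have b1 := profile_bound_arith c (rho - 1) e0 s1.
rewrite /profile_k normrM; apply: (le_trans (ler_piMr (normr_ge0 _) (norm_cutoffM _ _))).
apply: (le_trans b1); rewrite /profile_bound -[X in _ <= X]mulrA -expR_layer -/e.
rewrite -[X in _ <= X]mulrA -[X in _ <= X]mulrA; apply: ler_wpM2l => //.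
have r0 := normr_ge0 (rho - 1).
rewrite mulrA; apply: ler_wpM2r => //.
have := mulr_ge0 r0 (ltW l_gt0).
move: `|rho - 1| r0 (ltW l_gt0) => N N0 l0 Nl0; nra.
Qed.

Lemma norm_profile_k' c rho k (z : R) : 0 < z ->
  `|profile_k' c rho k z| <= profile_bound c rho * expR (- (l * z)).
Proof.
move=> z0; pose e := expR (l * (h - z)); have e0 : 0 <= e := expR_ge0 _.
have k0 : 0 < harmonic k :> R by exact: harmonic_gt0.
have s1 : `|sinhR (l * softpos (harmonic k) (h - z))| <= 1 * e.
  rewrite mul1r; have [[-> _]|/norm_sinhR_le//] := softpos_range k (ltW z0).
  by rewrite mulr0 sinhR0 normr0.
have s2 : `|coshR (l * softpos (harmonic k) (h - z)) * softpos' (harmonic k) (h - z)| <= 5 * e.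
  rewrite normrM mulrC; have [[_ ->]|/norm_coshR_le c1] := softpos_range k (ltW z0).
    by rewrite normr0 mul0r mulr_ge0.
  by apply: ler_pM => //; exact: norm_softpos'.
have b1 := profile_bound_arith c (rho - 1) e0 s1.
have b2 := profile_bound_arith (- (c * l)) (rho - 1) e0 s2.
have zn : - z <= 1 by lra.
rewrite /profile_k' (cutoff_le1 zn) (cutoff'_le1 zn) !mulr1 mulr0 subr0.
have b3 : `|harmonic k * cutoff' (harmonic k * z)| <= 4.
  rewrite normrM -[leRHS]mul1r; apply: ler_pM => //; last exact: norm_cutoff'.
  by rewrite ger0_norm ?(ltW k0)// invf_le1 ?ler1n ?ltr0n.
apply: (le_trans (ler_normD _ _)).
rewrite [X in X + _]normrM [X in _ + X]normrM.
have c1 := norm_cutoff (harmonic k * z).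
have aE : `|- (c * l)| = `|c| * l by rewrite normrN normrM (gtr0_norm l_gt0).
rewrite aE in b2.
rewrite /profile_bound -[X in _ <= X]mulrA -expR_layer -/e.
apply: (le_trans (lerD (ler_piMr (normr_ge0 _) c1) (ler_wpM2l (normr_ge0 _) b3))).
apply: (le_trans (lerD b2 (ler_wpM2r (ler0n R 4) b1))).
have := mulr_ge0 (mulr_ge0 (normr_ge0 c) (normr_ge0 (rho - 1))) e0.
by move: `|c| `|rho - 1| e {b1 b2 s1 s2 e0} => C N e; lra.
Qed.


Lemma continuous_profile c rho : continuous (profile c rho).
Proof.
move=> z; apply: cvgMr; apply: cvgD.
  by apply: (continuous_comp (@continuous_affine l h z)); exact: continuous_expR.
apply: cvgMr; apply: (@continuous_comp _ _ _ (fun z => l * pospart (h - z)) sinhR); last exact: continuous_sinhR.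
apply: cvgMr; apply: (@continuous_comp _ _ _ (fun z => h - z) pospart); last exact: continuous_pospart.
by apply: cvgB; [exact: cvg_cst|exact: cvg_id].
Qed.

Lemma measurable_profile c rho : measurable_fun setT (profile c rho).
Proof. exact: continuous_measurable_fun (@continuous_profile c rho). Qed.

Lemma measurable_profile' c rho : measurable_fun setT (profile' c rho).
Proof.
have mE (f : R -> R) : continuous f -> measurable_fun setT (fun z : R => f (l * (h - z))).
  move=> cf; apply: continuous_measurable_fun => z.
  by apply: (continuous_comp (@continuous_affine l h z)); exact: cf.
apply: measurable_funM; first exact: measurable_cst.
apply: measurable_funD; first by apply: mE; exact: continuous_expR.
apply: measurable_funM; first exact: measurable_cst.
apply: measurable_fun_ifT; last 2 first.
- by apply: mE; exact: continuous_coshR.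
- exact: measurable_cst.
apply: measurable_fun_ltr; first exact: measurable_cst.
apply: continuous_measurable_fun => z; apply: cvgB; [exact: cvg_cst|exact: cvg_id].
Qed.

Lemma cvg_cutoff_harm (z : R) :
  cutoff (harmonic k * z) @[k --> \oo] --> (1 : R) /\ cutoff' (harmonic k * z) @[k --> \oo] --> (0 : R).
Proof.
have c : harmonic k * z @[k --> \oo] --> 0 * z by apply: cvgMl; exact: cvg_harmonic.
rewrite mul0r in c; split.
  by rewrite -(@cutoff_le1 R 0 ler01); apply: continuous_cvg c; exact: continuous_cutoff.
by rewrite -(@cutoff'_le1 R 0 ler01); apply: continuous_cvg c; exact: continuous_cutoff'.
Qed.

Lemma cvg_profile_k c rho (z : R) : 0 <= z ->
  profile_k c rho k z @[k --> \oo] --> profile c rho z.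
Proof.
move=> z0; rewrite -[X in _ --> X]mulr1; apply: cvgM.
  apply: cvgMr; apply: cvgD; first exact: cvg_cst.
  apply: cvgMr; apply: continuous_cvg; first exact: continuous_sinhR.
  by apply: cvgMr; exact: cvg_softpos.
have zn : - z <= 1 by lra.
rewrite (cutoff_le1 zn); under eq_fun do rewrite mulr1.
by have [] := cvg_cutoff_harm z.
Qed.

Lemma cvg_profile_k' c rho (z : R) : 0 < z ->
  profile_k' c rho k z @[k --> \oo] --> profile' c rho z.
Proof.
move=> z0; have zn : - z <= 1 by lra.
rewrite /profile_k' (cutoff_le1 zn) (cutoff'_le1 zn).
under eq_fun do rewrite !mulr1 mulr0 subr0.
have [c1 c2] := cvg_cutoff_harm z.
rewrite -[profile' c rho z]addr0; apply: cvgD.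
  rewrite -[X in _ --> X]mulr1; apply: cvgM => //.
  apply: cvgMr; apply: cvgD; first exact: cvg_cst.
  apply: cvgMr.
  rewrite (_ : (if _ then _ else _) = coshR (l * pospart (h - z)) * (if 0 < h - z then 1 else 0)); last first.
    by case: ifP => hz; rewrite ?mulr0// mulr1 pospart_ge// ltW.
  apply: cvgM; last exact: cvg_softpos'.
  apply: continuous_cvg; first exact: continuous_coshR.
  by apply: cvgMr; exact: cvg_softpos.
rewrite -(mulr0 (c * (expR (l * (h - z)) + (rho - 1) * sinhR (l * pospart (h - z))))).
apply: cvgM.
  apply: cvgMr; apply: cvgD; first exact: cvg_cst.
  apply: cvgMr; apply: continuous_cvg; first exact: continuous_sinhR.
  by apply: cvgMr; exact: cvg_softpos.
by rewrite -(mulr0 (0 : R)); apply: cvgM => //; exact: cvg_harmonic.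
Qed.

Lemma norm_cvgn_le (f : nat -> R) (a b : R) : f k @[k --> \oo] --> a ->
  (forall k, `|f k| <= b) -> `|a| <= b.
Proof.
move=> cf fb; have cv : `|f k| @[k --> \oo] --> `|a| by exact: cvg_norm.
rewrite -(cvg_lim _ cv)//; apply: limr_le; first by apply/cvg_ex; eexists; exact: cv.
exact: nearW.
Qed.

Lemma norm_profile c rho (z : R) : 0 < z ->
  `|profile c rho z| <= profile_bound c rho * expR (- (l * z)).
Proof.
move=> z0; apply: (norm_cvgn_le (@cvg_profile_k c rho z (ltW z0))) => k.
by apply: norm_profile_k; exact: ltW.
Qed.

Lemma norm_profile' c rho (z : R) : 0 < z ->
  `|profile' c rho z| <= profile_bound c rho * expR (- (l * z)).
Proof.
move=> z0; apply: (norm_cvgn_le (@cvg_profile_k' c rho z z0)) => k.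
exact: norm_profile_k'.
Qed.

Lemma profile0 c rho : profile c rho 0 = c * (coshR (l * h) + rho * sinhR (l * h)).
Proof. by rewrite /profile subr0 pospart_ge ?(ltW h_gt0)// -coshDsinh; ring. Qed.

Lemma profile'0 c rho : profile' c rho 0 = - (c * l) * (sinhR (l * h) + rho * coshR (l * h)).
Proof. by rewrite /profile' subr0 h_gt0 -coshDsinh; ring. Qed.

(** Below [h], with [x = l * (h - z)], the profile is [c * (cosh x + rho * sinh x)] and its
    derivative [- c * l * (sinh x + rho * cosh x)]. For [rho = k_1 / k_2], multiplying by [k_2]
    clears the fraction, and factoring [k_1] out leaves the profile of the inverse contrast. Above
    [h] both are multiples of one exponential. *)
Lemma conductivity_profile' c (a : R * R) (z : R) : 1 + a.1 != 0 -> 1 + a.2 != 0 ->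
  conductivity h a z * profile' c ((1 + a.1) / (1 + a.2)) z =
  - (l * (1 + a.1)) * profile c ((1 + a.2) / (1 + a.1)) z.
Proof.
move=> a1 a2; rewrite /conductivity /profile /profile' subr_gt0.
case: leP => hz.
  by rewrite pospart_le ?subr_le0// !mulr0 sinhR0 ?mulr0 !addr0; ring.
rewrite pospart_ge ?subr_ge0 ?(ltW hz)// -coshDsinh; field.
by rewrite a1.
Qed.

Lemma conductivity_profile c (a : R * R) (z : R) : 1 + a.1 != 0 -> 1 + a.2 != 0 ->
  conductivity h a z * (l * profile c ((1 + a.1) / (1 + a.2)) z) =
  - (1 + a.1) * profile' c ((1 + a.2) / (1 + a.1)) z.
Proof.
move=> a1 a2; rewrite /conductivity /profile /profile' subr_gt0.
case: leP => hz.
  by rewrite pospart_le ?subr_le0// !mulr0 sinhR0 ?mulr0 !addr0; ring.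
rewrite pospart_ge ?subr_ge0 ?(ltW hz)// -coshDsinh; field.
by rewrite a1.
Qed.

End LayerProfile.

(** * The explicit function is a weak solution *)

Section ExplicitSolution.
Context {R : realType}.
Local Notation R2 := (R * R)%type.
Local Notation R3 := (R * R * R)%type.
Local Notation mu := (@lebesgue_measure R).
Local Notation RT := (measurableTypeR R).
Local Notation mu2 := (mu \x mu)%E.
Local Notation mu3 := (mu2 \x mu)%E.
Variables (l h : R) (a : R2).
Hypotheses (l_gt0 : 0 < l) (h_gt0 : 0 < h) (l_zero : besselJ 0 l = 0).
Hypotheses (a1_ge0 : 0 <= a.1) (a2_ge0 : 0 <= a.2).
Implicit Types (c rho : R).

Let mC := @mu3_measurable_cylinder R.

(** J_0 (l r) as a function of [s = r ^ 2], followed by its first two derivatives. *)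
Definition bessel_sq (s : R) : R := bfun 0 (l ^+ 2 / 4 * s).
Definition bessel_sq' (s : R) : R := - (l ^+ 2 / 4) * bfun 1 (l ^+ 2 / 4 * s).
Definition bessel_sq'' (s : R) : R := (l ^+ 2 / 4) ^+ 2 * bfun 2 (l ^+ 2 / 4 * s).

Lemma is_derive_bfun_scale p (k s : R) :
  is_derive s 1 (fun t => bfun p (k * t)) (- (k * bfun p.+1 (k * s))).
Proof.
have d := is_derive_fcomp (f := fun t => k * t) (is_derive_bfun p _)
  (is_derive_fM (is_derive_fcst s k) (is_derive_fid s)).
by apply: (is_derive_eq d); ring.
Qed.

Lemma is_derive_bessel_sq (s : R) : is_derive s 1 bessel_sq (bessel_sq' s).
Proof.
by apply: (is_derive_eq (is_derive_bfun_scale 0 _ s)); rewrite /bessel_sq'; ring.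
Qed.

Lemma is_derive_bessel_sq' (s : R) : is_derive s 1 bessel_sq' (bessel_sq'' s).
Proof.
have d := is_derive_fM (is_derive_fcst s (- (l ^+ 2 / 4))) (is_derive_bfun_scale 1 (l ^+ 2 / 4) s).
by apply: (is_derive_eq d); rewrite /bessel_sq''; ring.
Qed.

Lemma continuous_bessel_sq : continuous bessel_sq.
Proof. by move=> s; exact: is_derive_continuous (is_derive_bessel_sq s). Qed.

Lemma continuous_bessel_sq' : continuous bessel_sq'.
Proof. by move=> s; exact: is_derive_continuous (is_derive_bessel_sq' s). Qed.

Lemma continuous_bessel_sq'' : continuous bessel_sq''.
Proof.
by move=> s; apply: cvgMr; exact: is_derive_continuous (is_derive_bfun_scale 2 _ s).
Qed.

(** The left-hand side is the horizontal Laplacian of [g (r ^ 2)] at [r ^ 2 = s], so this is the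
    eigenvalue equation of J_0 (l r); it reduces to [bfun_rec]. *)
Lemma bessel_sq_ode (s : R) : 4 * bessel_sq' s + 4 * s * bessel_sq'' s = - l ^+ 2 * bessel_sq s.
Proof. by rewrite /bessel_sq /bessel_sq' /bessel_sq'' bfun_rec; field. Qed.

Lemma bessel_sq1 : bessel_sq 1 = 0.
Proof. by rewrite /bessel_sq mulr1 -besselJ0E. Qed.

Lemma besselJ0_sqrt (s : R) : 0 <= s -> besselJ 0 (l * Num.sqrt s) = bessel_sq s.
Proof.
by move=> s0; rewrite besselJ0E exprMn sqr_sqrtr// /bessel_sq; congr (bfun _ _); field.
Qed.

Let J := bessel_sq.
Let J' := bessel_sq'.
Let J'' := bessel_sq''.

Lemma sep_trace c rho : has_trace (sep J (profile l h c rho))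
  (dsep J J' (profile l h c rho) (profile' l h c rho))
  (fun q => J (q.1 ^+ 2 + q.2 ^+ 2) * profile l h c rho 0) (fun=> 0).
Proof.
apply: (@has_trace_sep R J J' _ _ (profile_k l h c rho) (profile_k' l h c rho)
  (profile_bound l h c rho) l).
- exact: is_derive_bessel_sq.
- exact: continuous_bessel_sq'.
- exact: bessel_sq1.
- by move=> k s; exact: is_derive_profile_k.
- by move=> k; exact: continuous_profile_k'.
- by move=> k; exact: profile_k_supp.
- exact: measurable_profile.
- exact: measurable_profile'.
- exact: l_gt0.
- by move=> k z; exact: norm_profile_k.
- by move=> k z; exact: norm_profile_k'.
- by move=> z; exact: cvg_profile_k.
- by move=> z; exact: cvg_profile_k'.
Qed.

Lemma L2_sep_profile (g : R -> R) c rho : continuous g ->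
  L2 mu3 cylinder (sep g (profile l h c rho)).
Proof.
move=> cg; have [G _ gG] := continuous_bounded01 cg.
apply: (L2_sep (continuous_measurable_fun cg) (@measurable_profile R l h c rho) l_gt0 gG).
by move=> z; exact: norm_profile.
Qed.

Lemma L2_dsep_profile c rho i :
  L2 mu3 cylinder (dsep J J' (profile l h c rho) (profile' l h c rho) i).
Proof.
have [G1 G10 gG1] := continuous_bounded01 continuous_bessel_sq.
have [G2 G20 gG2] := continuous_bounded01 continuous_bessel_sq'.
apply: (@L2_dsep R J J' _ _ (G1 + G2) (profile_bound l h c rho) l).
- exact: continuous_measurable_fun continuous_bessel_sq.
- exact: continuous_measurable_fun continuous_bessel_sq'.
- exact: measurable_profile.
- exact: measurable_profile'.
- exact: l_gt0.
- by move=> s /gG1 /le_trans; apply; rewrite lerDl.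
- by move=> s /gG2 /le_trans; apply; rewrite lerDr.
- by move=> z; exact: norm_profile.
- by move=> z; exact: norm_profile'.
Qed.

(** A horizontal component of the gradient of J_0 (l r). It is kept apart from the vertical factor,
    which has a kink, so as to be the smooth factor in [limit_green_lateral]. *)
Definition gradJ (i : 'I_3) (p : R3) : R := coord3 i p * sep (fun s => 2 * J' s) (fun=> 1) p.

Lemma C1_gradJ (i : 'I_3) : i != 2%N :> nat -> C1 (gradJ i) /\
  partial i (gradJ i) = fun p => 2 * J' (rsq p) + 4 * coord3 i p ^+ 2 * J'' (rsq p).
Proof.
move=> i2; have [C1x px] := @C1_coord3 R i.
have d2 (s : R) : is_derive s 1 (fun s => 2 * J' s) (2 * J'' s).
  by apply: (is_derive_eq (is_derive_fM (is_derive_fcst s 2) (is_derive_bessel_sq' s))); rewrite mul0r add0r.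
have [C1s ps] := C1_sep d2 (fun s => cvgMr (@continuous_bessel_sq'' s))
  (fun s => is_derive_fcst s 1) (fun s => cvg_cst _).
have [C1a pa] := C1M C1x C1s; split => //.
apply/funext => p; rewrite pa px ps eqxx /sep /dsep (negbTE i2) /=; ring.
Qed.


Let gam (p : R3) := conductivity h a p.2.

Definition contrast : R := (1 + a.1) / (1 + a.2).

Definition explicit_sol c (r z : R) : R := besselJ 0 (l * r) * profile l h c contrast z.

Lemma radial3_explicit c : radial3 (explicit_sol c) = sep J (profile l h c contrast).
Proof.
apply/funext => p; rewrite /radial3 /radial2 /explicit_sol besselJ0_sqrt//.
by rewrite addr_ge0 ?sqr_ge0.
Qed.

Lemma radial2_explicit c : radial2 (fun r : R => profile l h c contrast 0 * besselJ 0 (l * r)) =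
  fun q => J (q.1 ^+ 2 + q.2 ^+ 2) * profile l h c contrast 0.
Proof.
by apply/funext => q; rewrite /radial2 besselJ0_sqrt ?addr_ge0 ?sqr_ge0// mulrC.
Qed.

Let a1_neq0 : 1 + a.1 != 0.
Proof. by rewrite gt_eqF// ltr_wpDr. Qed.

Let a2_neq0 : 1 + a.2 != 0.
Proof. by rewrite gt_eqF// ltr_wpDr. Qed.

Lemma L2_gradJ c (j : 'I_3) : j != 2%N :> nat ->
  L2 mu3 cylinder (fun p => gam p * profile l h c contrast p.2 * gradJ j p).
Proof.
move=> j2; pose s := profile l h c contrast.
have := L2_conductivity h a1_ge0 a2_ge0 (L2_dsep_profile c contrast j).
rewrite (_ : (fun p => _) = fun p => conductivity h a p.2 * s p.2 * gradJ j p)//.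
by apply/funext => p; rewrite /dsep (negbTE j2) /gradJ /sep /s; ring.
Qed.

Lemma L2_partial_gradJ c (j : 'I_3) : j != 2%N :> nat ->
  L2 mu3 cylinder (fun p => gam p * profile l h c contrast p.2 * partial j (gradJ j) p).
Proof.
move=> j2; pose s := profile l h c contrast; have [_ pj] := C1_gradJ j2.
rewrite pj.
have mq : measurable_fun cylinder (fun p : RT * RT * RT => coord3 j (p : R3) ^+ 2).
  apply: measurable_funTS; apply: measurable_funX.
  exact: (continuous_measurable3 (@continuous_coord3 R j)).
have q1 (p : R3) : cylinder p -> `|coord3 j p ^+ 2| <= 1.
  by move=> Cp; rewrite normrX expr_le1// norm_coord3_le.
have c2 : continuous (fun s => 2 * J' s).
  by move=> x; apply: cvgMr; exact: continuous_bessel_sq'.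
have c4 : continuous (fun s => 4 * J'' s).
  by move=> x; apply: cvgMr; exact: continuous_bessel_sq''.
have L4 := L2Zl mC mq q1 (L2_sep_profile c contrast c4).
have := L2_conductivity h a1_ge0 a2_ge0 (L2D mC (L2_sep_profile c contrast c2) L4).
rewrite (_ : (fun p => _) = fun p => conductivity h a p.2 * s p.2 *
  (2 * J' (rsq p) + 4 * coord3 j p ^+ 2 * J'' (rsq p)))//.
by apply/funext => p; rewrite /sep /s; ring.
Qed.

(** Conductivity times profile goes into the rough weight and [gradJ] into the smooth factor; the
    zero lateral trace of [v] removes the boundary term. *)
Lemma green_horizontal c (b : bool) v Dv : H1 v Dv -> has_trace v Dv (fun=> 0) (fun=> 0) ->
  let j := if b then ord0 else inord 1 in
  let s := profile l h c contrast in
  \int[mu3]_(p in cylinder) (v p * (gam p * s p.2 * partial j (gradJ j) p)) +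
  \int[mu3]_(p in cylinder) (Dv j p * (gam p * s p.2 * gradJ j p)) = 0.
Proof.
move=> [Lv HDv] [vk [C1v cv cDv _ cl]] j s.
have LDv i : L2 mu3 cylinder (Dv i) by have [] := HDv i.
have j2 : j != 2%N :> nat by rewrite /j; case: (b); rewrite ?inordK.
have [C1j pj] := C1_gradJ j2.
have mg : measurable_fun setT (fun z => conductivity h a z * s z).
  by apply: measurable_funM; [exact: measurable_conductivity|exact: measurable_profile].
have bnd z : 0 < z -> `|conductivity h a z * s z| <=
    (1 + a.1 + a.2) * profile_bound l h c contrast * expR (- (l * z)).
  move=> z0; rewrite normrM -mulrA; apply: ler_pM => //.
    exact: conductivity_le.
  exact: norm_profile.
apply: (limit_green_lateral (a := gradJ j) (b := fun z => conductivity h a z * s z)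
  (B := (1 + a.1 + a.2) * profile_bound l h c contrast) C1v Lv LDv cv cDv C1j mg).
- move=> z z0; apply: (le_trans (bnd z z0)); apply: ler_piMr.
    rewrite mulr_ge0 ?addr_ge0// /profile_bound !mulr_ge0 ?addr_ge0 ?mulr_ge0 ?expR_ge0//.
    exact: ltW.
  by rewrite expR_le1 oppr_le0 mulr_ge0// ltW.
- exact: L2_gradJ.
- exact: L2_partial_gradJ.
- apply: (L2_le (@mu2_measurable_lateral R) _ _ (g := fun tz =>
    ((1 + a.1 + a.2) * profile_bound l h c contrast * `|2 * J' 1|) * expR (- (l * tz.2)))).
  + apply: measurable_funTS; apply: measurable_funM; last first.
      by apply: continuous_lateral; have [] := C1j.
    apply: measurable_funM.
      by apply: (measurableT_comp mg); exact: measurable_snd.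
    apply: (continuous_lateral (v := fun p => if b then p.1.1 else p.1.2)).
    by case: (b) => p; [exact: (@continuous_coord3 R ord0)|
      exact: (@continuous_coord3 R (Ordinal (isT : (1 < 3)%N)))].
  + move=> [t z] [_ /=]; rewrite in_itv/= andbT => z0.
    rewrite /gradJ /sep /rsq/= cos2Dsin2 mulr1.
    apply: le_trans (ler_norm _).
    have -> : coord3 j (cos t, sin t, z) = if b then cos t else sin t.
      by rewrite /j /coord3; case: (b); rewrite //= inordK.
    rewrite -mulrA normrM mulrA [X in _ * X]normrM.
    have cs : `|(if b then cos t else sin t) * (if b then cos t else sin t)| <= 1.
      by case: (b); rewrite -expr2 normrX expr_le1// ?cos_max ?sin_max.
    apply: (le_trans (ler_pM (normr_ge0 _) _ (bnd z z0) (ler_wpM2r (normr_ge0 _) cs))).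
      by rewrite mulr_ge0.
    by rewrite mul1r mulrAC.
  + apply: (L2Zl (@mu2_measurable_lateral R)
      (K := `|(1 + a.1 + a.2) * profile_bound l h c contrast * `|2 * J' 1| |)) => //.
    exact: L2_expR_lateral.
- exact: cl.
Qed.


Lemma L2_bottom (K : R) : L2 mu2 disk (fun q => J (q.1 ^+ 2 + q.2 ^+ 2) * K).
Proof.
have mD := @mu2_measurable_disk R.
have [G G0 gG] := continuous_bounded01 continuous_bessel_sq.
apply: (@L2_bounded _ _ R mu2 disk mD _ (G * `|K|)).
- exact: mu2_disk_lty.
- apply: measurable_funTS; apply: measurable_funM => //.
  apply: (measurableT_comp (continuous_measurable_fun continuous_bessel_sq)).
  exact: continuous_measurable2 (continuous_bottom (@continuous_rsq R)).
- move=> q Dq; rewrite normrM ler_wpM2r//; apply: gG.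
  by rewrite addr_ge0 ?sqr_ge0//= ltW.
Qed.

(** The profile of the inverse contrast stands for the vertical flux. Being itself a limit of C^1_c
    functions, it can be paired with [v] by [green_vertical], whose bottom term vanishes with the
    trace of [v]. *)
Lemma green_explicit c v Dv : H1 v Dv -> has_trace v Dv (fun=> 0) (fun=> 0) ->
  let s := profile l h c ((1 + a.2) / (1 + a.1)) in
  let s' := profile' l h c ((1 + a.2) / (1 + a.1)) in
  \int[mu3]_(p in cylinder) (v p * sep J s' p) +
  \int[mu3]_(p in cylinder) (Dv (inord 2) p * sep J s p) = 0.
Proof.
move=> [Lv HDv] tv s s'.
have LDv i : L2 mu3 cylinder (Dv i) by have [] := HDv i.
have L0 : L2 mu2 disk (fun=> 0) := L2_cst (@mu2_measurable_disk R) 0 (@mu2_disk_lty R).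
have := green_vertical Lv LDv L0 (L2_sep_profile c _ continuous_bessel_sq)
  (L2_dsep_profile c ((1 + a.2) / (1 + a.1))) (L2_bottom _) tv (sep_trace c _).
rewrite [X in - X]Rintegral_eq0 ?oppr0; last by move=> q _; rewrite mul0r.
by rewrite addrC /dsep inordK.
Qed.

Lemma green_arith (x0 x1 x2 y0 y1 y2 k : R) : x0 + y0 = 0 -> x1 + y1 = 0 ->
  x2 + y2 = 0 -> x0 + x1 + k * x2 = 0 -> y0 + y1 + k * y2 = 0.
Proof.
move=> /eqP; rewrite addr_eq0 => /eqP-> /eqP; rewrite addr_eq0 => /eqP->.
by move=> /eqP; rewrite addr_eq0 => /eqP->; lra.
Qed.

Lemma explicit_weak_solution c :
  weak_solution h a (fun r => profile l h c contrast 0 * besselJ 0 (l * r)) (explicit_sol c).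
Proof.
pose s := profile l h c contrast; pose Du := dsep J J' s (profile' l h c contrast).
have Lu : L2 mu3 cylinder (sep J s) := L2_sep_profile c contrast continuous_bessel_sq.
have LDu i : L2 mu3 cylinder (Du i) := L2_dsep_profile c contrast i.
rewrite /weak_solution radial3_explicit radial2_explicit; exists Du.
  by split; [exact: has_trace_H1 Lu LDu (sep_trace c contrast)|exact: sep_trace].
move=> v Dv Hv tv; have [Lv HDv] := Hv.
have LDv i : L2 mu3 cylinder (Dv i) by have [] := HDv i.
have gx := green_horizontal c true Hv tv; have gy := green_horizontal c false Hv tv.
have gz := green_explicit c Hv tv.
have i1 : (inord 1 : 'I_3) != 2%N :> nat by rewrite inordK.
rewrite /= in gx gy gz; set k := - (l * (1 + a.1)).
set t := profile l h c ((1 + a.2) / (1 + a.1)) in gz.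
set t' := profile' l h c ((1 + a.2) / (1 + a.1)) in gz.
pose v0 p := v p * (gam p * s p.2 * partial ord0 (gradJ ord0) p).
pose v1 p := v p * (gam p * s p.2 * partial (inord 1) (gradJ (inord 1)) p).
pose v2 p := v p * sep J t' p.
pose d0 p := Dv ord0 p * (gam p * s p.2 * gradJ ord0 p).
pose d1 p := Dv (inord 1) p * (gam p * s p.2 * gradJ (inord 1) p).
pose d2 p := Dv (inord 2) p * sep J t p.
have Lt : L2 mu3 cylinder (sep J t) := L2_sep_profile c _ continuous_bessel_sq.
have Lt' : L2 mu3 cylinder (sep J t').
  have := L2_dsep_profile c ((1 + a.2) / (1 + a.1)) (inord 2).
  by rewrite /dsep inordK.
have iv0 : mu3.-integrable cylinder (EFin \o v0) := L2_integrableM mC Lv (@L2_partial_gradJ c ord0 isT).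
have iv1 : mu3.-integrable cylinder (EFin \o v1) := L2_integrableM mC Lv (L2_partial_gradJ c i1).
have iv2 : mu3.-integrable cylinder (EFin \o v2) := L2_integrableM mC Lv Lt'.
have id0 : mu3.-integrable cylinder (EFin \o d0) := L2_integrableM mC (LDv _) (@L2_gradJ c ord0 isT).
have id1 : mu3.-integrable cylinder (EFin \o d1) := L2_integrableM mC (LDv _) (L2_gradJ c i1).
have id2 : mu3.-integrable cylinder (EFin \o d2) := L2_integrableM mC (LDv _) Lt.
have sum3 (f0 f1 f2 : R3 -> R) : mu3.-integrable cylinder (EFin \o f0) ->
    mu3.-integrable cylinder (EFin \o f1) -> mu3.-integrable cylinder (EFin \o f2) ->
    \int[mu3]_(p in cylinder) (f0 p + f1 p + k * f2 p) =
    \int[mu3]_(p in cylinder) f0 p + \int[mu3]_(p in cylinder) f1 p +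
    k * \int[mu3]_(p in cylinder) f2 p.
  move=> if0 if1 if2; have if01 := integrableD mC if0 if1.
  have ikf2 : mu3.-integrable cylinder (EFin \o (fun p => k * f2 p)).
    by have := integrableZl mC k if2; apply: eq_integrable.
  by rewrite RintegralD// RintegralD// RintegralZl.
(* The conjugation turns the vertical flux into [k] times the profile of the inverse contrast, so
   that each of the three terms occurs in one of the Green formulas. *)
have Ed : \int[mu3]_(p in cylinder) (conductivity h a p.2 * \sum_(i < 3) Du i p * Dv i p) =
    \int[mu3]_(p in cylinder) (d0 p + d1 p + k * d2 p).
  apply: eq_Rintegral => p _; rewrite !big_ord_recl big_ord0.
  have -> : lift ord0 ord0 = inord 1 :> 'I_3 by apply/val_inj; rewrite /= inordK.
  have -> : lift ord0 (lift ord0 ord0) = inord 2 :> 'I_3 by apply/val_inj; rewrite /= inordK.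
  have e := conductivity_profile' l h c p.2 a1_neq0 a2_neq0; rewrite -/t -/k in e.
  rewrite /d0 /d1 /d2 /Du /dsep !inordK//= /gradJ /sep [k * _]mulrCA [k * _]mulrCA -e /gam /s.
  ring.
(* The divergence of the flux vanishes pointwise: its horizontal part is [- l ^ 2 * J * gam * s] by
   the Bessel equation, and its vertical part is the opposite by the second conjugation. *)
have Ev : \int[mu3]_(p in cylinder) (v0 p + v1 p + k * v2 p) = 0.
  apply: Rintegral_eq0 => p _.
  have [_ px] := @C1_gradJ ord0 isT; have [_ py] := C1_gradJ i1.
  have ode := bessel_sq_ode (rsq p); rewrite -/J -/J' -/J'' in ode.
  have e := conductivity_profile l h c p.2 a1_neq0 a2_neq0; rewrite -/s -/t' in e.
  rewrite /v0 /v1 /v2 px py /sep.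
  transitivity (v p * (gam p * s p.2 * (4 * J' (rsq p) + 4 * rsq p * J'' (rsq p))
     + J (rsq p) * (l * (- (1 + a.1) * t' p.2)))).
    by rewrite /rsq /coord3 /= inordK//= /k; ring.
  by rewrite ode -e /gam; ring.
rewrite Ed sum3//; rewrite sum3// in Ev.
exact: (green_arith gx gy gz Ev).
Qed.

End ExplicitSolution.

(** * Polar null sets *)

Section NullSets.
Context {R : realType}.
Local Notation mu := (@lebesgue_measure R).

(** Half-open intervals of total length below [e / 2] cover [A]. The map sends each of them into the
    interval centred at the image of its right end, with its length as radius, at the price of a
    factor 2. *)
Lemma lipschitz_cover (f : R -> R) (A : set R) (e : R) :
  (forall x y : R, `|f x - f y| <= `|x - y|) -> mu A = 0%E -> 0 < e ->
  exists U : set R, [/\ measurable U, f @` A `<=` U & (mu U <= e%:E)%E].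
Proof.
move=> lipf A0 e0.
have /ereal_inf_lt[z [/= M covA <-{z}] Me] : (mu A < (e / 2)%:E)%E by rewrite A0 lte_fin divr_gt0.
have [mM AM] := covA.
have I_ n : exists I : set R, [/\ measurable I, f @` M n `<=` I &
    (mu I <= 2%:E * wlength idfun (M n))%E].
  have /ocitvP[->|[[a b] /= ab ->]] : ocitv (M n) by exact: mM.
    by exists set0; rewrite image_set0 wlength0 mule0; split => //; rewrite measure0.
  exists `[f b - (b - a), f b + (b - a)]%classic; split; first exact: measurable_itv.
    move=> _ [x /= + <-]; rewrite !in_itv/= -ler_distl => /andP[ax xb].
    by apply: (le_trans (lipf _ _)); rewrite ler0_norm ?subr_le0//; lra.
  rewrite lebesgue_measure_itv/= wlength_itv/= !lte_fin ab ifT; last by lra.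
  by rewrite -!EFinD -EFinM lee_fin; lra.
have [I HI] := choice I_.
exists (\bigcup_n I n); split.
- by apply: bigcupT_measurable => n; have [] := HI n.
- move=> _ [x Ax <-]; have [n _ Mx] := AM x Ax.
  by exists n => //; have [_ + _] := HI n; apply; exists x.
- apply: (@le_trans _ _ (\sum_(n <oo) mu (I n))%E).
    exact: outer_measure_sigma_subadditive.
  apply: (@le_trans _ _ (\sum_(n <oo) (2%:E * wlength idfun (M n)))%E).
    by apply: lee_nneseries => n _; [|have [] := HI n].
  rewrite nneseriesZl; last by move=> n _; exact: wlength_ge0.
  apply: (@le_trans _ _ (2%:E * (e / 2)%:E)%E).
    by rewrite lee_wpmul2l// ltW.
  by rewrite -EFinM mulrC divfK.
Qed.

(** The image need not be measurable, hence [negligible]: it lies in an intersection of sets of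
    measure at most [1 / (n + 1)]. *)
Lemma lipschitz_negligible (f : R -> R) (A : set R) :
  (forall x y : R, `|f x - f y| <= `|x - y|) -> mu A = 0%E -> mu.-negligible (f @` A).
Proof.
move=> lipf A0.
have [U HU] := choice (fun n => lipschitz_cover lipf A0 (@harmonic_gt0 R n)).
have mI : measurable (\bigcap_n U n) by apply: bigcapT_measurable => n; have [] := HU n.
exists (\bigcap_n U n); split => //.
  apply/eqP; rewrite eq_le measure_ge0 andbT; apply/lee_addgt0Pr => e e0; rewrite add0e.
  have [n ne] : exists n, harmonic n <= e.
      by have [n _ /(_ n (leqnn n)) /= /ltW] := near_infty_natSinv_lt (PosNum e0); exists n.
  have [mU _ Un] := HU n; apply: (@le_trans _ _ (mu (U n))); last first.
    by apply: (le_trans Un); rewrite lee_fin.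
  by apply: le_measure; rewrite ?inE// => x; apply.
by move=> x Ax n _; have [_ + _] := HU n; apply.
Qed.

End NullSets.

Section ProductNull.
Context d1 d2 (T1 : measurableType d1) (T2 : measurableType d2) (R : realType).
Variable m1 : {sigma_finite_measure set T1 -> \bar R}.
Variable m2 : {sigma_finite_measure set T2 -> \bar R}.

Lemma ae_ysection_null (N : set (T1 * T2)) : measurable N -> (m1 \x m2)%E N = 0%E ->
  {ae m2, forall y, m1 (ysection N y) = 0%E}.
Proof.
move=> mN N0.
have : (\int[m2]_y `|m1 (ysection N y)| = 0)%E.
  under eq_integral do rewrite gee0_abs//.
  rewrite -N0 -(setIT N) -integral_indic//.
  rewrite (@fubini_tonelli2 _ _ _ _ R m1 m2 (EFin \o \1_N)).
  - apply: eq_integral => y _; rewrite /fubini_G /= setIT.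
    rewrite -[ysection N y]setIT -integral_indic//; last exact: measurable_ysection.
    by apply: eq_integral => x _; rewrite /= !indicE mem_ysection.
  - by apply/measurable_EFinP; exact: measurable_indic.
  - by move=> p; rewrite lee_fin.
move/ae_eq_integral_abs => /(_ measurableT (measurable_fun_ysection m1 mN)).
by apply: ae_imp => y; apply.
Qed.

End ProductNull.

Section Radial.
Context {R : realType}.
Local Notation R2 := (R * R)%type.
Local Notation R3 := (R * R * R)%type.
Local Notation mu := (@lebesgue_measure R).
Local Notation mu2 := (mu \x mu)%E.
Local Notation mu3 := (mu2 \x mu)%E.
Local Notation RT := (measurableTypeR R).

Let mu1s : {sigma_finite_measure set RT -> \bar R} := mu.
Let mu2s : {sigma_finite_measure set (RT * RT)%type -> \bar R} := sigma_finite_copy (@sigma_finite_mu2 R).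

(** For the two radii, [a ^ 2 - b ^ 2 = (x - x') * (x + x')] and [|x + x'| <= a + b]. *)
Lemma sqrt_lipschitz (y x x' : R) :
  `|Num.sqrt (x ^+ 2 + y ^+ 2) - Num.sqrt (x' ^+ 2 + y ^+ 2)| <= `|x - x'|.
Proof.
set a := Num.sqrt _; set b := Num.sqrt _.
have xa : `|x| <= a by rewrite -sqrtr_sqr ler_sqrt ?addr_ge0 ?sqr_ge0// lerDl sqr_ge0.
have xb : `|x'| <= b by rewrite -sqrtr_sqr ler_sqrt ?addr_ge0 ?sqr_ge0// lerDl sqr_ge0.
have a2 : a ^+ 2 = x ^+ 2 + y ^+ 2 by rewrite sqr_sqrtr// addr_ge0 ?sqr_ge0.
have b2 : b ^+ 2 = x' ^+ 2 + y ^+ 2 by rewrite sqr_sqrtr// addr_ge0 ?sqr_ge0.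
have ab0 : 0 <= a + b by rewrite addr_ge0 ?sqrtr_ge0.
have [ab|ab] := eqVneq (a + b) 0.
  have -> : a = 0 by apply/eqP; rewrite eq_le sqrtr_ge0 andbT -ab lerDl sqrtr_ge0.
  have -> : b = 0 by apply/eqP; rewrite eq_le sqrtr_ge0 andbT -ab lerDr sqrtr_ge0.
  by rewrite subrr normr0.
have ab1 : 0 < a + b by rewrite lt0r ab.
rewrite -(ler_pM2r ab1) -[in leLHS](ger0_norm ab0) -normrM -subr_sqr.
have -> : a ^+ 2 - b ^+ 2 = (x - x') * (x + x') by rewrite a2 b2; ring.
by rewrite normrM ler_wpM2l// (le_trans (ler_normD _ _))// lerD.
Qed.

(** A measurable superset [N] of the exceptional set is kept, so that the measures of its sections
    can be integrated; Tonelli is applied twice, first to isolate [z] and then [y]. *)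
Lemma ae_sections (P : R3 -> Prop) : {ae mu3, forall p, P p} ->
  exists N : set R3, (forall p, ~ P p -> N p) /\
   {ae mu, forall z, {ae mu, forall y, mu [set x | N (x, y, z)] = 0%E}}.
Proof.
move=> [N [mN N0 PN]]; exists N; split; first by move=> p Pp; exact: PN.
have := @ae_ysection_null _ _ _ _ R mu2s mu1s N mN N0.
apply: ae_imp => z Nz.
have mNz : @measurable _ (RT * RT)%type (ysection N z) by exact: measurable_ysection.
have := @ae_ysection_null _ _ _ _ R mu1s mu1s (ysection N z) mNz Nz.
apply: ae_imp => y Ny; rewrite -[RHS]Ny; congr (mu _).
by apply/seteqP; split => x; rewrite /ysection/= ?in_setE/= /ysection/= ?in_setE.
Qed.

(* On almost every horizontal line the radius is a Lipschitz function of [x], so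
   that the null set of exceptional [x] gives a null set of radii. *)
Lemma ae_radial (U V : R -> R -> R) :
  {ae mu3, forall p, cylinder p -> radial3 U p = radial3 V p} ->
  {ae mu, forall z, 0 < z -> {ae mu, forall r, r \in `]0, 1[ -> U r z = V r z}}.
Proof.
move=> /ae_sections[N [HN]]; apply: ae_imp => z Nz z0.
(* The line of ordinate [y] meets only radii at least [y]; good ordinates below [1 / (k + 1)] for
   every [k] are needed to reach all radii in ]0, 1[. *)
have good k : exists y : R, 0 < y < harmonic k /\ mu [set x | N (x, y, z)] = 0%E.
  apply: contrapT => /forallNP hN.
  have : mu.-negligible `]0, harmonic k[%classic.
    apply: negligibleS Nz => y /=; rewrite in_itv/= => yk Ny.
    by apply: (hN y).
  move/negligibleP => /(_ (measurable_itv _)).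
  rewrite -[X in X = _ -> _]/(mu `]0, harmonic k[%classic) lebesgue_measure_itv/= lte_fin harmonic_gt0 -EFinB subr0 => -[] /eqP.
  by rewrite gt_eqF// harmonic_gt0.
have [Y HY] := choice good.
apply: (negligibleS _ (negligible_bigcup (fun k =>
  lipschitz_negligible (@sqrt_lipschitz (Y k)) (proj2 (HY k))))).
move=> r /= /not_implyP[]; rewrite in_itv/= => /andP[r0 r1] Ur.
have [k kr] : exists k, harmonic k < r.
  by have [n _ /(_ n (leqnn n)) /=] := near_infty_natSinv_lt (PosNum r0); exists n.
have [/andP[y0 yk] _] := HY k; have yr := lt_trans yk kr.
have q0 : 0 <= r ^+ 2 - Y k ^+ 2.
  by rewrite subr_ge0 ler_sqr ?nnegrE ?ltW.
exists k => //; exists (Num.sqrt (r ^+ 2 - Y k ^+ 2)); last first.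
  by rewrite sqr_sqrtr// subrK sqrtr_sqr gtr0_norm.
apply: HN => /=; apply/not_implyP; split.
  split => //=; rewrite /disk/= sqr_sqrtr// subrK.
  by rewrite expr_lt1// ltW.
by rewrite /radial3 /radial2/= sqr_sqrtr// subrK sqrtr_sqr gtr0_norm.
Qed.

(** On the ray of points [(r, 0, z)] with [0 < r < 1], the section is [radial3 U] composed with a
    measurable map; adding the two endpoints preserves measurability. *)
Lemma measurable_radial_section (U : R -> R -> R) (z : R) : 0 < z ->
  L2 mu3 cylinder (radial3 U) -> measurable_fun (`[0, 1]%classic : set R) (U ^~ z).
Proof.
move=> z0 [mU _].
apply/measurable_fun_itv_bndo_bndcP/measurable_fun_itv_obnd_cbndP.
have : measurable_fun (`]0, 1[%classic : set R) (radial3 U \o (fun r : R => (r, 0, z))).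
  apply: (measurable_comp (@mu3_measurable_cylinder R) _ mU).
    move=> _ [r /= + <-]; rewrite in_itv/= => /andP[r0 r1]; split => //.
    by rewrite /disk/= expr0n addr0 expr_lt1// ltW.
  apply: measurable_funTS; apply: (@measurable_fun_pair _ _ _ RT (RT * RT)%type RT) => //.
apply: eq_measurable_fun => r; rewrite inE/= in_itv/= => /andP[r0 r1].
by rewrite /radial3 /radial2/= expr0n addr0 sqrtr_sqr gtr0_norm.
Qed.

(** A single null set of heights serves all [n]: off it, the two sections agree for almost every
    [r], hence so do all their coefficients. *)
Lemma bessel_coef_ae (U V : R -> R -> R) :
  L2 mu3 cylinder (radial3 U) -> L2 mu3 cylinder (radial3 V) ->
  {ae mu3, forall p, cylinder p -> radial3 U p = radial3 V p} ->
  {ae mu, forall z, 0 < z -> forall n, bessel_coef (U ^~ z) n = bessel_coef (V ^~ z) n}.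
Proof.
move=> LU LV /ae_radial; apply: ae_imp => z UV z0 n.
have {}UV := UV z0; rewrite /bessel_coef /Rintegral; congr (_ * fine _ / _).
have mJ (W : R -> R -> R) : L2 mu3 cylinder (radial3 W) ->
    measurable_fun (`[0, 1]%classic : set R) (fun r : R => (W r z * besselJ 0 (bessel_zero n * r) * r)%:E).
  move=> LW; apply/measurable_EFinP; apply: measurable_funM => //.
  apply: measurable_funM; first exact: measurable_radial_section.
  by apply: measurable_funTS; apply: continuous_measurable_fun; exact: continuous_besselJ0Z.
apply: ae_eq_integral; [exact: measurable_itv|exact: mJ|exact: mJ|].
have n01 : mu.-negligible ([set 0] `|` [set 1] : set R).
  by apply: negligibleU; apply/negligibleP => //; exact: lebesgue_measure_set1.
apply: (negligibleS _ (negligibleU UV n01)) => r /= /not_implyP[].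
rewrite in_itv/= => /andP[r0 r1] Ur.
have [->|rn0] := eqVneq r 0; first by right; left.
have [->|rn1] := eqVneq r 1; first by right; right.
left; apply/not_implyP; split; first by rewrite in_itv/= !lt_neqAle r0 r1 rn1 eq_sym rn0.
by apply: contra_not Ur => ->.
Qed.

End Radial.

(** * The Dirichlet-to-Neumann map on a Bessel function *)

Lemma ae_and d (T : measurableType d) (R : realType) (m : {measure set T -> \bar R})
    (P Q : T -> Prop) : {ae m, forall x, P x} -> {ae m, forall x, Q x} ->
  {ae m, forall x, P x /\ Q x}.
Proof. by move=> hP hQ; apply: filterI. Qed.

Section RightDerivative.
Context {R : realType}.
Local Notation mu := (@lebesgue_measure R).

Lemma is_derive_right_quotient (f : R -> R) (d : R) : is_derive (0 : R) 1 f d ->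
  t^-1 * (f t - f 0) @[t --> 0^'+] --> d.
Proof.
move=> [df <-]; have /cvg_within_filter := df.
rewrite /derive => c.
have : (fun t : R => t^-1 *: ((f \o shift 0) (t *: 1) - f 0)) @ 0^'+ --> derive f 0 1.
  apply: cvg_trans df; apply: cvg_app.
  by apply: within_subset => t /= t0; rewrite gt_eqF.
apply: cvg_trans; apply: near_eq_cvg; apply: nearW => t.
by rewrite /= addr0 -[t *: 1]/(t * 1) mulr1.
Qed.

(** Functions continuous from the right that differ at [z] differ on some []z, z + e[], which has
    positive measure. Working on the right of [z] includes [z = 0], where the derivative is
    taken. *)
Lemma ae_eq_within_continuous (f g : R -> R) : {ae mu, forall z, 0 < z -> f z = g z} ->
  {within `[0, +oo[%classic, continuous f} -> {within `[0, +oo[%classic, continuous g} ->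
  forall z, 0 <= z -> f z = g z.
Proof.
move=> fg cf cg z z0.
have right (u : R -> R) : {within `[0, +oo[%classic, continuous u} -> u x @[x --> z^'+] --> u z.
  move=> /continuous_within_itvcyP[cu cu0]; move: z0; rewrite le_eqVlt => /orP[/eqP<-//|z0].
  by apply: cvg_at_right_filter; apply: cu; rewrite in_itv/= z0.
apply/eqP; rewrite -subr_eq0; apply/negPn/negP => fgz.
have : \forall x \near z^'+, f x - g x != 0.
  by apply: cvgr_neq0 fgz; apply: cvgB; exact: right.
move=> [e /= e0 He].
have : mu.-negligible `]z, z + e[%classic.
  apply: negligibleS fg => x /=; rewrite in_itv/= => /andP[zx xe] fgx.
  have := He x; rewrite /= distrC gtr0_norm ?subr_gt0// ltrBlDl => /(_ xe zx) /eqP.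
  by apply; rewrite fgx ?subrr// (le_lt_trans z0).
move/negligibleP => /(_ (measurable_itv _)).
rewrite -[X in X = _ -> _]/(mu `]z, z + e[%classic) lebesgue_measure_itv/= lte_fin ltrDl e0.
by rewrite -EFinB addrC addKr => -[] /eqP; rewrite gt_eqF.
Qed.

End RightDerivative.

Section DirichletToNeumann.
Context {R : realType}.
Local Notation R2 := (R * R)%type.
Local Notation mu := (@lebesgue_measure R).
Local Notation mu2 := (mu \x mu)%E.
Variables (h : R) (a : R2) (n : nat).
Hypotheses (h_gt0 : 0 < h) (a1_ge0 : 0 <= a.1) (a2_ge0 : 0 <= a.2).

Let l : R := bessel_zero n.
Let l_gt0 : 0 < l := bessel_zero_gt0 n.
Let l_zero : besselJ 0 l = 0 := besselJ0_bessel_zero n.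

(** Below the interface the positive part is the identity and the profile is smooth; the derivative
    at 0 is the one that enters the Dirichlet-to-Neumann map. *)
Lemma is_derive_profile (c rho z : R) : z < h ->
  is_derive z 1 (profile l h c rho) (profile' l h c rho z).
Proof.
move=> zh; have d1 := is_derive_fcomp (f := fun t => l * (h - t)) (is_derive_expR _) (is_derive_affine l h z).
have d2 := is_derive_fcomp (f := fun t => l * (h - t)) (is_derive_sinhR _) (is_derive_affine l h z).
have d := is_derive_fM (is_derive_fcst z c) (is_derive_fD d1 (is_derive_fM (is_derive_fcst z (rho - 1)) d2)).
have {d} : is_derive z 1 (fun t => c * (expR (l * (h - t)) + (rho - 1) * sinhR (l * (h - t))))
    (profile' l h c rho z).
  by apply: (is_derive_eq d); rewrite /profile' subr_gt0 zh; ring.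
apply: near_eq_is_derive; near=> t.
rewrite /profile pospart_ge// subr_ge0; apply: ltW; near: t; exact: lt_nbhsl.
Unshelve. all: by end_near. Qed.

Lemma bessel_coef_J0M (k : R) m :
  bessel_coef (fun r => besselJ 0 (l * r) * k) m = k * (m == n)%:R.
Proof.
rewrite -(bessel_coef_J0 n m) /bessel_coef.
transitivity (2 * (k * \int[mu]_(r in `[0, 1]%classic)
   (besselJ 0 (l * r) * besselJ 0 (bessel_zero m * r) * r)) / besselJ 1 (bessel_zero m) ^+ 2).
  congr (_ * _ / _); rewrite -RintegralZl.
  - by apply: eq_Rintegral => r _; ring.
  - exact: measurable_itv.
  - apply: continuous_compact_integrable; first exact: segment_compact.
    apply: continuous_subspaceT => r; apply: cvgM; last exact: cvg_id.
    by apply: cvgM; exact: continuous_besselJ0Z.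
by rewrite -/l; ring.
Qed.

Definition normalization : R :=
  (coshR (l * h) + contrast a * sinhR (l * h))^-1.

Let T : R := sinhR (l * h) / coshR (l * h).

Let s := profile l h normalization (contrast a).

Lemma coshR_gt0 (x : R) : 0 < coshR x.
Proof. by rewrite /coshR divr_gt0// addr_gt0 ?expR_gt0. Qed.

Lemma sinhR_gt0 (x : R) : 0 < x -> 0 < sinhR x.
Proof. by move=> x0; rewrite /sinhR divr_gt0// subr_gt0 ltr_expR; lra. Qed.

Let lh_gt0 : 0 < l * h := mulr_gt0 l_gt0 h_gt0.
Let a1_gt0 : 0 < 1 + a.1.
Proof. by rewrite ltr_wpDr. Qed.
Let a2_gt0 : 0 < 1 + a.2.
Proof. by rewrite ltr_wpDr. Qed.

Lemma contrast_gt0 : 0 < contrast a.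
Proof. by rewrite /contrast divr_gt0. Qed.

Lemma normalization_neq0 : coshR (l * h) + contrast a * sinhR (l * h) != 0.
Proof. by rewrite gt_eqF// addr_gt0 ?coshR_gt0// mulr_gt0 ?contrast_gt0 ?sinhR_gt0. Qed.

Lemma profile_normalized : s 0 = 1.
Proof. by rewrite /s profile0// /normalization mulVf// normalization_neq0. Qed.

(** The flux at 0 is [l * k_2 * (sinh + rho * cosh) / (cosh + rho * sinh)] at [l * h], with
    [rho = k_1 / k_2]; division by the hyperbolic cosine gives the admittance at [T]. *)
Lemma flux_normalized : - (1 + a.2) * profile' l h normalization (contrast a) 0 =
  l * admittance T (1 + a.1) (1 + a.2).
Proof.
rewrite profile'0// /admittance /T /normalization /contrast.
have c0 := coshR_gt0 (l * h); have sh0 := sinhR_gt0 lh_gt0.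
move: (coshR _) (sinhR _) c0 sh0 => C S C0 S0.
field; rewrite !gt_eqF//=; do ?[rewrite addr_gt0// mulr_gt0//].
Qed.

Lemma explicit_solves :
  weak_solution h a (fun r => besselJ 0 (l * r)) (explicit_sol l h a normalization).
Proof.
have := @explicit_weak_solution _ _ h _ l_gt0 l_zero a1_ge0 a2_ge0 normalization.
by rewrite -/s profile_normalized; under [X in weak_solution _ _ X _]eq_fun do rewrite mul1r.
Qed.

Lemma bessel_coef_explicit (z : R) m :
  bessel_coef (explicit_sol l h a normalization ^~ z) m = s z * (m == n)%:R.
Proof. exact: bessel_coef_J0M. Qed.

Lemma continuous_sM (k : R) : {within `[0, +oo[%classic, continuous (fun z => s z * k)}.
Proof.
apply: continuous_subspaceT => z; apply: cvgMl; exact: continuous_profile.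
Qed.

Lemma cvg_sM (k : R) : t^-1 * (s t * k - s 0 * k) @[t --> 0^'+] -->
  profile' l h normalization (contrast a) 0 * k.
Proof.
apply: is_derive_right_quotient.
have d := is_derive_fM (is_derive_profile normalization (contrast a) h_gt0) (is_derive_fcst 0 k).
by apply: (is_derive_eq d); rewrite mulr0 addr0.
Qed.

Lemma L2_J0 : L2 mu2 disk (radial2 (fun r => besselJ 0 (l * r))).
Proof.
have := L2_bottom l 1; rewrite (_ : (fun q => _) = radial2 (fun r => besselJ 0 (l * r)))//.
by apply/funext => q; rewrite /radial2 besselJ0_sqrt ?addr_ge0 ?sqr_ge0// mulr1.
Qed.

(** [DN] picks a sequence satisfying [is_DN] and would default to 0 if there were none, so the proof
    shows that [is_DN] holds of exactly one sequence. *)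
Lemma DN_bessel m : DN h a (fun r => besselJ 0 (l * r)) m =
  (m == n)%:R * (l * admittance T (1 + a.1) (1 + a.2)).
Proof.
pose f (r : R) := besselJ 0 (l * r).
pose c0 (m : nat) : R := (m == n)%:R * (l * admittance T (1 + a.1) (1 + a.2)).
suff E : [set c0] = is_DN h a f.
  rewrite /DN -/f -E.
  by have /= -> := @xgetPex _ (fun=> 0) [set c0] (ex_intro _ c0 erefl).
apply/seteqP; split => [_ ->|c [U sU HU]].
  exists (explicit_sol l h a normalization); first exact: explicit_solves.
  move=> k; exists (fun z => s z * (k == n)%:R).
  exists (profile' l h normalization (contrast a) 0 * (k == n)%:R); split.
  - by apply: aeW => z _; rewrite bessel_coef_explicit.
  - exact: continuous_sM.
  - exact: cvg_sM.
  - by rewrite /c0 -flux_normalized; ring.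
have sE := explicit_solves.
have LU W : weak_solution h a f W -> L2 (mu2 \x mu)%E cylinder (radial3 W) by move=> [Du [[]]].
have UE := bessel_coef_ae (LU _ sU) (LU _ sE)
  (weak_solution_unique a1_ge0 a2_ge0 L2_J0 sU sE).
apply/funext => k; have [w [d [wU cw dw ->]]] := HU k.
(* Weak solutions agree almost everywhere only, but [w] is continuous on [0, oo[: it is therefore
   known everywhere there, 0 included, which determines its right derivative. *)
have wE z : 0 <= z -> w z = s z * (k == n)%:R.
  move: z; apply: ae_eq_within_continuous => //; last exact: continuous_sM.
  have : {ae mu, forall z, (0 < z -> w z = bessel_coef (U ^~ z) k) /\
     (0 < z -> forall n0, bessel_coef (U ^~ z) n0 = bessel_coef (explicit_sol l h a normalization ^~ z) n0)}.
    exact: (ae_and wU UE).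
  by apply: ae_imp => z [h1 h2] z0; rewrite h1// h2// bessel_coef_explicit.
have dw' : t^-1 * (w t - w 0) @[t --> 0^'+] --> profile' l h normalization (contrast a) 0 * (k == n)%:R.
  have cs := @cvg_sM (k == n)%:R.
  apply: cvg_trans cs.
  apply: near_eq_cvg; near=> t.
  by rewrite !wE//; apply: ltW; near: t; exact: nbhs_right_gt.
have -> : d = profile' l h normalization (contrast a) 0 * (k == n)%:R.
  by apply: (cvg_unique _ dw dw').
by rewrite /c0 -flux_normalized; ring.
Unshelve. all: by end_near. Qed.

End DirichletToNeumann.

(** * Lower bounds for the operator norm *)

Section OperatorNorm.
Context {R : realType}.
Local Notation J1 n := (besselJ 1 (bessel_zero n : R)).

Lemma bessel_norm_single (s x : R) n (c : nat -> R) : (forall k, k != n -> c k = 0) ->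
  c n = x ->
  bessel_norm s c = (Num.sqrt ((1 + bessel_zero n ^+ 2) `^ s * x ^+ 2 * J1 n ^+ 2))%:E.
Proof.
move=> c0 cn; rewrite /bessel_norm (@nneseriesD1 R _ n xpredT)//; last first.
  by move=> k _; rewrite lee_fin (mulr_ge0 (mulr_ge0 (powR_ge0 _ _) (sqr_ge0 _)) (sqr_ge0 _)).
rewrite eseries0 ?adde0 ?cn//.
by move=> k _ kn; rewrite c0// expr0n mulr0 mul0r.
Qed.

Definition tanhR (x : R) : R := sinhR x / coshR x.

Definition half_weight n : R := (1 + bessel_zero n ^+ 2) `^ (1 / 2).

Lemma half_weight_gt0 n : 0 < half_weight n.
Proof. by rewrite powR_gt0// ltr_wpDr ?sqr_ge0. Qed.

(** Tested on one mode, both norms have a single term. With weight [w = half_weight n], the quotient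
    is that of [lambda |D| |J_1| / sqrt w] by [sqrt w |J_1|]. *)
Lemma DN_op_norm_ge (h : R) (a b : R * R) n : 0 < h ->
  0 <= a.1 -> 0 <= a.2 -> 0 <= b.1 -> 0 <= b.2 ->
  ((bessel_zero n / half_weight n *
     `|admittance (tanhR (bessel_zero n * h)) (1 + a.1) (1 + a.2) -
       admittance (tanhR (bessel_zero n * h)) (1 + b.1) (1 + b.2)|)%:E <=
   op_norm (fun f n => (DN h a f n - DN h b f n)%R))%E.
Proof.
move=> h0 a1 a2 b1 b2.
set D := admittance _ _ _ - admittance _ _ _.
pose f (r : R) := besselJ 0 (bessel_zero n * r).
have l0 := bessel_zero_gt0 n : 0 < bessel_zero n :> R.
have J0 : J1 n != 0 := besselJ1_neq0 l0 (besselJ0_bessel_zero n).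
have w0 := half_weight_gt0 n.
have n1 : bessel_norm (1 / 2) (bessel_coef f) = (Num.sqrt (half_weight n * J1 n ^+ 2))%:E.
  rewrite (@bessel_norm_single _ 1 n) ?expr1n ?mulr1// => [k kn|];
    by rewrite bessel_coef_J0 ?(negbTE kn) ?eqxx.
have q0 : 0 < half_weight n * J1 n ^+ 2 by rewrite mulr_gt0// exprn_even_gt0.
apply: ereal_sup_ubound; exists f.
  split; last by rewrite n1 eqe sqrtr_eq0 -ltNge.
  by split; [exact: L2_J0|rewrite n1 ltry].
rewrite n1 (@bessel_norm_single _ (bessel_zero n * D) n).
- rewrite /= -EFinM; congr (_%:E).
  have -> : (1 + bessel_zero n ^+ 2) `^ (- (1 / 2)) = (half_weight n)^-1 :> R by rewrite powRN.
  have -> : (half_weight n)^-1 * (bessel_zero n * D) ^+ 2 * J1 n ^+ 2 =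
     (bessel_zero n / half_weight n * D) ^+ 2 * (half_weight n * J1 n ^+ 2).
    by field; rewrite gt_eqF.
  rewrite sqrtrM ?sqr_ge0// sqrtr_sqr mulfK ?gt_eqF ?sqrtr_gt0//.
  by rewrite normrM ger0_norm// divr_ge0 ?ltW.
- by move=> k kn; rewrite !DN_bessel// (negbTE kn) !mul0r subrr.
- by rewrite !DN_bessel// eqxx !mul1r -mulrBr.
Qed.

Lemma tanhR_lt (x y : R) : x < y -> tanhR x < tanhR y.
Proof.
move=> xy; rewrite /tanhR ltr_pdivrMr ?coshR_gt0// mulrAC ltr_pdivlMr ?coshR_gt0//.
rewrite /sinhR /coshR.
have e1 : expR x < expR y by rewrite ltr_expR.
have e2 : expR (- y) < expR (- x) by rewrite ltr_expR ltrN2.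
(* With the denominators cleared, the claim amounts to [exp (x - y) < exp (y - x)]. *)
have := ltr_pM (ltW (expR_gt0 x)) (ltW (expR_gt0 (- y))) e1 e2.
by lra.
Qed.

Lemma tanhR_le1 (x : R) : tanhR x <= 1.
Proof.
rewrite /tanhR ler_pdivrMr ?coshR_gt0// mul1r /sinhR /coshR.
by have := expR_ge0 (- x); lra.
Qed.

(** The larger of two numbers is at least half their sum, which turns 24 into 48. *)
Lemma two_modes_arith (S D0 D1 k0 k1 d K4 : R) : 0 < k0 -> 0 < k1 -> 0 <= D0 -> 0 <= D1 ->
  0 < K4 -> d * S <= 24 * K4 * (D0 + D1) ->
  d * Num.min k0 k1 / (48 * K4) * S <= Num.max (k0 * D0) (k1 * D1).
Proof.
move=> k00 k10 D00 D10 K0 H; set m := Num.min k0 k1.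
have m0 : 0 < m by rewrite lt_min k00.
have mk0 : m <= k0 by rewrite ge_min lexx.
have mk1 : m <= k1 by rewrite ge_min lexx orbT.
apply: (@le_trans _ _ (m * (D0 + D1) / 2)).
  have -> : d * m / (48 * K4) * S = m * (d * S) / (48 * K4) by ring.
  rewrite ler_pdivrMr ?mulr_gt0//.
  have -> : m * (D0 + D1) / 2 * (48 * K4) = m * (24 * K4 * (D0 + D1)) by field.
  by rewrite ler_pM2l.
have e0 : m * D0 <= k0 * D0 by rewrite ler_wpM2r.
have e1 : m * D1 <= k1 * D1 by rewrite ler_wpM2r.
rewrite le_max; case: (leP D0 D1) => D01; apply/orP; [right|left].
  by have := ler_wpM2l (ltW m0) D01; lra.
by have := ler_wpM2l (ltW m0) (ltW D01); lra.
Qed.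

End OperatorNorm.

Theorem theorem1p2 (R : realType) (h M : R) (h_gt0 : 0 < h) (M_gt0 : 0 < M) :
  exists2 C : R, 0 < C &
    forall a b : R * R,
      0 <= a.1 <= M -> 0 <= a.2 <= M -> 0 <= b.1 <= M -> 0 <= b.2 <= M ->
      ((C * (`|a.2 - b.2| + `|a.1 - b.1|))%:E
       <= op_norm (fun f n => (DN h a f n - DN h b f n)%R))%E.
Proof.
pose T n : R := tanhR (bessel_zero n * h).
pose k n : R := bessel_zero n / half_weight n.
have k0 n : 0 < k n by rewrite divr_gt0 ?bessel_zero_gt0 ?half_weight_gt0.
have [_ _ l01] := @bessel_zeroP R 0.
have T0 : 0 < T 0%N.
  by rewrite divr_gt0 ?coshR_gt0// sinhR_gt0// mulr_gt0// bessel_zero_gt0.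
(* The first two zeros being distinct, this gap makes the constant positive. The zeros are absolute
   numbers, so that the constant depends on [h] and [M] only. *)
have T01 : T 0%N < T 1%N by apply: tanhR_lt; rewrite ltr_pM2r.
have K0 : 0 < (1 + M) ^+ 4 by rewrite exprn_gt0// ltr_wpDl// ltW.
exists ((T 1%N - T 0%N) * Num.min (k 0%N) (k 1%N) / (48 * (1 + M) ^+ 4)).
  have m0 : 0 < Num.min (k 0%N) (k 1%N) by rewrite lt_min !k0.
  apply: divr_gt0; apply: mulr_gt0 => //; by rewrite subr_gt0.
move=> a b /andP[a1 a1M] /andP[a2 a2M] /andP[b1 b1M] /andP[b2 b2M].
pose D n := `|admittance (T n) (1 + a.1) (1 + a.2) - admittance (T n) (1 + b.1) (1 + b.2)|.
have bnd (x : R) : 0 <= x -> x <= M -> 1 <= 1 + x <= 1 + M.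
  by move=> x0 xM; rewrite lerDl x0 lerD2l.
have st : (T 1%N - T 0%N) * (`|a.2 - b.2| + `|a.1 - b.1|) <= 24 * (1 + M) ^+ 4 * (D 0%N + D 1%N).
  have := admittance_stable T0 T01 (tanhR_le1 _) (bnd _ a1 a1M) (bnd _ a2 a2M) (bnd _ b1 b1M) (bnd _ b2 b2M).
  have e (x y : R) : 1 + x - (1 + y) = x - y by ring.
  by rewrite !e.
apply: (@le_trans _ _ (Num.max (k 0%N * D 0%N) (k 1%N * D 1%N))%:E).
  rewrite lee_fin.
  exact: (two_modes_arith (k0 0%N) (k0 1%N) (normr_ge0 _) (normr_ge0 _) K0 st).
by rewrite EFin_max ge_max !DN_op_norm_ge.
Qed.
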